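(* Let $B$ be a tropical torus of dimension $n$, let $c\in C_j(B;\Lambda^kT_{\mathbb{Z}}B)$ and $\delta\in C^j(B;\Lambda^kT^*_{\mathbb{Z}}B)$. For any choices of splittings $\kappa:H_\bullet(F_b;\mathbb{Z})\to C_\bullet(F_b;\mathbb{Z})$ and $\kappa':H^\bullet(F_b;\mathbb{Z})\to C^\bullet(F_b;\mathbb{Z})$, the corresponding maps $\hat\phi=\hat\phi_\kappa$ and $\hat\psi=\hat\psi_{\kappa'}$ satisfy $$\int_c\delta=\int_{\hat\phi(c)}\hat\psi(\delta).$$
   Context: **Tropical torus and fibration.** $B=\mathbb{R}^n/\Gamma_1$ with $\Gamma_1\subset\mathbb{R}^n$ a full-rank lattice, together with a second full-rank lattice $\Gamma_2\subset\mathbb{R}^n$ defining the constant lattice $T_{\mathbb{Z}}B=\Gamma_2\subset TB$ and its dual $T^*_{\mathbb{Z}}B\subset T^*B$. $X(B)=T^*B/T^*_{\mathbb{Z}}B$; $b\in B$ is a fixed point, $F_b=(T^*B)_b/(T^*_{\mathbb{Z}}B)_b$ the fibre, and $t:X(B)\cong B\times F_b$ the trivialisation by parallel transport for the flat affine connection. **Tropical (co)chains.** $C_j(B;\Lambda^kT_{\mathbb{Z}}B)\cong C_j(B;\mathbb{Z})\otimes\Lambda^k(T_{\mathbb{Z}}B)_b$ are (smooth) singular $j$-chains with coefficients in $\Lambda^k\Gamma_2$. Elements of $C^j(B;\Lambda^kT^*_{\mathbb{Z}}B)$ are here finite sums $\alpha\otimes\eta$ with $\alpha\in\Lambda^k(T^*_{\mathbb{Z}}B)_b$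 and $\eta$ a $j$-form on $B$; likewise cochains on $F_b$ and $X(B)$ are represented by differential forms. The tropical pairing is $\int_{\beta\otimes\sigma}\alpha\otimes\eta=\alpha(\beta)\int_\sigma\eta$, extended bilinearly. **Identifications of coefficients.** Fix an orientation of the fibres and an oriented basis $v_1,\dots,v_n$ of $(T_{\mathbb{Z}}B)_b$, with dual basis $v_i^*$ of $(T^*_{\mathbb{Z}}B)_b=H_1(F_b;\mathbb{Z})$ and linear fibre coordinates $p_1,\dots,p_n$ on $F_b$ with respect to $v_1^*,\dots,v_n^*$. The isomorphism $\Lambda^k(T_{\mathbb{Z}}B)_b\cong\Lambda^{n-k}(T^*_{\mathbb{Z}}B)_b\cong H_{n-k}(F_b;\mathbb{Z})$ sends $v_{i_1}\wedge\dots\wedge v_{i_k}$ to $(-1)^{sgn(\mu)}v^*_{i_{k+1}}\wedge\dots\wedge v^*_{i_n}$, and the dual isomorphism $\Lambda^k(T^*_{\mathbb{Z}}B)_b\cong H^{n-k}(F_b;\mathbb{Z})$ sends $v^*_{i_1}\wedge\dots\wedge v^*_{i_k}$ to $(-1)^{sgn(\mu)}[dp_{i_{k+1}}\wedge\dots\wedge dp_{i_n}]$, where $\mu$ is the permutation $(1,\dots,n)\mapsto(i_1,\dots,i_n)$ and $(-1)^{sgn(\mu)}$ its sign. **The maps.** $\kappa:H_\bullet(F_b;\mathbb{Z})\to C_\bullet(F_b;\mathbb{Z})$ is a homomorphism with values in cycles with $[\kappa(x)]=x$; $\kappa':H^\bullet(F_b;\mathbb{Z})\to C^\bullet(F_b;\mathbb{Z})$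 is a homomorphism with values in closed forms with $[\kappa'(x)]=x$. The chain map $\hat\phi:C_\bullet(B;\Lambda^kT_{\mathbb{Z}}B)\to C_{\bullet+n-k}(X(B);\mathbb{Z})$ is the composition $$C_\bullet(B)\otimes H_{n-k}(F_b)\xrightarrow{(\mathrm{id},\kappa)}C_\bullet(B)\otimes C_{n-k}(F_b)\to C_{\bullet+n-k}(B\times F_b)\xrightarrow{(t^{-1})_*}C_{\bullet+n-k}(X(B)),$$ the middle map being the Eilenberg–Zilber cross product. The cochain map $\hat\psi:C^\bullet(B;\Lambda^kT^*_{\mathbb{Z}}B)\to C^{\bullet+n-k}(X(B))$ is the composition $$C^\bullet(B)\otimes H^{n-k}(F_b)\xrightarrow{(\mathrm{id},\kappa')}C^\bullet(B)\otimes C^{n-k}(F_b)\to C^{\bullet+n-k}(B\times F_b)\xrightarrow{t^*}C^{\bullet+n-k}(X(B)),$$ the middle map being the cross product $\eta\otimes\theta\mapsto \mathrm{pr}_B^*\eta\wedge\mathrm{pr}_{F_b}^*\theta$. *)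

(* Defs.v *)
From HB Require Import structures.
From mathcomp Require Import all_boot all_order all_fingroup all_algebra.
From mathcomp Require Import generic_quotient ring_quotient.
From mathcomp Require Import all_classical all_reals all_analysis.
From mathcomp Require Import freeg zify.

Set Implicit Arguments.
Unset Strict Implicit.
Unset Printing Implicit Defensive.

Import Order.TTheory GRing.Theory Num.Theory numFieldNormedType.Exports.
Local Open Scope quotient_scope.
Local Open Scope ring_scope.

Section Smooth.
Variable R : realType.

Fixpoint difft (k : nat) (d : nat) (f : 'rV[R]_d -> R) : Prop :=
  (forall x, differentiable f x) /\
  if k is k'.+1 then forall v, difft k' (fun x => 'D_v f x) else True.

(* C^oo: all iterated directional derivatives exist and are differentiable. *)
Definition smooth d (f : 'rV[R]_d -> R) : Prop := forall k, difft k f.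

Definition smooth_map d e (f : 'rV[R]_d -> 'rV[R]_e) : Prop :=
  forall i, smooth (fun x => f x 0 i).

Lemma difft_differentiable k d (f : 'rV[R]_d -> R) x :
  difft k f -> differentiable f x.
Proof. by case: k => [|k] []. Qed.

Lemma difftW k d (f : 'rV[R]_d -> R) : difft k.+1 f -> difft k f.
Proof.
elim: k f => [|k IH] f [df Df]; split=> // v.
exact/IH/Df.
Qed.

Lemma difft_cst k d (a : R) : difft k (fun _ : 'rV[R]_d => a).
Proof.
elim: k a => [|k IH] a; split=> //; move=> v.
have -> : (fun x => 'D_v (fun _ : 'rV[R]_d => a) x) = (fun=> 0).
  by apply/funext => x; rewrite derive_cst.
exact: IH.
Qed.

Lemma difftD k d (f g : 'rV[R]_d -> R) :
  difft k f -> difft k g -> difft k (fun x => f x + g x).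
Proof.
elim: k f g => [|k IH] f g [df Df] [dg Dg]; split=> //;
  try by move=> x; exact: differentiableD.
move=> v.
have -> : (fun x => 'D_v (fun y => f y + g y) x)
        = (fun x => 'D_v f x + 'D_v g x).
  by apply/funext => x; rewrite deriveD //; apply: diff_derivable.
apply: IH; [exact: Df | exact: Dg].
Qed.

Lemma difftM k d (f g : 'rV[R]_d -> R) :
  difft k f -> difft k g -> difft k (fun x => f x * g x).
Proof.
elim: k f g => [|k IH] f g kf kg; have [df Df] := kf; have [dg Dg] := kg;
  split=> //; try by move=> x; exact: differentiableM.
move=> v.
have -> : (fun x => 'D_v (fun y => f y * g y) x)
        = (fun x => f x * 'D_v g x + g x * 'D_v f x).
  by apply/funext => x; rewrite deriveM //; apply: diff_derivable.
apply: difftD; apply: IH; try exact: difftW; [exact: Dg | exact: Df].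
Qed.

Lemma differentiable_mulmxr d e (L : 'M[R]_(d, e)) (x : 'rV[R]_d) :
  differentiable (fun y => y *m L) x.
Proof.
have -> : (fun y : 'rV[R]_d => y *m L) =
    \sum_(i < d) (fun y : 'rV[R]_d => y 0 i *: row i L).
  by apply/funext => y; rewrite mulmx_sum_row fct_sumE.
apply: differentiable_sum => i; apply: differentiableZl.
exact: differentiable_coord.
Qed.

Lemma difft_mulmxr k d e (f : 'rV[R]_e -> R) (L : 'M[R]_(d, e)) :
  difft k f -> difft k (fun x => f (x *m L)).
Proof.
elim: k f => [|k IH] f [df Df]; split=> //.
- move=> x; apply: (differentiable_comp (differentiable_mulmxr L x)).
  exact: df.
- move=> x; apply: (differentiable_comp (differentiable_mulmxr L x)).
  exact: df.
move=> v; have -> : (fun x => 'D_v (fun y => f (y *m L)) x)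
        = (fun x => 'D_(v *m L) f (x *m L)).
  apply/funext => x; rewrite /derive; apply: (congr1 (fun g : R -> R => lim (g @ 0^')%classic)).
  by apply/funext => h /=; rewrite mulmxDl scalemxAl.
apply: (IH (fun y => 'D_(v *m L) f y)); exact: Df.
Qed.

Lemma smooth_cst d (a : R) : smooth (fun _ : 'rV[R]_d => a).
Proof. by move=> k; exact: difft_cst. Qed.

Lemma smoothD d (f g : 'rV[R]_d -> R) :
  smooth f -> smooth g -> smooth (fun x => f x + g x).
Proof. by move=> sf sg k; exact: difftD. Qed.

Lemma smoothM d (f g : 'rV[R]_d -> R) :
  smooth f -> smooth g -> smooth (fun x => f x * g x).
Proof. by move=> sf sg k; exact: difftM. Qed.

Lemma smooth_sum d (I : Type) (r : seq I) (f : I -> 'rV[R]_d -> R) :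
  (forall i, smooth (f i)) -> smooth (fun x => \sum_(i <- r) f i x).
Proof.
move=> sf; elim: r => [|i r IH].
  have -> : (fun x => \sum_(i <- [::]) f i x) = fun=> 0.
    by apply/funext => x; rewrite big_nil.
  exact: smooth_cst.
have -> : (fun x => \sum_(l <- i :: r) f l x)
        = (fun x => f i x + \sum_(l <- r) f l x).
  by apply/funext => x; rewrite big_cons.
exact: smoothD.
Qed.

Lemma smooth_mulmxr d e (f : 'rV[R]_e -> R) (L : 'M[R]_(d, e)) :
  smooth f -> smooth (fun x => f (x *m L)).
Proof. by move=> sf k; exact: difft_mulmxr. Qed.

Lemma smooth_coord d (i : 'I_d) : smooth (fun x : 'rV[R]_d => x 0 i).
Proof.
case=> [|k]; split=> //; try by move=> x; exact: differentiable_coord.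
move=> v.
have -> : (fun x => 'D_v (fun y : 'rV[R]_d => y 0 i) x) = fun=> v 0 i.
  apply/funext => x; rewrite /derive; apply: lim_near_cst => //.
  near=> h.
  rewrite /= !mxE addrK /GRing.scale /= mulrA mulVf ?mul1r //.
  near: h; exact: nbhs_dnbhs_neq.
exact: difft_cst.
Unshelve. all: by end_near. Qed.

Lemma smooth_map_comp_lin d e c (f : 'rV[R]_d -> 'rV[R]_e) (L : 'M[R]_(e, c)) :
  smooth_map f -> smooth_map (fun x => f x *m L).
Proof.
move=> sf i.
have -> : (fun x => (f x *m L) 0 i) = (fun x => \sum_l f x 0 l * L l i).
  by apply/funext => x; rewrite mxE.
apply: smooth_sum => l; apply: smoothM; [exact: sf | exact: smooth_cst].
Qed.

Lemma smooth_map_lin d e (L : 'M[R]_(d, e)) :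
  smooth_map (fun x : 'rV[R]_d => x *m L).
Proof. by apply: smooth_map_comp_lin => i; exact: smooth_coord. Qed.

Lemma smooth_map_row_mx d e1 e2 (f : 'rV[R]_d -> 'rV[R]_e1)
    (g : 'rV[R]_d -> 'rV[R]_e2) :
  smooth_map f -> smooth_map g -> smooth_map (fun x => row_mx (f x) (g x)).
Proof.
move=> sf sg i; case: (splitP i) => l il.
  have -> : (fun x => (row_mx (f x) (g x)) 0 i) = fun x => f x 0 l.
    apply/funext => x; rewrite -(row_mxEl (f x) (g x)); congr (row_mx _ _ _ _).
    exact/val_inj.
  exact: sf.
have -> : (fun x => (row_mx (f x) (g x)) 0 i) = fun x => g x 0 l.
  apply/funext => x; rewrite -(row_mxEr (f x) (g x)); congr (row_mx _ _ _ _).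
  exact/val_inj.
exact: sg.
Qed.

End Smooth.

Section Simplices.
Variable R : realType.

(* A flat manifold presented by its covering map from R^tdim; R^d / Gamma and
   products of such are the only instances used. *)
Record ftorus := FTorus {
  tdim : nat;
  tpt : Type;
  tcov : 'rV[R]_tdim -> tpt }.

(* A map of tori together with a linear lift to the coverings. *)
Record tmap (M N : ftorus) := TMap {
  tmap_fun :> tpt M -> tpt N;
  tmap_lin : 'M[R]_(tdim M, tdim N);
  tmap_cov : forall x, tmap_fun (tcov x) = tcov (x *m tmap_lin) }.

Definition prodT (M N : ftorus) : ftorus :=
  @FTorus (tdim M + tdim N) (tpt M * tpt N)
    (fun x => (tcov (lsubmx x), tcov (rsubmx x))).

Lemma pr1_cov (M N : ftorus) (x : 'rV[R]_(tdim (prodT M N))) :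
  (tcov x).1 = tcov (x *m (col_mx 1%:M 0 : 'M[R]_(tdim M + tdim N, tdim M))).
Proof. by rewrite -{2}[x]hsubmxK mul_row_col mulmx1 mulmx0 addr0. Qed.

Lemma pr2_cov (M N : ftorus) (x : 'rV[R]_(tdim (prodT M N))) :
  (tcov x).2 = tcov (x *m (col_mx 0 1%:M : 'M[R]_(tdim M + tdim N, tdim N))).
Proof. by rewrite -{2}[x]hsubmxK mul_row_col mulmx1 mulmx0 add0r. Qed.

Definition pr1T M N : tmap (prodT M N) M := TMap (@pr1_cov M N).
Definition pr2T M N : tmap (prodT M N) N := TMap (@pr2_cov M N).

(* The standard simplex, in barycentric coordinates. *)
Definition in_splx m (t : 'rV[R]_m.+1) : bool :=
  [forall i, 0 <= t 0 i] && (\sum_i t 0 i == 1).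

Definition splx m := {t : 'rV[R]_m.+1 | in_splx t}.

(* The affine map of simplices given on vertices by f. *)
Definition vertex_mx m p (f : 'I_m.+1 -> 'I_p.+1) : 'M[R]_(m.+1, p.+1) :=
  \matrix_(i, j) (f i == j)%:R.

Lemma in_splx_vertex m p (f : 'I_m.+1 -> 'I_p.+1) (t : splx m) :
  in_splx (val t *m vertex_mx f).
Proof.
case: t => t /= /andP[/forallP t0 /eqP t1]; apply/andP; split.
  apply/forallP => j; rewrite mxE; apply: sumr_ge0 => i _.
  by rewrite mxE mulr_ge0 ?ler0n.
apply/eqP; under eq_bigr do rewrite mxE.
rewrite exchange_big -[RHS]t1; apply: eq_bigr => i _ /=.
under eq_bigr do rewrite mxE.
rewrite (bigD1 (f i)) //= eqxx mulr1 big1 ?addr0 // => j /negPf.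
by rewrite eq_sym => ->; rewrite mulr0.
Qed.

Definition splx_map m p (f : 'I_m.+1 -> 'I_p.+1) (t : splx m) : splx p :=
  exist _ (val t *m vertex_mx f) (in_splx_vertex f t).

(* Smooth singular simplices. As the simplex is simply connected, a map to M
   is smooth if and only if it is the image of a smooth map to the covering. *)
Record simplex (M : ftorus) (m : nat) := Simplex {
  simplex_fun :> splx m -> tpt M;
  simplex_lift : exists2 g : 'rV[R]_m.+1 -> 'rV[R]_(tdim M),
    smooth_map g & forall t, simplex_fun t = tcov (g (val t)) }.

HB.instance Definition _ M m := gen_eqMixin (simplex M m).
HB.instance Definition _ M m := gen_choiceMixin (simplex M m).

Lemma simplexP M m (s u : simplex M m) :
  (forall t, s t = u t) -> s = u.
Proof.
case: s u => [s sP] [u uP] /= /funext su; subst u.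
by rewrite (Prop_irrelevance sP uP).
Qed.

Lemma linear_simplex_lift M m (W : 'M[R]_(m.+1, tdim M)) :
  exists2 g : 'rV[R]_m.+1 -> 'rV[R]_(tdim M), smooth_map g &
    forall t : splx m, @tcov M (val t *m W) = tcov (g (val t)).
Proof. by exists (fun t => t *m W) => //; exact: smooth_map_lin. Qed.

(* The image of the affine simplex whose vertices are the rows of W. *)
Definition linear_simplex M m (W : 'M[R]_(m.+1, tdim M)) : simplex M m :=
  Simplex (linear_simplex_lift W).

Lemma reparam_lift M m p (f : 'I_m.+1 -> 'I_p.+1) (s : simplex M p) :
  exists2 g : 'rV[R]_m.+1 -> 'rV[R]_(tdim M), smooth_map g &
    forall t, s (splx_map f t) = tcov (g (val t)).
Proof.
have [g sg gE] := simplex_lift s.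
exists (fun t => g (t *m vertex_mx f)) => [i|t]; last by rewrite gE.
exact/(smooth_mulmxr (f := fun y => g y 0 i))/sg.
Qed.

Definition reparam M m p (f : 'I_m.+1 -> 'I_p.+1) (s : simplex M p) :
  simplex M m := Simplex (reparam_lift f s).

Lemma spush_lift M N (f : tmap M N) m (s : simplex M m) :
  exists2 g : 'rV[R]_m.+1 -> 'rV[R]_(tdim N), smooth_map g &
    forall t, f (s t) = tcov (g (val t)).
Proof.
have [g sg gE] := simplex_lift s.
exists (fun t => g t *m tmap_lin f) => [|t]; last by rewrite gE tmap_cov.
exact: smooth_map_comp_lin.
Qed.

Definition spush M N (f : tmap M N) m (s : simplex M m) : simplex N m :=
  Simplex (spush_lift f s).

Lemma spair_lift M N m (s : simplex M m) (u : simplex N m) :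
  exists2 g : 'rV[R]_m.+1 -> 'rV[R]_(tdim (prodT M N)), smooth_map g &
    forall t, (s t, u t) = @tcov (prodT M N) (g (val t)).
Proof.
have [g sg gE] := simplex_lift s; have [h sh hE] := simplex_lift u.
exists (fun t => row_mx (g t) (h t)) => [|t].
  exact: smooth_map_row_mx.
by rewrite /= row_mxKl row_mxKr gE hE.
Qed.

Definition spair M N m (s : simplex M m) (u : simplex N m) :
  simplex (prodT M N) m :=
  @Simplex (prodT M N) m (fun t => (s t, u t)) (spair_lift s u).

Definition chain M m := {freeg (simplex M m)}.
HB.instance Definition _ M m := GRing.Zmodule.on (chain M m).

End Simplices.

Section Lift.
Variables (S : choiceType) (V : zmodType).

(* Additive extension of f to the free abelian group on S. *)
Definition chlift (f : S -> V) (c : {freeg S}) : V :=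
  \sum_(s <- dom c) f s *~ coeff s c.

Lemma chliftE (f : S -> V) (c : {freeg S}) :
  chlift f c = fglift (f : S -> zmodule V) c.
Proof.
pose f' : S -> zmodule V := f.
pose F : {additive {freeg S} -> zmodule V} :=
  HB.pack (fglift f') (GRing.isZmodMorphism.Build _ _ _ (lift_is_additive f')).
rewrite -[RHS]/(F c) -{2}(freeg_sumE c) raddf_sum /chlift /=.
by apply: eq_bigr => s _; rewrite liftU.
Qed.

Lemma chlift_is_additive f : zmod_morphism (chlift f).
Proof. by move=> c e; rewrite !chliftE lift_is_additive. Qed.

HB.instance Definition _ f :=
  GRing.isZmodMorphism.Build {freeg S} V (chlift f) (chlift_is_additive f).

Lemma chliftU f s : chlift f << s >> = f s.
Proof. by rewrite chliftE liftU scale1r. Qed.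

End Lift.

Section Homology.
Variable R : realType.
Implicit Types M N : ftorus R.

Definition face M m (i : 'I_m.+2) (s : simplex M m.+1) : simplex M m :=
  reparam (fintype.lift i) s.

Definition boundary M m : chain M m.+1 -> chain M m :=
  chlift (fun s => \sum_(i < m.+2) << (-1) ^+ i *g face i s >>).
HB.instance Definition _ M m :=
  GRing.isZmodMorphism.Build _ _ (@boundary M m) (chlift_is_additive _).

Definition is_cycle M m : chain M m -> Prop :=
  if m is m'.+1 then fun c => boundary c = 0 else fun=> True.

Definition cycle_pred M m : {pred chain M m} := fun c => `[< is_cycle c >].

Lemma cycle_zmod_closed M m : zmod_closed (@cycle_pred M m).
Proof.
rewrite /cycle_pred; case: m => [|m].
  by split=> [|c e _ _]; apply/asboolP.
split=> [|c e /asboolP /= bc /asboolP /= be]; apply/asboolP => /=.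
  exact: raddf0.
by rewrite raddfB /= bc be subrr.
Qed.
HB.instance Definition _ M m :=
  GRing.isZmodClosed.Build _ (@cycle_pred M m) (@cycle_zmod_closed M m).

Record cycle M m := Cycle {
  cycle_chain :> chain M m; _ : cycle_chain \in @cycle_pred M m }.
HB.instance Definition _ M m := [isSub for @cycle_chain M m].
HB.instance Definition _ M m := [Choice of cycle M m by <:].
HB.instance Definition _ M m := [SubChoice_isSubZmodule of cycle M m by <:].

Definition boundary_pred M m : {pred cycle M m} :=
  fun z => `[< exists e : chain M m.+1, val z = boundary e >].

Lemma boundary_zmod_closed M m : zmod_closed (@boundary_pred M m).
Proof.
split=> [|c e /asboolP[c' Ec] /asboolP[e' Ee]]; apply/asboolP.
  by exists 0; rewrite !raddf0.
by exists (c' - e'); rewrite raddfB [RHS]raddfB /= -Ec -Ee.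
Qed.
HB.instance Definition _ M m :=
  GRing.isZmodClosed.Build _ (@boundary_pred M m) (@boundary_zmod_closed M m).

Definition homology M m := Quotient.quot (@boundary_pred M m).
HB.instance Definition _ M m := GRing.Zmodule.on (homology M m).

Definition hclass M m (z : cycle M m) : homology M m :=
  \pi_(homology M m) z.

Definition cpush M N (f : tmap M N) m : chain M m -> chain N m :=
  chlift (fun s => << spush f s >>).

End Homology.

Section Shuffles.

(* Subsets of {0, ..., n-1} of cardinality m, and their elements in
   increasing order. *)
Definition ksub (n m : nat) := {A : {set 'I_n} | #|A| == m}.

Definition kelt n m (A : ksub n m) (a : 'I_m) : 'I_n :=
  enum_val (cast_ord (esym (eqP (valP A))) a).

Lemma kcompl_subproof n m (A : ksub n m) : #|~: val A| == (n - m)%N.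
Proof. by rewrite cardsCs finset.setCK card_ord (eqP (valP A)). Qed.

Definition kcompl n m (A : ksub n m) : ksub n (n - m) :=
  exist _ (~: val A) (kcompl_subproof A).

Definition shuffle_fun n (A : {set 'I_n}) (a : 'I_n) : 'I_n :=
  nth a (enum A ++ enum (~: A)) a.

Lemma shuffle_inj n (A : {set 'I_n}) : injective (shuffle_fun A).
Proof.
have sz : size (enum A ++ enum (~: A)) = n.
  by rewrite size_cat -!cardE cardsC card_ord.
have un : uniq (enum A ++ enum (~: A)).
  rewrite cat_uniq !enum_uniq andbT /=; apply/hasPn => a.
  by rewrite !mem_enum finset.in_setC.
move=> a b; rewrite /shuffle_fun (set_nth_default a b) ?sz // => /eqP.
by rewrite nth_uniq ?sz // => /eqP/val_inj.
Qed.

(* The permutation (1,...,n) |-> (i_1,...,i_n) where i_1 < ... < i_m are the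
   elements of A and i_(m+1) < ... < i_n those of its complement. *)
Definition shuffle n (A : {set 'I_n}) : 'S_n := perm (@shuffle_inj n A).

End Shuffles.

Section Cross.
Variable R : realType.
Implicit Types M N : ftorus R.

(* The vertex map [0..n] -> [0..m] increasing exactly at the steps in A. *)
Definition staircase n m (A : {set 'I_n}) (i : 'I_n.+1) : 'I_m.+1 :=
  inord #|[set a in A | (a < i)%N]|.

(* Eilenberg-Zilber: the sum over (p,q)-shuffles. *)
Definition ez M N p q (s : simplex M p) (u : simplex N q) :
    chain (prodT M N) (p + q) :=
  \sum_(A : ksub (p + q) p)
    << (-1) ^+ shuffle (val A) *g
       spair (reparam (staircase p (val A)) s)
             (reparam (staircase q (~: val A)) u) >>.

Definition cross M N p q (c : chain M p) (e : chain N q) :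
    chain (prodT M N) (p + q) :=
  chlift (fun s => chlift (fun u => ez s u) e) c.

End Cross.

Section Forms.
Variable R : realType.
Implicit Types M N : ftorus R.

Definition set_row m d (A : 'M[R]_(m, d)) (i : 'I_m) (u : 'rV[R]_d) :
    'M[R]_(m, d) :=
  \matrix_(l, j) (if l == i then u 0 j else A l j).

(* A field of m-linear forms on the covering space; the m tangent vectors at
   a point are the rows of a matrix. *)
Definition preform M m := 'rV[R]_(tdim M) -> 'M[R]_(m, tdim M) -> R.

(* Smooth differential m-forms on M, as forms on the covering that are
   invariant under the deck transformations (tangent spaces are identified by
   translation). *)
Record is_form M m (w : preform M m) : Prop := IsForm {
  form_multilinear : forall x A i (a : R) u v,
    w x (set_row A i (a *: u + v)) =
      a * w x (set_row A i u) + w x (set_row A i v);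
  form_alternating : forall x A (s : 'S_m),
    w x (row_perm s A) = (-1) ^+ s * w x A;
  form_smooth : forall A, smooth (fun x => w x A);
  form_descends : forall x y, tcov (f := M) x = tcov y -> w x = w y }.

Definition form_pred M m : {pred preform M m} := fun w => `[< is_form w >].

Lemma smoothN d (f : 'rV[R]_d -> R) : smooth f -> smooth (fun x => - f x).
Proof.
move=> sf; have -> : (fun x => - f x) = (fun x => -1 * f x).
  by apply/funext => x; rewrite mulN1r.
by apply: smoothM => //; exact: smooth_cst.
Qed.

Lemma form_zmod_closed M m : zmod_closed (@form_pred M m).
Proof.
split=> [|w1 w2 /asboolP[l1 a1 s1 d1] /asboolP[l2 a2 s2 d2]]; apply/asboolP.
  split=> [x A i a u v|x A s|A|x y _] //=.
  - by rewrite !(mulr0, addr0).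
  - by rewrite mulr0.
  - exact: smooth_cst.
split=> [x A i a u v|x A s|A|x y xy] /=.
- by rewrite !fctE l1 l2 mulrBr opprD addrACA.
- by rewrite !fctE a1 a2 mulrBr.
- apply: (smoothD (f := fun x => w1 x A)) => //; exact: smoothN.
- by rewrite !fctE (d1 _ _ xy) (d2 _ _ xy).
Qed.
HB.instance Definition _ M m :=
  GRing.isZmodClosed.Build _ (@form_pred M m) (@form_zmod_closed M m).

Record dform M m := Form {
  form_val :> preform M m; _ : form_val \in @form_pred M m }.
HB.instance Definition _ M m := [isSub for @form_val M m].
HB.instance Definition _ M m := [Choice of dform M m by <:].
HB.instance Definition _ M m := [SubChoice_isSubZmodule of dform M m by <:].

Lemma formP M m (w : dform M m) : is_form w.
Proof. by case: w => w /= /asboolP. Qed.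

Definition mkform M m (w : preform M m) (wP : is_form w) : dform M m :=
  Form (asboolT wP).

(* Normalised so that dp_1 /\ ... /\ dp_m is the determinant. *)
Definition wedge_fun M p q (w1 : preform M p) (w2 : preform M q) :
    preform M (p + q) := fun x A =>
  (p`! * q`!)%:R^-1 * \sum_(s : 'S_(p + q)) (-1) ^+ s *
    w1 x (usubmx (row_perm s A)) * w2 x (dsubmx (row_perm s A)).

Lemma wedge_is_form M p q (w1 : dform M p) (w2 : dform M q) :
  is_form (wedge_fun w1 w2).
Proof.
have [l1 a1 s1 d1] := formP w1; have [l2 a2 s2 d2] := formP w2.
rewrite /wedge_fun; split=> [x A i a u v|x A s|A|x y xy].
- rewrite [a * _]mulrCA -mulrDr; congr (_ * _).
  rewrite mulr_sumr -big_split /=.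
  apply: eq_bigr => s _.
  have rp w : row_perm s (set_row A i w) = set_row (row_perm s A) ((s^-1)%g i) w.
    by apply/matrixP => k j; rewrite !mxE (canF_eq (permK s)).
  rewrite !rp; case: (splitP ((s^-1)%g i)) => l il.
    have us w : usubmx (set_row (row_perm s A) ((s^-1)%g i) w)
              = set_row (usubmx (row_perm s A)) l w.
      by apply/matrixP => k j; rewrite !mxE -val_eqE /= il.
    have ds w : dsubmx (set_row (row_perm s A) ((s^-1)%g i) w)
              = dsubmx (row_perm s A).
      apply/matrixP => k j; rewrite !mxE -val_eqE /= il.
      by rewrite gtn_eqF // ltn_addr.
    by rewrite !us !ds l1 mulrDr mulrDl mulrCA !mulrA.
  have ds w : dsubmx (set_row (row_perm s A) ((s^-1)%g i) w)
            = set_row (dsubmx (row_perm s A)) l w.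
    by apply/matrixP => k j; rewrite !mxE -val_eqE /= il eqn_add2l.
  have us w : usubmx (set_row (row_perm s A) ((s^-1)%g i) w)
            = usubmx (row_perm s A).
    apply/matrixP => k j; rewrite !mxE -val_eqE /= il.
    by rewrite ltn_eqF // ltn_addr.
  by rewrite !us !ds l2 mulrDr mulrCA.
- rewrite mulrCA; congr (_ * _); rewrite mulr_sumr.
  rewrite (reindex_inj (mulIg (s^-1)%g)) /=; apply: eq_bigr => r _.
  rewrite -row_permM -mulgA mulVg mulg1 odd_permM odd_permV signr_addb.
  by rewrite mulrA [_ * (-1) ^+ s]mulrC !mulrA.
- apply: smoothM; first exact: smooth_cst.
  apply: smooth_sum => s; apply: smoothM; last exact: s2.
  by apply: smoothM; [exact: smooth_cst | exact: s1].
- by rewrite (d1 _ _ xy) (d2 _ _ xy).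
Qed.

Definition fwedge M p q (w1 : dform M p) (w2 : dform M q) : dform M (p + q) :=
  mkform (wedge_is_form w1 w2).

Definition pullback_fun M N (f : tmap M N) m (w : preform N m) :
    preform M m :=
  fun x A => w (x *m tmap_lin f) (A *m tmap_lin f).

Lemma pullback_is_form M N (f : tmap M N) m (w : dform N m) :
  is_form (pullback_fun f w).
Proof.
have [lw aw sw dw] := formP w; rewrite /pullback_fun.
split=> [x A i a u v|x A s|A|x y xy].
- have sr z : set_row A i z *m tmap_lin f
            = set_row (A *m tmap_lin f) i (z *m tmap_lin f).
    apply/matrixP => k j; rewrite !mxE; have [->|ki] := eqVneq k i.
      by apply: eq_bigr => l _; rewrite mxE eqxx.
    by apply: eq_bigr => l _; rewrite mxE (negPf ki).
  by rewrite !sr mulmxDl -scalemxAl lw.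
- by rewrite row_permE -mulmxA -row_permE aw.
- have := smooth_mulmxr (tmap_lin f) (sw (A *m tmap_lin f)). exact.
- by rewrite (dw _ (y *m tmap_lin f)) // -!tmap_cov xy.
Qed.

Definition pullback M N (f : tmap M N) m (w : dform N m) : dform M m :=
  mkform (pullback_is_form f w).

Definition fcross M N p q (w : dform M p) (v : dform N q) :
    dform (prodT M N) (p + q) :=
  fwedge (pullback (pr1T M N) w) (pullback (pr2T M N) v).

Definition extd M m (w : preform M m) : preform M m.+1 := fun x A =>
  \sum_(i < m.+1) (-1) ^+ i * 'D_(row i A) (fun y => w y (row' i A)) x.

Lemma extd_is_additive M m (w1 w2 : dform M m) :
  extd (w1 - w2 : dform M m) = extd w1 - extd w2.
Proof.
apply/funext => x; apply/funext => A; rewrite /extd.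
rewrite !fctE -sumrB; apply: eq_bigr => i _; rewrite -mulrBr; congr (_ * _).
have [_ _ /(_ (row' i A)) s1 _] := formP w1.
have [_ _ /(_ (row' i A)) s2 _] := formP w2.
by rewrite -deriveB //; apply: diff_derivable; apply: (@difft_differentiable _ 0).
Qed.

Definition closed_pred M m : {pred dform M m} :=
  fun w => `[< extd w = (fun _ _ => 0) >].

Lemma closed_zmod_closed M m : zmod_closed (@closed_pred M m).
Proof.
split=> [|w1 w2 /asboolP E1 /asboolP E2]; apply/asboolP.
  by rewrite -(subrr (0 : dform M m)) extd_is_additive subrr.
by rewrite extd_is_additive E1 E2; apply/funext => x; apply/funext => A;
  rewrite !fctE subrr.
Qed.
HB.instance Definition _ M m :=
  GRing.isZmodClosed.Build _ (@closed_pred M m) (@closed_zmod_closed M m).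

Record closed_form M m := ClosedForm {
  closed_val :> dform M m; _ : closed_val \in @closed_pred M m }.
HB.instance Definition _ M m := [isSub for @closed_val M m].
HB.instance Definition _ M m := [Choice of closed_form M m by <:].
HB.instance Definition _ M m :=
  [SubChoice_isSubZmodule of closed_form M m by <:].

Definition is_exact M m : preform M m -> Prop :=
  if m is m'.+1 return preform M m -> Prop
  then fun w => exists v : dform M m', w = extd v
  else fun w => w = 0.

Definition exact_pred M m : {pred closed_form M m} :=
  fun w => `[< is_exact (form_val (closed_val w)) >].

Lemma exact_zmod_closed M m : zmod_closed (@exact_pred M m).
Proof.
rewrite /exact_pred; case: m => [|m] /=.
  split=> [|w1 w2 /asboolP /= E1 /asboolP /= E2]; apply/asboolP => //=.
  by rewrite E1 E2 subrr.
split=> [|w1 w2 /asboolP /= [v1 E1] /asboolP /= [v2 E2]]; apply/asboolP => /=.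
  by exists 0; rewrite -(subrr (0 : dform M m)) extd_is_additive subrr.
by exists (v1 - v2); rewrite extd_is_additive -E1 -E2.
Qed.
HB.instance Definition _ M m :=
  GRing.isZmodClosed.Build _ (@exact_pred M m) (@exact_zmod_closed M m).

Definition deRham M m := Quotient.quot (@exact_pred M m).
HB.instance Definition _ M m := GRing.Zmodule.on (deRham M m).

Definition dRclass M m (w : closed_form M m) : deRham M m := \pi_(deRham M m) w.

End Forms.

Section Integration.
Variable R : realType.
Implicit Types M N : ftorus R.

(* Iterated integral over { b >= y_0 >= y_1 >= ... >= y_(m-1) >= 0 }. *)
Fixpoint oint (m : nat) (b : R) : ('rV[R]_m -> R) -> R :=
  if m is m'.+1 return ('rV[R]_m -> R) -> R then
    fun f => Rintegral (@lebesgue_measure R) `[0, b]%classic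
      (fun y => oint y (fun z : 'rV[R]_m' => f (row_mx (y%:M : 'M[R]_1) z)))
  else fun f => f 0.

(* Row i is the edge e_(i+1) - e_i of the standard simplex. *)
Definition edge_mx m : 'M[R]_(m, m.+1) :=
  \matrix_(i, j) ((j == fintype.lift ord0 i)%:R - (j == widen_ord (leqnSn m) i)%:R).

(* Orientation-preserving parametrisation of the standard simplex by
   1 >= y_0 >= ... >= y_(m-1) >= 0. *)
Definition bary m (y : 'rV[R]_m) : 'rV[R]_m.+1 :=
  delta_mx 0 0 + y *m edge_mx m.

(* Integral over the simplex of the pullback of w by the lift g. *)
Definition lift_int M m (g : 'rV[R]_m.+1 -> 'rV[R]_(tdim M)) (w : preform M m) :
    R :=
  oint 1 (fun y =>
    w (g (bary y)) (\matrix_(i < m) 'D_(row i (edge_mx m)) g (bary y))).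

Definition slift M m (s : simplex M m) : 'rV[R]_m.+1 -> 'rV[R]_(tdim M) :=
  s2val (cid2 (simplex_lift s)).

Definition sint M m (s : simplex M m) (w : dform M m) : R :=
  lift_int (slift s) w.

Definition chint M m (c : chain M m) (w : dform M m) : R :=
  chlift (fun s => sint s w) c.

End Integration.

Section Tori.
Variable R : realType.

(* The lattice spanned by the rows of G. *)
Definition lat d (G : 'M[R]_d) : {pred 'rV[R]_d} :=
  fun x => `[< exists z : 'rV[int]_d, x = map_mx intr z *m G >].

Lemma lat_zmod_closed d (G : 'M[R]_d) : zmod_closed (lat G).
Proof.
split=> [|x y /asboolP[z ->] /asboolP[w ->]]; apply/asboolP.
  by exists 0; rewrite raddf0 mul0mx.
by exists (z - w); rewrite raddfB mulmxBl.
Qed.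
HB.instance Definition _ d (G : 'M[R]_d) :=
  GRing.isZmodClosed.Build _ (lat G) (lat_zmod_closed G).

Definition quotT d (G : 'M[R]_d) : ftorus R :=
  @FTorus R d (Quotient.quot (lat G)) (\pi_(Quotient.quot (lat G))).

Lemma quotT_covE d (G : 'M[R]_d) (x y : 'rV[R]_d) :
  tcov (f := quotT G) x = tcov (f := quotT G) y <-> x - y \in lat G.
Proof. by rewrite Quotient.idealrBE; split=> /eqP. Qed.

Section Parallelotope.
Variables (d : nat) (G : 'M[R]_d).

(* Vertices of the simplex of the parallelotope spanned by the rows of G in J,
   taken in the order given by s. *)
Definition par_mx m (J : ksub d m) (s : 'S_m) : 'M[R]_(m.+1, d) :=
  \matrix_(i < m.+1) \sum_(a < m | (a < i)%N) row (kelt J (s a)) G.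

(* The triangulated cube y |-> \sum_a y_a g_a, a in J, modulo the lattice: the
   Pontrjagin product of the loops g_a. *)
Definition par_chain m (J : ksub d m) : chain (quotT G) m :=
  \sum_(s : 'S_m)
    << (-1) ^+ s *g linear_simplex (M := quotT G) (par_mx J s) >>.

Lemma face_linear m (W : 'M[R]_(m.+2, d)) (i : 'I_m.+2) :
  face i (linear_simplex (M := quotT G) W) =
  linear_simplex (M := quotT G) (row' i W).
Proof.
apply: simplexP => t; congr (tcov (f := quotT G) _).
rewrite /= -mulmxA; congr (_ *m _); apply/matrixP => k j; rewrite !mxE.
rewrite (bigD1 (fintype.lift i k)) //= mxE eqxx mul1r big1 ?addr0 // => l.
by rewrite mxE eq_sym => /negPf ->; rewrite mul0r.
Qed.

Lemma linear_simplex_translate m (W W' : 'M[R]_(m.+1, d)) (u : 'rV[R]_d) :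
  u \in lat G -> (forall i, row i W = row i W' + u) ->
  linear_simplex (M := quotT G) W = linear_simplex (M := quotT G) W'.
Proof.
move=> uG WW'; apply: simplexP => t /=; apply/quotT_covE.
rewrite !mulmx_sum_row -sumrB.
under eq_bigr do rewrite WW' scalerDr addrC addKr.
by case: t => t /= /andP[_ /eqP t1]; rewrite -scaler_suml t1 scale1r.
Qed.

Lemma row_lat i : row i G \in lat G.
Proof.
apply/asboolP; exists (delta_mx 0 i); rewrite rowE; congr (_ *m _).
by apply/matrixP => k j; rewrite !mxE; case: (_ && _).
Qed.

Lemma freeg_self_opp (S : choiceType) (c : {freeg S}) : c = - c -> c = 0.
Proof.
move=> cN; apply/eqP/freeg_eqP => s; rewrite coeff0.
have : coeff s c = - coeff s c by rewrite {1}cN coeffN.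
by move/eqP; rewrite -addr_eq0 -mulr2n mulrn_eq0 => /eqP.
Qed.

Lemma freegU_cancel (S : choiceType) (a : int) (s : S) :
  << a *g s >> + << - a *g s >> = 0 :> {freeg S}.
Proof. by rewrite freegUD subrr freegU0. Qed.

Lemma chlift_scaleU (S : choiceType) (V : zmodType) (f : S -> V) z s :
  chlift f << z *g s >> = f s *~ z.
Proof. by rewrite chliftE liftU. Qed.

Lemma inner_face_cancel m (J : ksub d m.+1) (i : 'I_m.+2) :
  (0 < i < m.+1)%N ->
  \sum_(s : 'S_m.+1) << (-1) ^+ s *g
     linear_simplex (M := quotT G) (row' i (par_mx J s)) >> = 0
  :> chain (quotT G) m.
Proof.
move=> /andP[i0 im]; apply: freeg_self_opp.
have i1m : (i.-1 < m.+1)%N by rewrite (leq_ltn_trans (leq_pred i)).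
pose a := Ordinal i1m; pose b := Ordinal im.
have ab : a != b by rewrite -val_eqE /= -[X in _ != X](prednK i0) ltn_eqF.
pose tau := tperm a b.
rewrite {1}(reindex_inj (mulgI tau)) -sumrN; apply: eq_bigr => s _ /=.
rewrite odd_mul_tperm ab addTb signrN freegUN; congr << _ *g linear_simplex _ >>.
apply/matrixP => l j; rewrite !mxE !summxE.
rewrite (reindex_inj (perm_inj (s := tau))) /=.
apply: eq_big => [c|c _]; last by rewrite permM tpermK.
have [il|il] := leqP i l; rewrite /tau; case: tpermP => [->|->|//] /=;
  rewrite /bump; lia.
Qed.

Lemma outer_face_cancel m (J : ksub d m.+1) :
  \sum_(s : 'S_m.+1) << (-1) ^+ s *g
     linear_simplex (M := quotT G) (row' ord0 (par_mx J s)) >> +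
  (\sum_(s : 'S_m.+1) << (-1) ^+ s *g
     linear_simplex (M := quotT G) (row' ord_max (par_mx J s)) >>)
    *~ (-1) ^+ m.+1 = 0 :> chain (quotT G) m.
Proof.
pose c : 'S_m.+1 := lift_perm ord_max ord0 1.
have oc : (-1) ^+ c = (-1) ^+ m :> int.
  by rewrite odd_lift_perm odd_perm1 addbF /= addbF signr_odd.
rewrite [X in X *~ _](reindex_inj (mulgI c)) mulrz_suml -big_split /=.
apply: big1 => s _.
rewrite freeg_mulz mulrzz odd_permM signr_addb oc.
rewrite mulrAC exprS mulN1r mulrN -expr2 sqrr_sign mulN1r.
have -> : linear_simplex (M := quotT G) (row' ord0 (par_mx J s)) =
          linear_simplex (M := quotT G) (row' ord_max (par_mx J (c * s)%g)).
  apply: (linear_simplex_translate (row_lat (kelt J (s ord0)))) => i.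
  apply/rowP => j; rewrite !mxE !summxE.
  rewrite big_mkcond big_ord_recl [in RHS]big_mkcond big_ord_recr /=.
  have -> : (m < bump m.+1 i)%N = false by rewrite /bump; have := ltn_ord i; lia.
  rewrite addr0 addrC mxE; congr (_ + _); apply: eq_bigr => k _.
  have -> : (c * s)%g (widen_ord (leqnSn m) k) = s (fintype.lift ord0 k).
    rewrite permM; congr (s _).
    have -> : widen_ord (leqnSn m) k = fintype.lift ord_max k.
      by apply: val_inj; rewrite /= /bump leqNgt ltn_ord.
    by rewrite lift_perm_lift perm1.
  have -> : (bump 0 k < bump 0 i)%N = (k < bump m.+1 i)%N.
    by rewrite /bump; have := ltn_ord i; lia.
  by [].
exact: freegU_cancel.
Qed.

Lemma boundary_par m (J : ksub d m.+1) :
  boundary (par_chain J) = \sum_(i < m.+2)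
    (\sum_(s : 'S_m.+1) << (-1) ^+ s *g
       linear_simplex (M := quotT G) (row' i (par_mx J s)) >>) *~ (-1) ^+ i
  :> chain (quotT G) m.
Proof.
rewrite [LHS]raddf_sum.
transitivity (\sum_(s : 'S_m.+1) \sum_(i < m.+2)
    << (-1) ^+ s *g linear_simplex (M := quotT G) (row' i (par_mx J s)) >>
      *~ (-1) ^+ i : chain (quotT G) m).
  apply: eq_bigr => s _; rewrite [LHS]chlift_scaleU mulrz_suml.
  apply: eq_bigr => i _; rewrite face_linear !freeg_mulz.
  by rewrite !mulrzz mulrC.
rewrite exchange_big; apply: eq_bigr => i _.
by rewrite mulrz_suml.
Qed.

Lemma par_chain_is_cycle m (J : ksub d m) : is_cycle (par_chain J).
Proof.
case: m J => [//|m] J; apply: (etrans (boundary_par J)).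
rewrite big_ord_recl big_ord_recr [X in _ + (X + _)]big1 => [|i _].
  have -> : fintype.lift ord0 ord_max = ord_max :> 'I_m.+2 by exact/val_inj.
  rewrite [X in _ + X = _]add0r expr0 mulr1z; exact: outer_face_cancel.
rewrite inner_face_cancel ?mul0rz // lift0 /=; have := ltn_ord i; lia.
Qed.

Definition par_cycle m (J : ksub d m) : cycle (quotT G) m :=
  Cycle (asboolT (par_chain_is_cycle J)).

End Parallelotope.
End Tori.

Section TorusCohomology.
Variables (R : realType) (d : nat) (G : 'M[R]_d).

(* dp_J, where p are the linear coordinates x = p *m G on R^d. *)
Definition dp_fun m (J : ksub d m) : preform (quotT G) m := fun=> fun A =>
  \det (\matrix_(a < m, b < m) (A *m invmx G) a (kelt J b)).

Lemma dp_is_form m (J : ksub d m) : is_form (dp_fun J).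
Proof.
rewrite /dp_fun; split=> [x A i a u v|x A s|A|//].
- set B := fun w => \matrix_(k, b) (set_row A i w *m invmx G) k (kelt J b).
  have rB w : row i (B w) = \row_b (w *m invmx G) 0 (kelt J b).
    apply/rowP => b; rewrite !mxE; apply: eq_bigr => l _.
    by rewrite mxE eqxx.
  have rB' w : row' i (B w) = row' i (B v).
    apply/matrixP => k b; rewrite !mxE; apply: eq_bigr => l _.
    by rewrite !mxE eq_sym (negPf (neq_lift _ _)).
  rewrite -[X in _ = _ + X]mul1r; apply: (determinant_multilinear (i0 := i)).
  + rewrite !rB; apply/rowP => b; rewrite !mxE mul1r mulr_sumr -big_split /=.
    by apply: eq_bigr => l _; rewrite !mxE mulrDl mulrA.
  + exact: (etrans (rB' u) (esym (rB' _))).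
  + exact: (etrans (rB' v) (esym (rB' _))).
- rewrite (_ : \matrix_(_, _) _ =
    row_perm s (\matrix_(k, b) (A *m invmx G) k (kelt J b))).
    by rewrite row_permE det_mulmx det_perm.
  apply/matrixP => k b; rewrite !mxE; apply: eq_bigr => l _; by rewrite mxE.
- exact: smooth_cst.
Qed.

Definition dp m (J : ksub d m) : dform (quotT G) m := mkform (dp_is_form J).

Lemma dp_closed m (J : ksub d m) : dp J \in @closed_pred _ (quotT G) m.
Proof.
apply/asboolP/funext => x; apply/funext => A; apply: big1 => i _.
by rewrite derive_cst mulr0.
Qed.

Definition dp_closed_form m (J : ksub d m) : closed_form (quotT G) m :=
  ClosedForm (dp_closed J).

End TorusCohomology.

Section ExteriorPowers.

(* The exterior power Lambda^k(Z^n); the coordinates are with respect to the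
   basis e_I = e_(i_1) /\ ... /\ e_(i_k), i_1 < ... < i_k. *)
Definition ext (n k : nat) := {ffun ksub n k -> int}.
HB.instance Definition _ n k := GRing.Zmodule.on (ext n k).

Definition ext_basis n k (I : ksub n k) : ext n k := [ffun J => (J == I)%:R].

(* Evaluation of Lambda^k of the dual lattice on Lambda^k, in dual bases. *)
Definition ext_eval n k (alpha beta : ext n k) : int :=
  \sum_I alpha I * beta I.

(* e_I |-> sgn(mu) e^*_(I^c), with mu the permutation (I, I^c). *)
Definition ext_compl n k (alpha : ext n k) : ext n (n - k) :=
  \sum_(I : ksub n k)
    ext_basis (kcompl I) *~ (alpha I * (-1) ^+ shuffle (val I)).

Lemma ext_compl_basis n k (alpha : ext n k) :
  ext_compl alpha = \sum_I ext_compl (ext_basis I) *~ alpha I.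
Proof.
apply: eq_bigr => I _; rewrite /ext_compl (bigD1 I) //= big1 => [|J JI].
  by rewrite addr0 ffunE eqxx mul1r mulrC mulrzA.
by rewrite ffunE (negPf JI) mul0r mulr0z.
Qed.

(* C (x) Lambda^k(Z^n), an element being given by its coordinates with respect
   to the basis (e_I) of the second factor. *)
Definition tens (C : zmodType) (n k : nat) := {ffun ksub n k -> C}.
HB.instance Definition _ C n k := GRing.Zmodule.on (tens C n k).

Definition pure (C : zmodType) n k (x : C) (beta : ext n k) : tens C n k :=
  [ffun I => x *~ beta I].

End ExteriorPowers.

Section Splittings.
Variables (R : realType) (n : nat) (G : 'M[R]_n).
Local Notation T := (quotT G).

(* The identification Lambda^m(lat G) ~ H_m(R^n / lat G; Z): g_J goes to the
   class of the m-torus spanned by the rows of G in J, in increasing order. *)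
Definition ext_homology m (x : ext n m) : homology T m :=
  \sum_(J : ksub n m) hclass (par_cycle G J) *~ x J.

Lemma ext_homology_is_additive m : zmod_morphism (@ext_homology m).
Proof.
move=> x y; rewrite -sumrB; apply: eq_bigr => J _.
by rewrite !ffunE mulrzBr.
Qed.
HB.instance Definition _ m := GRing.isZmodMorphism.Build _ _ (@ext_homology m)
  (@ext_homology_is_additive m).

Definition ext_deRham m (x : ext n m) : deRham T m :=
  \sum_(J : ksub n m) dRclass (dp_closed_form G J) *~ x J.

(* H^m(R^n / lat G; Z) has no torsion, and so is a lattice in de Rham
   cohomology; the classes [dp_J] are a basis. *)
Definition int_pred m : {pred deRham T m} :=
  fun h => `[< exists x : ext n m, h = ext_deRham x >].

Lemma int_zmod_closed m : zmod_closed (@int_pred m).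
Proof.
split=> [|h1 h2 /asboolP[x1 ->] /asboolP[x2 ->]]; apply/asboolP.
  by exists 0; rewrite [RHS]big1 // => J _; rewrite ffunE mulr0z.
exists (x1 - x2); rewrite -sumrB; apply: eq_bigr => J _.
by rewrite !ffunE mulrzBr.
Qed.
HB.instance Definition _ m :=
  GRing.isZmodClosed.Build _ (@int_pred m) (@int_zmod_closed m).

Record int_cohomology m := IntCohomology {
  int_class :> deRham T m; _ : int_class \in @int_pred m }.
HB.instance Definition _ m := [isSub for @int_class m].
HB.instance Definition _ m := [Choice of int_cohomology m by <:].
HB.instance Definition _ m := [SubChoice_isSubZmodule of int_cohomology m by <:].

Lemma ext_deRham_int m (x : ext n m) : ext_deRham x \in @int_pred m.
Proof. by apply/asboolP; exists x. Qed.

Definition ext_cohomology m (x : ext n m) : int_cohomology m :=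
  IntCohomology (ext_deRham_int x).

Definition is_cycle_splitting
    (kappa : forall m, {additive homology T m -> chain T m}) : Prop :=
  forall m (x : homology T m),
    exists z : cycle T m, kappa m x = cycle_chain z /\ hclass z = x.

Definition is_form_splitting
    (kappa' : forall m, {additive int_cohomology m -> dform T m}) : Prop :=
  forall m (x : int_cohomology m),
    exists w : closed_form T m, kappa' m x = closed_val w /\
      dRclass w = int_class x.

End Splittings.

Section TropicalTorus.
Variables (R : realType) (n : nat).
(* B = R^n / Gamma_1 with Gamma_1 = lat G1; the rows of V are the basis v_1, ..., v_n of Gamma_2. *)
Variables (G1 V : 'M[R]_n).

Definition tropB : ftorus R := quotT G1.

(* Covectors are row vectors, paired with vectors by the dot product. The rows
   are the dual basis v_1^*, ..., v_n^*. *)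
Definition dual_basis : 'M[R]_n := (invmx V)^T.

(* All cotangent spaces of B are identified with R^n by translation; this is
   parallel transport for the flat affine connection. *)
Definition tropF : ftorus R := quotT dual_basis.

(* T^*B / T^*_Z B, where T^*B = (R^n x R^n) / (Gamma_1 x 0). *)
Definition tropX : ftorus R :=
  @quotT R (n + n) (block_mx G1 0 0 dual_basis).

Lemma lat_block (x : 'rV[R]_(n + n)) :
  (x \in lat (block_mx G1 0 0 dual_basis)) =
  (lsubmx x \in lat G1) && (rsubmx x \in lat dual_basis).
Proof.
apply/asboolP/andP => [[z ->]|[/asboolP[z1 E1] /asboolP[z2 E2]]].
  rewrite -[z]hsubmxK map_row_mx mul_row_block !mulmx0 addr0 add0r.
  by rewrite row_mxKl row_mxKr; split; apply/asboolP; eexists.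
exists (row_mx z1 z2); rewrite map_row_mx mul_row_block !mulmx0 addr0 add0r.
by rewrite -E1 -E2 hsubmxK.
Qed.

Lemma trivial_cov (x : 'rV[R]_(n + n)) :
  @tcov R (prodT tropB tropF) (repr (@tcov R tropX x)) =
  @tcov R (prodT tropB tropF) (x *m (1%:M : 'M[R]_(n + n))).
Proof.
rewrite mulmx1; have : repr (@tcov R tropX x) - x \in
    lat (block_mx G1 0 0 dual_basis).
  by apply/quotT_covE; rewrite /= reprK.
rewrite lat_block !raddfB => /andP[l r].
by congr pair; apply/quotT_covE.
Qed.

Definition triv : tmap tropX (prodT tropB tropF) :=
  @TMap R tropX (prodT tropB tropF)
    (fun q => @tcov R (prodT tropB tropF) (repr q)) 1%:M trivial_cov.

Definition triv_inv_fun (q : tpt (prodT tropB tropF)) : tpt tropX :=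
  @tcov R tropX (row_mx (repr q.1) (repr q.2)).

Lemma triv_inv_cov (x : 'rV[R]_(n + n)) :
  triv_inv_fun (@tcov R (prodT tropB tropF) x) =
  @tcov R tropX (x *m (1%:M : 'M[R]_(n + n))).
Proof.
rewrite mulmx1; apply/quotT_covE; rewrite lat_block !raddfB /=.
rewrite row_mxKl row_mxKr; apply/andP; split; apply/quotT_covE;
  by rewrite /= reprK.
Qed.

Definition triv_inv : tmap (prodT tropB tropF) tropX :=
  @TMap R (prodT tropB tropF) tropX triv_inv_fun 1%:M triv_inv_cov.

Lemma trivK : cancel triv triv_inv.
Proof.
move=> q; rewrite -[q]reprK -[\pi_(_) _]/(@tcov R tropX (repr q)).
by rewrite tmap_cov tmap_cov !mulmx1.
Qed.

Lemma triv_invK : cancel triv_inv triv.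
Proof.
case=> a b; pose x : 'rV[R]_(n + n) := row_mx (repr a) (repr b).
have -> : (a, b) = @tcov R (prodT tropB tropF) x.
  by rewrite /= row_mxKl row_mxKr !reprK.
by rewrite tmap_cov tmap_cov !mulmx1.
Qed.

(* Coordinates of chains are with respect to v_I = v_(i_1) /\ ... /\ v_(i_k). A
   cochain is a finite sum of terms alpha (x) eta, listed as pairs, alpha having
   coordinates with respect to v^*_I. *)
Definition trop_chain j k := tens (chain tropB j) n k.
Definition trop_cochain j k := seq (ext n k * dform tropB j).

Definition trop_int j k (c : trop_chain j k) (delta : trop_cochain j k) : R :=
  \sum_(ae <- delta) \sum_(I : ksub n k) (ae.1 I)%:~R * chint (c I) ae.2.

Lemma trop_int_pure j k (sigma : simplex tropB j) (beta alpha : ext n k)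
    (eta : dform tropB j) :
  trop_int (pure (<< sigma >> : chain tropB j) beta) [:: (alpha, eta)] =
  (ext_eval alpha beta)%:~R * sint sigma eta.
Proof.
rewrite /trop_int big_seq1 /= /ext_eval rmorph_sum /= mulr_suml.
apply: eq_bigr => I _; rewrite ffunE /chint.
rewrite (raddfMz (chlift (fun s => sint s eta))) /= chliftU.
by rewrite -[_ *~ beta I]mulrzl intrM mulrA.
Qed.

(* phihat and psihat are the maps out of the tensor products induced by the
   splittings; T_Z and T^*_Z enter through Lambda^k(T_Z)_b ~
   Lambda^(n-k)(T^*_Z)_b ~ H_(n-k)(F_b; Z) and its dual. *)
Variable kappa : forall m, {additive homology tropF m -> chain tropF m}.
Variable kappa' : forall m, {additive int_cohomology dual_basis m -> dform tropF m}.

Definition phihat j k (c : trop_chain j k) : chain tropX (j + (n - k)) :=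
  \sum_(I : ksub n k) cpush triv_inv
    (cross (c I) (kappa _ (ext_homology dual_basis (ext_compl (ext_basis I))))).

Lemma phihat_pure j k (sigma : simplex tropB j) (beta : ext n k) :
  phihat (pure (<< sigma >> : chain tropB j) beta) =
  cpush triv_inv
    (cross << sigma >> (kappa _ (ext_homology dual_basis (ext_compl beta)))).
Proof.
pose f (e : chain tropF (n - k)) := cpush triv_inv (cross << sigma >> e).
have fB : zmod_morphism f.
  by move=> e1 e2; rewrite /f /cross !chliftU raddfB /cpush raddfB.
pose F : {additive chain tropF (n - k) -> chain tropX (j + (n - k))} :=
  HB.pack f (GRing.isZmodMorphism.Build _ _ f fB).
rewrite -[RHS]/(F _) ext_compl_basis (raddf_sum (@ext_homology _ _ _ _)).
rewrite (raddf_sum (kappa _)) (raddf_sum F); apply: eq_bigr => I _.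
rewrite (raddfMz (@ext_homology _ _ _ _)) (raddfMz (kappa _)) (raddfMz F).
rewrite ffunE /F /= /f /cpush /cross.
by rewrite !(raddfMz (chlift _)).
Qed.

Definition psihat j k (delta : trop_cochain j k) : dform tropX (j + (n - k)) :=
  \sum_(ae <- delta) pullback triv
    (fcross ae.2 (kappa' _ (ext_cohomology dual_basis (ext_compl ae.1)))).

End TropicalTorus.

(* Main.v *)
Require Import Defs.
From HB Require Import structures.
From mathcomp Require Import all_boot all_order all_fingroup all_algebra.
From mathcomp Require Import ring_quotient.
From mathcomp Require Import all_classical all_reals all_analysis.
From mathcomp Require Import freeg ring.

(** Write c = sum_I c_I (x) v_I and delta = sum alpha (x) eta. The chain of
    phihat (c) belonging to I is a cross product of c_I with a cycle z on the
    fibre, the summand of psihat (delta) belonging to (alpha, eta) is a cross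
    product of eta with a closed form w on the fibre, and the trivialisation
    t cancels against its inverse. Fubini reduces the integral over the cross
    product to the product of the integral of eta over c_I and the period of w
    along z. By the theorem of Stokes this period depends only on the classes of
    z and w, that is, not on the splittings; it may be computed with the
    coordinate subtori and the forms dp_J, which are dual to each other. The signs of the
    two identifications of coefficients are both sgn (mu), so that they cancel,
    and the period is the coefficient alpha (v_I).

    Singular chains are built from simplices, so all of this is done with
    iterated integrals over 1 >= y_0 >= ... >= y_(m-1) >= 0.

    - Stokes. In these coordinates the faces of the simplex are y_0 = 1,
      y_(i-1) = y_i and y_(m-1) = 0. The integral of the j-th partial derivative
      is the difference of the integrals over the two faces that bound the
      range of y_j ([oint_derive]); for the outermost variable this is the
      Leibniz rule ([int0_leibniz]). Summing over j with signs gives Stokes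
      ([chart_stokes]), once the pullback along a smooth map is known to
      commute with the exterior derivative ([extd_chart], from the symmetry of
      second derivatives [derive_commute]).

    - Fubini. The Eilenberg-Zilber product triangulates a product of two
      simplices by shuffles. The pullback of a product form to the simplex of
      a shuffle is a product of two functions of complementary subsets of the
      variables ([sint_shuffle]), and the sum over all shuffles is the product
      of the two iterated integrals ([shuffle_product]), by induction from the
      product rule.

    - Lifts. The integral over a singular simplex is defined by a choice of a
      lift to the covering. Two lifts differ on the simplex by a smooth map
      with values in a lattice, whose derivatives along the simplex vanish
      ([lift_derive_eq]), so that any lift computes the integral ([sintE]). This
      needs the lattice to be discrete, hence invertible period matrices. *)

Set Implicit Arguments.
Unset Strict Implicit.
Unset Printing Implicit Defensive.

Import Order.TTheory GRing.Theory Num.Theory numFieldNormedType.Exports.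
Local Open Scope classical_set_scope.
Local Open Scope ring_scope.

(** * Integrals over intervals starting at 0 *)

Section Integral.
Variable R : realType.
Implicit Types (f g F : R -> R) (b : R).

Definition int0 b f : R := Rintegral (@lebesgue_measure R) `[0, b] f.

Lemma continuous_integrable f a b : continuous f ->
  (@lebesgue_measure R).-integrable `[a, b] (EFin \o f).
Proof.
move=> cf; apply: continuous_compact_integrable; first exact: segment_compact.
exact: continuous_subspaceT.
Qed.

Lemma int0_le0 b f : b <= 0 -> int0 b f = 0.
Proof.
rewrite /int0 le_eqVlt => /predU1P[->|b0]; first by rewrite set_itv1 Rintegral_set1.
by rewrite set_itv_ge ?Rintegral_set0 // bnd_simp -ltNge.
Qed.

Lemma eq_int0 b f g : (forall x, 0 <= x <= b -> f x = g x) -> int0 b f = int0 b g.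
Proof.
by move=> fg; apply: eq_Rintegral => x /set_mem /=; rewrite in_itv /=; exact: fg.
Qed.

Lemma int0D b f g : continuous f -> continuous g ->
  int0 b (fun x => f x + g x) = int0 b f + int0 b g.
Proof.
by move=> cf cg; apply: RintegralD => //; exact: continuous_integrable.
Qed.

Lemma int0B b f g : continuous f -> continuous g ->
  int0 b (fun x => f x - g x) = int0 b f - int0 b g.
Proof.
by move=> cf cg; apply: RintegralB => //; exact: continuous_integrable.
Qed.

Lemma int0Z b c f : continuous f -> int0 b (fun x => c * f x) = c * int0 b f.
Proof. by move=> cf; apply: RintegralZl => //; exact: continuous_integrable. Qed.

Lemma int0_bound b f (M : R) : continuous f -> 0 <= b ->
  (forall x, 0 <= x <= b -> `|f x| <= M) -> `|int0 b f| <= M * b.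
Proof.
move=> cf b0 fM.
apply: le_trans (le_normr_Rintegral _ (continuous_integrable 0 b cf)) _ => //.
apply: (@le_trans _ _ (\int[@lebesgue_measure R]_(x in `[0, b]) M)).
  apply: le_Rintegral => //.
  - apply: continuous_integrable => x; apply: continuous_comp; first exact: cf.
    exact: norm_continuous.
  - apply: (@continuous_integrable (cst M)); exact: cst_continuous.
rewrite Rintegral_cst //= lebesgue_measure_itv /= lte_fin.
move: b0; rewrite le_eqVlt => /predU1P[<-|->]; first by rewrite ltxx mulr0.
by rewrite -EFinD /= subr0.
Qed.

Lemma int0_FTC1 f b : continuous f -> 0 < b ->
  is_derive b (1 : R) (int0 ^~ f) (f b).
Proof.
move=> cf b0.
have [||df ff] := @continuous_FTC1_closed R f 0 b (b + 1) _ _ b0 (cf b).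
- by rewrite ltrDl.
- exact: continuous_integrable.
by apply: DeriveDef; [exact: df|rewrite -derive1E; exact: ff].
Qed.

Lemma int0_FTC2 F f b : continuous f -> continuous F -> 0 <= b ->
  (forall x, 0 < x < b -> is_derive x (1 : R) F (f x)) ->
  int0 b f = F b - F 0.
Proof.
move=> cf cF; rewrite le_eqVlt => /predU1P[<-|b0] dF.
  by rewrite int0_le0 // subrr.
rewrite /int0 /Rintegral (@continuous_FTC2 R f F 0 b) //.
- exact: continuous_subspaceT.
- split=> [x||]; first by rewrite in_itv /= => /dF [].
  + exact/cvg_at_right_filter/cF.
  + exact/cvg_at_left_filter/cF.
- by move=> x; rewrite in_itv /= => /dF dFx; rewrite derive1E derive_val.
Qed.

Lemma int0_continuous_bound f : continuous f -> continuous (int0 ^~ f).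
Proof.
move=> cf b; have [b0|b0|b0] := ltgtP b 0; last first.
- rewrite b0 /continuous_at int0_le0 //; apply/cvgr0Pnorm_le => e e0.
  have [M [M0 nM]] : exists M : R, 0 < M /\ \forall x \near (0 : R), `|f x| <= M.
    exists (`|f 0| + 1); split; first by rewrite ltr_wpDl.
    have /cvgrPdist_le/(_ 1 ltr01) := cf 0.
    apply: filterS => x; rewrite distrC => fx; rewrite -lerBlDl.
    exact: le_trans (lerB_dist _ _) fx.
  have [d /= d0 dM] := nM.
  have xd : \forall x \near (0 : R), x < d := lt_nbhsl d0.
  have xe : \forall x \near (0 : R), x < e / M := lt_nbhsl (divr_gt0 e0 M0).
  apply: filterS2 xd xe => x xd; rewrite ltr_pdivlMr // mulrC => /ltW xe.
  have [x0|x0] := leP x 0; first by rewrite int0_le0 // normr0 ltW.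
  apply: le_trans xe; apply: int0_bound => // [|y /andP[y0 yx]]; first exact: ltW.
  by apply: dM => /=; rewrite sub0r normrN ger0_norm // (le_lt_trans yx).
- apply/differentiable_continuous/derivable1_diffP.
  by have [] := int0_FTC1 cf b0.
- rewrite /continuous_at int0_le0 ?ltW //; apply: cvg_near_cst.
  by apply: filterS (lt_nbhsl b0) => x /ltW x0; rewrite int0_le0.
Qed.

End Integral.

(** * Continuous dependence on parameters *)

Section IntegralParameter.
Variable R : realType.

(** The tube lemma, for the compact segment [a, b]. *)
Lemma near_segment (T : topologicalType) (P : R -> T -> Prop) (a b : R) (t0 : T) :
  (forall x, a <= x <= b -> \forall p \near (x, t0), P p.1 p.2) ->
  \forall t \near t0, forall x, a <= x <= b -> P x t.
Proof.
move=> nP; have /compact_near_coveringP nc := @segment_compact R a b.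
have := nc T (nbhs t0) (fun t x => P x t) _ => /(_ _) nc'.
apply: filterS (nc' _) => [t Pt x xab|x /= xab].
  by apply: Pt; rewrite /= in_itv.
apply: (nP x); move: xab; by rewrite in_itv.
Qed.

Lemma continuous_pair (T U V : topologicalType) (f : T -> U) (g : T -> V) :
  continuous f -> continuous g -> continuous (fun t => (f t, g t)).
Proof. by move=> cf cg t; apply: cvg_pair; [exact: cf|exact: cg]. Qed.

Lemma continuous_compose (T U V : topologicalType) (f : T -> U) (g : U -> V) :
  continuous f -> continuous g -> continuous (fun t => g (f t)).
Proof. by move=> cf cg t; apply: continuous_comp; [exact: cf|exact: cg]. Qed.

Lemma continuous_fst (T U : topologicalType) : continuous (@fst T U).
Proof. by case=> x y; exact: cvg_fst. Qed.

Lemma continuous_snd (T U : topologicalType) : continuous (@snd T U).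
Proof. by case=> x y; exact: cvg_snd. Qed.

Lemma continuous_const (T U : topologicalType) (u : U) : continuous (fun _ : T => u).
Proof. by move=> t; exact: cvg_cst. Qed.

Lemma continuous_ident (T : topologicalType) : continuous (fun t : T => t).
Proof. by move=> t; exact: cvg_id. Qed.

Lemma continuous2r (T U V : topologicalType) (f : T * U -> V) (u : U) :
  continuous f -> continuous (fun t => f (t, u)).
Proof.
move=> cf; apply: (continuous_compose _ cf); apply: continuous_pair.
  exact: continuous_ident.
exact: continuous_const.
Qed.

(** The integral of f (-, t) - f (-, t0) over [0, x] is small because f is
    uniformly close to f (-, t0) on a segment that contains [0, x] for all x
    near b; the rest is continuity in the bound for the fixed parameter t0. *)
Lemma int0_continuous (T : topologicalType) (f : R * T -> R) : continuous f ->
  continuous (fun p : R * T => int0 p.1 (fun x => f (x, p.2))).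
Proof.
move=> cf [b t0].
have cft t : continuous (fun x => f (x, t)) by exact: continuous2r.
apply/cvgrPdist_le => e e0.
pose B : R := `|b| + 1; have B0 : 0 < B by rewrite ltr_wpDl.
pose d := e / 2 / B; have d0 : 0 < d by rewrite !divr_gt0.
have nt : \forall t \near t0, forall x, 0 <= x <= B -> `|f (x, t) - f (x, t0)| <= d.
  apply: (near_segment (P := fun x t => `|f (x, t) - f (x, t0)| <= d)) => x _.
  have ctt0 : continuous (fun p : R * T => f p - f (p.1, t0)).
    have cf0 : continuous (fun p : R * T => f (p.1, t0)).
      apply: (continuous_compose _ cf); apply: continuous_pair.
        exact: continuous_fst.
      exact: continuous_const.
    by move=> p; apply: cvgB; [exact: cf|exact: cf0].
  have : (f p - f (p.1, t0)) @[p --> (x, t0)] --> 0.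
    by have := ctt0 (x, t0); rewrite /continuous_at subrr.
  move=> /cvgr0_norm_le /(_ d d0).
  by apply: filterS => -[].
have nb : \forall x \near b, x < B by apply: lt_nbhsl; rewrite ltr_pwDr // ler_norm.
have e20 : 0 < e / 2 by rewrite divr_gt0.
have cb := int0_continuous_bound (cft t0).
have /cvgrPdist_le/(_ _ e20) nc := cb b.
have nbc := filterI nb nc.
exists ([set x | x < B /\ `|int0 b (fun x => f (x, t0)) - int0 x (fun x => f (x, t0))| <= e / 2],
  [set t | forall x, 0 <= x <= B -> `|f (x, t) - f (x, t0)| <= d]) => [|[x t] [/= [xB bx] tP]].
  by split; [exact: nbc|exact: nt].
rewrite -(subrK (int0 x (fun x => f (x, t0))) (int0 b _)) -addrA.
apply: le_trans (ler_normD _ _) _; rewrite [e in X in _ <= X]splitr lerD //.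
rewrite distrC -int0B //.
have [x0|x0] := leP x 0; first by rewrite int0_le0 // normr0 divr_ge0 // ltW.
apply: (@le_trans _ _ (d * x)).
  apply: int0_bound => [y||y /andP[y0 yx]]; [|exact: ltW|].
    by apply: cvgB; exact: cft.
  by apply: tP; rewrite y0 (le_trans yx) // ltW.
apply: (@le_trans _ _ (d * B)); first by rewrite ler_wpM2l // ltW.
by rewrite /d divfK ?gt_eqF.
Qed.

End IntegralParameter.

(** Continuity of maps built from pairs, projections and constants. *)
Ltac cts := solve [ assumption | exact: continuous_ident | exact: continuous_fst
  | exact: continuous_snd | exact: continuous_const
  | apply: continuous_pair; cts
  | apply: (continuous_compose _ (@continuous_fst _ _)); cts
  | apply: (continuous_compose _ (@continuous_snd _ _)); cts ].

(** * Iterated integrals over the ordered simplex *)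

Section IteratedIntegral.
Variable R : realType.

Definition row_cons m (y : R) (z : 'rV[R]_m) : 'rV[R]_m.+1 :=
  row_mx (y%:M : 'M[R]_1) z.

Lemma row_consE m y (z : 'rV[R]_m) : row_cons y z =
  y *: row_mx (1%:M : 'M[R]_1) 0 + z *m row_mx 0 1%:M.
Proof.
by rewrite mul_mx_row scale_row_mx scaler0 mulmx0 mulmx1 add_row_mx add0r addr0
  scale_scalar_mx mulr1.
Qed.

Lemma row_cons0 m y (z : 'rV[R]_m) : row_cons y z 0 ord0 = y.
Proof.
have -> : ord0 = lshift m (ord0 : 'I_1) by exact/val_inj.
by apply: (etrans (row_mxEl (y%:M : 'M[R]_1) z 0 ord0)); rewrite mxE.
Qed.

Lemma row_consS m y (z : 'rV[R]_m) i :
  row_cons y z 0 (fintype.lift ord0 i) = z 0 i.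
Proof.
have -> : fintype.lift ord0 i = rshift 1 i by exact/val_inj.
exact: (row_mxEr (y%:M : 'M[R]_1) z 0 i).
Qed.

Lemma continuous_mulmxr d e (L : 'M[R]_(d, e)) :
  continuous (fun y : 'rV[R]_d => y *m L).
Proof. by move=> x; apply/differentiable_continuous/differentiable_mulmxr. Qed.

Lemma continuous_row_cons m :
  continuous (fun p : R * 'rV[R]_m => row_cons p.1 p.2).
Proof.
have c2 : continuous
    (fun p : R * 'rV[R]_m => p.2 *m (row_mx 0 1%:M : 'M[R]_(m, 1 + m))).
  by apply: (continuous_compose _ (@continuous_mulmxr _ _ _)); cts.
move=> p; under eq_fun do rewrite row_consE.
by apply: cvgD; [apply: cvgZr_tmp; exact: continuous_fst|exact: c2].
Qed.

Lemma continuous_row_cons_comp (T : topologicalType) m (f : T -> R)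
    (g : T -> 'rV[R]_m) : continuous f -> continuous g ->
  continuous (fun t => row_cons (f t) (g t)).
Proof.
move=> cf cg.
exact: (continuous_compose (continuous_pair cf cg) (@continuous_row_cons m)).
Qed.

Lemma ointS m b (f : 'rV[R]_m.+1 -> R) :
  oint b f = int0 b (fun y => oint y (fun z => f (row_cons y z))).
Proof. by []. Qed.

(** The parameter space is arbitrary because the induction moves the outermost
    variable, which bounds the inner integral, into the parameter. *)
Lemma oint_continuous m (T : topologicalType) (F : T * 'rV[R]_m -> R) :
  continuous F -> continuous (fun p : R * T => oint p.1 (fun z => F (p.2, z))).
Proof.
elim: m T F => [|m IH] T F cF; first by apply: (continuous_compose _ cF); cts.
pose f (p : R * T) := oint p.1 (fun z => F (p.2, row_cons p.1 z)).
apply: (@int0_continuous R T f).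
pose F' (q : (R * T) * 'rV[R]_m) := F (q.1.2, row_cons q.1.1 q.2).
have cF' : continuous F'.
  apply: (continuous_compose _ cF); apply: continuous_pair; first by cts.
  by apply: continuous_row_cons_comp; cts.
have cg : continuous (fun p : R * T => (p.1, (p.1, p.2))) by cts.
exact: (continuous_compose cg (IH _ _ cF')).
Qed.

Lemma oint_slice_continuous m (f : 'rV[R]_m.+1 -> R) : continuous f ->
  continuous (fun y => oint y (fun z => f (row_cons y z))).
Proof.
move=> cf; pose F (q : R * 'rV[R]_m) := f (row_cons q.1 q.2).
have cF : continuous F := continuous_compose (@continuous_row_cons m) cf.
have cg : continuous (fun y : R => (y, y)) by cts.
exact: (continuous_compose cg (oint_continuous cF)).
Qed.

Lemma continuous_slice m y (f : 'rV[R]_m.+1 -> R) : continuous f ->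
  continuous (fun z => f (row_cons y z)).
Proof.
move=> cf; apply: (continuous_compose _ cf).
by apply: continuous_row_cons_comp; cts.
Qed.

Lemma oint_ext m b (f g : 'rV[R]_m -> R) : f =1 g -> oint b f = oint b g.
Proof. by move/funext->. Qed.

(** The domain over which [oint] integrates. *)
Definition ordered m (b : R) (y : 'rV[R]_m) :=
  (forall i, 0 <= y 0 i <= b) /\
  (forall i j : 'I_m, (i <= j)%N -> y 0 j <= y 0 i).

Lemma ordered_cons m b y (z : 'rV[R]_m) :
  0 <= y <= b -> ordered y z -> ordered b (row_cons y z).
Proof.
move=> /andP[y0 yb] [zy zz]; split=> [i|i j].
  have [k ->|->] := unliftP ord0 i; last by rewrite row_cons0 y0.
  by rewrite row_consS; have /andP[-> /le_trans ->] := zy k.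
have [k ->|->] := unliftP ord0 i; have [l ->|->] := unliftP ord0 j => //.
- by rewrite !row_consS; exact: zz.
- by rewrite row_cons0 row_consS => _; have /andP[] := zy l.
Qed.

Lemma eq_oint m b (f g : 'rV[R]_m -> R) : 0 <= b ->
  (forall y, ordered b y -> f y = g y) -> oint b f = oint b g.
Proof.
elim: m b f g => [|m IH] b f g b0 fg; first by apply: fg; split=> -[].
apply: eq_int0 => y /andP[y0 yb]; apply: IH => // z zP.
by apply/fg/ordered_cons => //; rewrite y0.
Qed.

Lemma ointD m b (f g : 'rV[R]_m -> R) : continuous f -> continuous g ->
  oint b (fun y => f y + g y) = oint b f + oint b g.
Proof.
elim: m b f g => [//|m IH] b f g cf cg; rewrite !ointS -int0D.
- by apply: eq_int0 => y _; apply: IH; exact: continuous_slice.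
- exact: oint_slice_continuous.
- exact: oint_slice_continuous.
Qed.

Lemma ointZ m b c (f : 'rV[R]_m -> R) : continuous f ->
  oint b (fun y => c * f y) = c * oint b f.
Proof.
elim: m b f => [//|m IH] b f cf; rewrite !ointS -int0Z.
- by apply: eq_int0 => y _; apply: IH; exact: continuous_slice.
- exact: oint_slice_continuous.
Qed.

Lemma oint0 m b : oint b (fun _ : 'rV[R]_m => 0) = 0.
Proof.
rewrite -[RHS](mul0r (oint b (fun _ : 'rV[R]_m => 0))) -ointZ; last exact: continuous_const.
by apply: oint_ext => y; rewrite mul0r.
Qed.

Lemma ointN m b (f : 'rV[R]_m -> R) : continuous f ->
  oint b (fun y => - f y) = - oint b f.
Proof.
by move=> cf; rewrite -mulN1r -ointZ //; apply: oint_ext => y; rewrite mulN1r.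
Qed.

Lemma continuous_sumR (T : topologicalType) I (r : seq I) (P : pred I) (f : I -> T -> R) :
  (forall i, P i -> continuous (f i)) -> continuous (fun y => \sum_(i <- r | P i) f i y).
Proof.
move=> cf; elim: r => [|i r IH].
  by under eq_fun do rewrite big_nil; exact: continuous_const.
case Pi: (P i); last by under eq_fun do rewrite big_cons Pi.
under eq_fun do rewrite big_cons Pi.
by move=> y; apply: cvgD; [exact: cf|exact: IH].
Qed.

Lemma oint_sum m b I (r : seq I) (P : pred I) (f : I -> 'rV[R]_m -> R) :
  (forall i, P i -> continuous (f i)) ->
  oint b (fun y => \sum_(i <- r | P i) f i y) = \sum_(i <- r | P i) oint b (f i).
Proof.
move=> cf; elim: r => [|i r IH].
  rewrite big_nil -[RHS](@oint0 m b).
  by apply: oint_ext => y; rewrite big_nil.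
rewrite big_cons -IH; case: ifP => Pi.
  rewrite -ointD; [|exact: cf|exact: continuous_sumR].
  by apply: oint_ext => y; rewrite big_cons Pi.
by apply: oint_ext => y; rewrite big_cons Pi.
Qed.

End IteratedIntegral.

(** * Differentiation under the integral sign *)

Section Leibniz.
Variable R : realType.

Lemma continuous_oint m (T : topologicalType) (b : T -> R) (F : T -> 'rV[R]_m -> R) :
  continuous b -> continuous (fun p : T * 'rV[R]_m => F p.1 p.2) ->
  continuous (fun t => oint (b t) (F t)).
Proof.
move=> cb cF; have cg : continuous (fun t => (b t, t)) by cts.
exact: (continuous_compose cg (oint_continuous cF)).
Qed.

Lemma is_derive_quotient (f : R -> R) (x l : R) :
  is_derive x (1 : R) f l <->
  (fun h => h^-1 * (f (h + x) - f x)) @ 0^' --> l.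
Proof.
have E : (fun h : R => h^-1 *: ((f \o shift x) (h *: (1 : R)) - f x)) =
    (fun h => h^-1 * (f (h + x) - f x)).
  by apply/funext => h /=; rewrite /GRing.scale /= mulr1.
split=> [[/cvg_ex[l' dl] <-]|dl].
  rewrite /derive E; rewrite E in dl.
  by apply/cvg_ex; exists l'.
apply: DeriveDef; first by apply/cvg_ex; exists l; rewrite E.
by rewrite /derive E; apply: cvg_lim.
Qed.

Lemma bounded_rectangle (f : R * R -> R) (a b c d : R) : continuous f ->
  exists M : R, forall x y, a <= x <= b -> c <= y <= d -> `|f (x, y)| <= M.
Proof.
move=> cf.
have cK := compact_setX (@segment_compact R a b) (@segment_compact R c d).
have cfK : {within `[a, b] `*` `[c, d], continuous f} by exact: continuous_subspaceT.
have [M [_ /(_ (M + 1))]] := compact_bounded (continuous_compact cfK cK).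
rewrite ltrDl => /(_ ltr01) bM; exists (M + 1) => x y xab ycd.
by apply: bM; exists (x, y) => //; split; rewrite /= in_itv.
Qed.

Lemma int0_derive_param (f df : R * R -> R) (b z : R) :
  continuous f -> continuous df ->
  (forall y z, is_derive z (1 : R) (fun z => f (y, z)) (df (y, z))) ->
  is_derive z (1 : R) (fun z => int0 b (fun y => f (y, z)))
    (int0 b (fun y => df (y, z))).
Proof.
move=> cf cdf dfE.
pose f' (z y : R) := f (y, z).
have d1E u y : partial1of2 f' u y = df (y, u).
  by rewrite partial1of2E; have [_ <-] := dfE y u.
have [M Mb] := bounded_rectangle 0 b (z - 1) (z + 1) cdf.
(* A nonnegative bound, to serve as dominating function. *)
pose M' := `|M|.
have zI : [set` `](z - 1), (z + 1)[] z.
  by rewrite /= in_itv /= ltrBlDr ltrDl ltr01.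
have int_f u : [set` `](z - 1), (z + 1)[] u ->
    (@lebesgue_measure R).-integrable `[0, b] (EFin \o f' u).
  by move=> _; apply: continuous_integrable; exact: continuous2r.
have der_f u y : [set` `](z - 1), (z + 1)[] u -> [set` `[0, b]] y ->
    derivable (f' ^~ y) u 1.
  by move=> _ _; have [] := dfE y u.
have int_M : (@lebesgue_measure R).-integrable `[0, b] (EFin \o cst M').
  by apply: (@continuous_integrable _ (cst M')); exact: cst_continuous.
have ubM u y : [set` `](z - 1), (z + 1)[] u -> [set` `[0, b]] y ->
    `|partial1of2 f' u y| <= cst M' y.
  rewrite /= !in_itv /= d1E => /andP[u1 u2] yb.
  by apply: le_trans (ler_norm M); apply: Mb => //; rewrite !ltW.
have mI : measurable [set` `[0, b]] by exact: measurable_itv.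
have M0 (y : R) : 0 <= cst M' y by exact: normr_ge0.
have D := @derivable_under_integral R _ _ (@lebesgue_measure R) f' `[0, b] mI z _ _ zI
  int_f der_f (cst M') M0 int_M ubM.
have DE := @differentiation_under_integral R _ _ (@lebesgue_measure R) f' `[0, b] mI z _ _ zI
  int_f der_f (cst M') M0 int_M ubM.
apply: DeriveDef; first exact: D.
rewrite -derive1E; apply: (etrans DE); apply: eq_int0 => y _.
exact: d1E.
Qed.

(** The first difference quotient in
    f (t, t) - f (a, a) = (f (t, t) - f (a, t)) + (f (a, t) - f (a, a))
    is, by the mean value theorem, a value of the first partial derivative near
    (a, a). Only f (a, -) has to be differentiable in the second variable. *)
Lemma is_derive_diagonal (f f1 : R * R -> R) (a l : R) :
  {for (a, a), continuous f1} ->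
  (\forall x \near a, forall z, is_derive x (1 : R) (fun x => f (x, z)) (f1 (x, z))) ->
  is_derive a (1 : R) (fun z => f (a, z)) l ->
  is_derive a (1 : R) (fun z => f (z, z)) (f1 (a, a) + l).
Proof.
move=> cf1 df1 /is_derive_quotient dl; apply/is_derive_quotient.
have -> : (fun h => h^-1 * (f (h + a, h + a) - f (a, a))) =
    (fun h => h^-1 * (f (h + a, h + a) - f (a, h + a)) +
       h^-1 * (f (a, h + a) - f (a, a))).
  by apply/funext => h; rewrite -mulrDr subrKA.
apply: cvgD dl; apply/cvgrPdist_le => e e0.
have /cvgrPdist_le/(_ _ e0) [[A B] [/= nA nB] AB] := cf1.
have [d0 /= d00 dA] := nA; have [d1 /= d10 dB] := nB; have [d2 /= d20 dD] := df1.
pose d := Num.min d0 (Num.min d1 d2).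
have d_gt0 : 0 < d by rewrite !lt_min d00 d10.
exists d => // h /=; rewrite sub0r normrN !lt_min => /and3P[h0 h1 h2] hn0.
have der t : `|t| <= `|h| -> is_derive (t + a) (1 : R) (fun x => f (x, h + a)) (f1 (t + a, h + a)).
  by move=> th; apply: dD => /=; rewrite opprD addrCA subrr addr0 normrN (le_lt_trans th).
have near_f1 t : `|t| <= `|h| -> `|f1 (a, a) - f1 (t + a, h + a)| <= e.
  move=> th; apply: (AB (t + a, h + a)); split; [apply: dA|apply: dB] => /=;
    by rewrite opprD addrCA subrr addr0 normrN // (le_lt_trans th).
have der' t : `|t - a| <= `|h| -> is_derive t (1 : R) (fun x => f (x, h + a)) (f1 (t, h + a)).
  by move=> /der; rewrite subrK.
have cseg (u v : R) : (forall t, u <= t <= v -> `|t - a| <= `|h|) ->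
    {within `[u, v], continuous (fun x => f (x, h + a))}.
  move=> uv; apply: derivable_within_continuous => t; rewrite in_itv /= => /uv /der'.
  by case.
have [hp|hn|hz] := ltgtP h 0; last by rewrite hz eqxx in hn0.
- have Hn t : h + a <= t <= a -> `|t - a| <= `|h|.
    move=> /andP[t1 t2]; rewrite (ltr0_norm hp) ler0_norm ?subr_le0 // lerN2.
    by rewrite lerBrDr.
  have [|||c] := @MVT R (fun x => f (x, h + a)) (fun x => f1 (x, h + a)) (h + a) a.
  + by rewrite gtrDr.
  + move=> x; rewrite in_itv /= => /andP[x1 x2]; apply: der'; apply: Hn.
    by rewrite !ltW.
  + exact: cseg.
  rewrite in_itv /= => /andP[c1 c2] E.
  rewrite -[X in _^-1 * X]opprB E (_ : a - (h + a) = - h); last by ring.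
  rewrite !mulrN opprK mulrCA mulVf // mulr1.
  by rewrite -[c](subrK a) near_f1 // Hn // !ltW.
- have Hn t : a <= t <= h + a -> `|t - a| <= `|h|.
    by move=> /andP[t1 t2]; rewrite (gtr0_norm hn) ger0_norm ?subr_ge0 // lerBlDr.
  have [|||c] := @MVT R (fun x => f (x, h + a)) (fun x => f1 (x, h + a)) a (h + a).
  + by rewrite ltrDr.
  + move=> x; rewrite in_itv /= => /andP[x1 x2]; apply: der'; apply: Hn.
    by rewrite !ltW.
  + exact: cseg.
  rewrite in_itv /= => /andP[c1 c2] E.
  rewrite E addrK mulrCA mulVf // mulr1.
  by rewrite -[c](subrK a) near_f1 // Hn // !ltW.
Qed.

(** Moving the bound contributes f (a, a), moving the parameter the integral of
    df. The bound must be positive: the integral vanishes for negative bounds,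
    so that it has a kink at 0 unless f (0, 0) = 0. *)
Lemma int0_leibniz (f df : R * R -> R) (a : R) : 0 < a ->
  continuous f -> continuous df ->
  (forall y z, is_derive z (1 : R) (fun z => f (y, z)) (df (y, z))) ->
  is_derive a (1 : R) (fun z => int0 z (fun y => f (y, z)))
    (f (a, a) + int0 a (fun y => df (y, a))).
Proof.
move=> a0 cf cdf dfE.
apply: (@is_derive_diagonal (fun p => int0 p.1 (fun y => f (y, p.2))) f).
- exact: cf.
- have : \forall x \near a, 0 < x by exact: lt_nbhsr.
  apply: filterS => x x0 z; exact: (@int0_FTC1 R (fun y => f (y, z)) x (continuous2r cf) x0).
- exact: int0_derive_param.
Qed.

Lemma oint_derive_param m (F dF : 'rV[R]_m * R -> R) (b z : R) :
  continuous F -> continuous dF ->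
  (forall y z, is_derive z (1 : R) (fun z => F (y, z)) (dF (y, z))) ->
  is_derive z (1 : R) (fun z => oint b (fun y => F (y, z)))
    (oint b (fun y => dF (y, z))).
Proof.
elim: m F dF b z => [|m IH] F dF b z cF cdF dFE; first exact: dFE.
have cs (G : 'rV[R]_m.+1 * R -> R) : continuous G ->
    continuous (fun p : R * R => oint p.1 (fun w => G (row_cons p.1 w, p.2))).
  move=> cG; apply: continuous_oint; first by cts.
  apply: (continuous_compose _ cG); apply: continuous_pair; last by cts.
  by apply: continuous_row_cons_comp; cts.
have cs' y (G : 'rV[R]_m.+1 * R -> R) : continuous G ->
    continuous (fun p : 'rV[R]_m * R => G (row_cons y p.1, p.2)).
  move=> cG; apply: (continuous_compose _ cG); apply: continuous_pair; last by cts.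
  by apply: continuous_row_cons_comp; cts.
apply: (@int0_derive_param (fun p => oint p.1 (fun w => F (row_cons p.1 w, p.2)))
  (fun p => oint p.1 (fun w => dF (row_cons p.1 w, p.2)))); try exact: cs.
move=> y {}z /=.
apply: (IH (fun p => F (row_cons y p.1, p.2)) (fun p => dF (row_cons y p.1, p.2)));
  [exact: cs' cF|exact: cs' cdF|move=> w u; exact: (dFE (row_cons y w) u)].
Qed.

End Leibniz.

(** * Calculus of smooth maps *)

Section SmoothCalculus.
Variable R : realType.

Lemma smooth_differentiable d (f : 'rV[R]_d -> R) x : smooth f -> differentiable f x.
Proof. by move=> sf; apply: (@difft_differentiable _ 0); exact: sf. Qed.

Lemma smooth_continuous d (f : 'rV[R]_d -> R) : smooth f -> continuous f.
Proof. by move=> sf x; apply: differentiable_continuous; exact: smooth_differentiable. Qed.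

Lemma smooth_derive d (f : 'rV[R]_d -> R) v : smooth f -> smooth (fun x => 'D_v f x).
Proof. by move=> sf k; have [_] := sf k.+1; exact. Qed.

Lemma differentiable_row d e (g : 'rV[R]_d -> 'rV[R]_e) x :
  (forall i, differentiable (fun y => g y 0 i) x) -> differentiable g x.
Proof.
move=> dg; have -> : g = \sum_(i < e) (fun y => g y 0 i *: delta_mx 0 i).
  by apply/funext => y; rewrite fct_sumE {1}[g y]row_sum_delta.
apply: differentiable_sum => i; exact: differentiableZl.
Qed.

Lemma smooth_map_differentiable d e (g : 'rV[R]_d -> 'rV[R]_e) x :
  smooth_map g -> differentiable g x.
Proof.
by move=> sg; apply: differentiable_row => i; apply: smooth_differentiable; exact: sg.
Qed.

Lemma derive_chain d e (V : normedModType R) (g : 'rV[R]_d -> 'rV[R]_e)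
    (f : 'rV[R]_e -> V) x v :
  differentiable g x -> differentiable f (g x) ->
  'D_v (fun y => f (g y)) x = 'D_('D_v g x) f (g x).
Proof.
move=> dg df; have dfg := differentiable_comp dg df.
by rewrite (deriveE v dfg) (deriveE _ df) (deriveE _ dg) diff_comp.
Qed.

Lemma derive_mulmxr d e (L : 'M[R]_(d, e)) (x v : 'rV[R]_d) :
  'D_v (fun y => y *m L) x = v *m L.
Proof.
rewrite /derive; apply: cvg_lim => //; apply: cvg_near_cst.
have : \forall h \near (0 : R)^', h != 0 by exact: nbhs_dnbhs_neq.
apply: filterS => h h0 /=.
by rewrite mulmxDl addrK -scalemxAl scalerA mulVf // scale1r.
Qed.

Lemma derive_coord d e (g : 'rV[R]_d -> 'rV[R]_e) x v i :
  differentiable g x -> ('D_v g x) 0 i = 'D_v (fun y => g y 0 i) x.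
Proof.
move=> dg; rewrite (@derive_chain d e _ g (fun z => z 0 i)) //; last first.
  exact: differentiable_coord.
rewrite /derive; apply/esym; apply: cvg_lim => //; apply: cvg_near_cst.
have : \forall h \near (0 : R)^', h != 0 by exact: nbhs_dnbhs_neq.
apply: filterS => h h0 /=.
by rewrite !mxE addrK /GRing.scale /= mulrA mulVf ?mul1r.
Qed.

Lemma derive_linear d (V : normedModType R) (f : 'rV[R]_d -> V) x a u v :
  differentiable f x -> 'D_(a *: u + v) f x = a *: 'D_u f x + 'D_v f x.
Proof. by move=> df; rewrite !(deriveE _ df) linearP. Qed.

Lemma deriveDv d (V : normedModType R) (f : 'rV[R]_d -> V) x u v :
  differentiable f x -> 'D_(u + v) f x = 'D_u f x + 'D_v f x.
Proof. by move=> df; rewrite -[u]scale1r derive_linear // !scale1r. Qed.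

Lemma deriveNv d (V : normedModType R) (f : 'rV[R]_d -> V) x v :
  differentiable f x -> 'D_(- v) f x = - 'D_v f x.
Proof. by move=> df; rewrite !(deriveE _ df) linearN. Qed.

Lemma derive_sumv d (V : normedModType R) (f : 'rV[R]_d -> V) x
    I (r : seq I) (P : pred I) (u : I -> 'rV[R]_d) :
  differentiable f x ->
  'D_(\sum_(i <- r | P i) u i) f x = \sum_(i <- r | P i) 'D_(u i) f x.
Proof.
move=> df; rewrite (deriveE _ df) linear_sum.
by apply: eq_bigr => i _; rewrite (deriveE _ df).
Qed.

Lemma derive_coords d (V : normedModType R) (f : 'rV[R]_d -> V) x v :
  differentiable f x -> 'D_v f x = \sum_i v 0 i *: 'D_(delta_mx 0 i) f x.
Proof.
move=> df; rewrite {1}[v]row_sum_delta derive_sumv //; apply: eq_bigr => i _.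
by rewrite !(deriveE _ df) linearZ.
Qed.

Lemma difft_sum k d I (r : seq I) (f : I -> 'rV[R]_d -> R) :
  (forall i, difft k (f i)) -> difft k (fun x => \sum_(i <- r) f i x).
Proof.
move=> sf; elim: r => [|i r IH].
  by under eq_fun do rewrite big_nil; exact: difft_cst.
by under eq_fun do rewrite big_cons; exact: difftD.
Qed.

(** The partial derivatives of f o g are sums of products of derivatives of the
    coordinates of g, which are smooth, with functions of the same form
    h o g, h a partial derivative of f; this makes the induction on the order
    of differentiability work for all f at once. *)
Lemma smooth_comp d e (g : 'rV[R]_d -> 'rV[R]_e) (f : 'rV[R]_e -> R) :
  smooth_map g -> smooth f -> smooth (fun x => f (g x)).
Proof.
move=> sg + k; elim: k f => [|k IH] f sf.
  split=> // x; apply: differentiable_comp; first exact: smooth_map_differentiable.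
  exact: smooth_differentiable.
split=> [x|v].
  apply: differentiable_comp; first exact: smooth_map_differentiable.
  exact: smooth_differentiable.
have -> : (fun x => 'D_v (fun y => f (g y)) x) = (fun x =>
    \sum_i 'D_v (fun y => g y 0 i) x * 'D_(delta_mx 0 i) f (g x)).
  apply/funext => x; have dg := smooth_map_differentiable x sg.
  have df := smooth_differentiable (g x) sf.
  rewrite derive_chain // derive_coords //; apply: eq_bigr => i _.
  by rewrite derive_coord.
apply: difft_sum => i; apply: difftM; first exact: (smooth_derive v (sg i)).
exact: (IH _ (smooth_derive (delta_mx 0 i) sf)).
Qed.

Lemma smooth_map_comp d e c (g : 'rV[R]_d -> 'rV[R]_e) (f : 'rV[R]_e -> 'rV[R]_c) :
  smooth_map g -> smooth_map f -> smooth_map (fun x => f (g x)).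
Proof. by move=> sg sf i; exact: (smooth_comp sg (sf i)). Qed.

Lemma smooth_map_affine d e (a : 'rV[R]_e) (L : 'M[R]_(d, e)) :
  smooth_map (fun x : 'rV[R]_d => a + x *m L).
Proof.
move=> i; under eq_fun do rewrite mxE.
by apply: smoothD; [exact: smooth_cst|exact: smooth_map_lin].
Qed.

Lemma smooth_map_derive d e (g : 'rV[R]_d -> 'rV[R]_e) v :
  smooth_map g -> smooth_map (fun x => 'D_v g x).
Proof.
move=> sg i; have -> : (fun x => 'D_v g x 0 i) = (fun x => 'D_v (fun y => g y 0 i) x).
  by apply/funext => x; rewrite derive_coord //; exact: smooth_map_differentiable.
exact: smooth_derive.
Qed.

Lemma is_derive_line d (f : 'rV[R]_d -> R) (x v : 'rV[R]_d) (t : R) :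
  differentiable f (x + t *: v) ->
  is_derive t (1 : R) (fun t => f (x + t *: v)) ('D_v f (x + t *: v)).
Proof.
move=> df; apply/is_derive_quotient.
have := diff_derivable (v := v) df; rewrite /derivable /derive => /cvg_ex[l dl].
rewrite (cvg_lim _ dl) //.
have E : (fun h : R => h^-1 *: ((f \o shift (x + t *: v)) (h *: v) - f (x + t *: v))) =
  (fun h => h^-1 * (f (x + (h + t) *: v) - f (x + t *: v))).
  by apply/funext => h /=; rewrite scalerDl [x + (_ + _)]addrCA.
by rewrite E in dl.
Qed.

Lemma continuous_line_map d (x v : 'rV[R]_d) : continuous (fun t : R => x + t *: v).
Proof.
move=> t; rewrite /continuous_at.
apply: (@cvgD R).
  exact: cvg_cst.
by apply: cvgZr_tmp; exact: cvg_id.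
Qed.

Lemma continuous_plane_map d (x u v : 'rV[R]_d) :
  continuous (fun p : R * R => x + p.1 *: u + p.2 *: v).
Proof.
move=> p; rewrite /continuous_at.
apply: (@cvgD R).
  apply: (@cvgD R).
    exact: cvg_cst.
  by apply: cvgZr_tmp; exact: continuous_fst.
by apply: cvgZr_tmp; exact: continuous_snd.
Qed.

Lemma continuous_line d (f : 'rV[R]_d -> R) (x v : 'rV[R]_d) : continuous f ->
  continuous (fun t : R => f (x + t *: v)).
Proof. exact: continuous_compose (@continuous_line_map d x v). Qed.

(** The fundamental theorem of calculus along a segment. *)
Lemma int0_derive_line d (f : 'rV[R]_d -> R) (x v : 'rV[R]_d) (s : R) :
  smooth f -> 0 <= s ->
  int0 s (fun r => 'D_v f (x + r *: v)) = f (x + s *: v) - f x.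
Proof.
move=> sf s0; rewrite -[f x](_ : f (x + 0 *: v) = _); last by rewrite scale0r addr0.
apply: (@int0_FTC2 R (fun r => f (x + r *: v))) => //.
- exact: (@continuous_line d _ x v (smooth_continuous (smooth_derive v sf))).
- exact: (@continuous_line d _ x v (smooth_continuous sf)).
- by move=> r _; apply: is_derive_line; exact: smooth_differentiable.
Qed.

(** Symmetry of second derivatives. Differentiating
    f (z + s u + t v) - f (z + t v) = int_0^s D_u f (z + r u + t v) dr
    at t = 0 under the integral sign gives
    D_v f (z + s u) - D_v f (z) = int_0^s D_v D_u f (z + r u) dr,
    and the derivative of both sides at s = 1 is the claim at z + u. *)
Lemma derive_commute d (f : 'rV[R]_d -> R) (x u v : 'rV[R]_d) : smooth f ->
  'D_u (fun y => 'D_v f y) x = 'D_v (fun y => 'D_u f y) x.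
Proof.
move=> sf; pose z := x - u.
have E1 s : 0 <= s -> int0 s (fun r => 'D_v (fun y => 'D_u f y) (z + r *: u)) =
    'D_v f (z + s *: u) - 'D_v f z.
  move=> s0.
  pose F (p : R * R) := 'D_u f (z + p.1 *: u + p.2 *: v).
  pose dF (p : R * R) := 'D_v (fun y => 'D_u f y) (z + p.1 *: u + p.2 *: v).
  have cpl (h : 'rV[R]_d -> R) : continuous h ->
      continuous (fun p : R * R => h (z + p.1 *: u + p.2 *: v)).
    exact: continuous_compose (@continuous_plane_map d z u v).
  have D1 : is_derive (0 : R) (1 : R) (fun t => int0 s (fun r => F (r, t)))
      (int0 s (fun r => dF (r, 0))).
    apply: int0_derive_param.
    - exact: (cpl _ (smooth_continuous (smooth_derive u sf))).
    - exact: (cpl _ (smooth_continuous (smooth_derive v (smooth_derive u sf)))).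
    - move=> r t; have df := smooth_differentiable (z + r *: u + t *: v) (smooth_derive u sf).
      exact: (is_derive_line df).
  have D2 : is_derive (0 : R) (1 : R) (fun t => int0 s (fun r => F (r, t)))
      ('D_v f (z + s *: u) - 'D_v f z).
    have -> : (fun t => int0 s (fun r => F (r, t))) =
        (fun t => f (z + s *: u + t *: v)) - (fun t => f (z + t *: v)).
      apply/funext => t; rewrite -[RHS]/(f (z + s *: u + t *: v) - f (z + t *: v)).
      rewrite (addrAC z (s *: u) (t *: v)).
      rewrite -(int0_derive_line (z + t *: v) u sf s0).
      by apply: eq_int0 => r _; rewrite /F (addrAC z (r *: u)).
    apply: is_deriveB.
      have := @is_derive_line d f (z + s *: u) v 0.
      by rewrite scale0r addr0; apply; exact: smooth_differentiable.
    have := @is_derive_line d f z v 0.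
    by rewrite scale0r addr0; apply; exact: smooth_differentiable.
  have <- : int0 s (fun r => dF (r, 0)) =
      int0 s (fun r => 'D_v (fun y => 'D_u f y) (z + r *: u)).
    by apply: eq_int0 => r _; rewrite /dF scale0r addr0.
  by rewrite -(@derive_val _ _ _ _ _ _ _ D1) (@derive_val _ _ _ _ _ _ _ D2).
have cg : continuous (fun r : R => 'D_v (fun y => 'D_u f y) (z + r *: u)).
  exact: (@continuous_line d _ z u (smooth_continuous (smooth_derive v (smooth_derive u sf)))).
have D1 := int0_FTC1 cg (ltr01 : 0 < (1 : R)).
have D2 : is_derive (1 : R) (1 : R) (fun s => 'D_v f (z + s *: u))
   ('D_u (fun y => 'D_v f y) (z + (1 : R) *: u)).
  have df := smooth_differentiable (z + (1 : R) *: u) (smooth_derive v sf).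
  exact: (is_derive_line df).
have D3 : is_derive (1 : R) (1 : R)
    (fun s => int0 s (fun r => 'D_v (fun y => 'D_u f y) (z + r *: u)))
    ('D_u (fun y => 'D_v f y) (z + (1 : R) *: u)).
  pose g s : R := 'D_v f (z + s *: u) - 'D_v f z.
  have Dg : is_derive (1 : R) (1 : R) g ('D_u (fun y => 'D_v f y) (z + (1 : R) *: u)).
    by rewrite -[X in is_derive _ _ _ X]subr0; exact: is_deriveB.
  apply: (near_eq_is_derive (f := g)) Dg.
  have : \forall s \near (1 : R), 0 < s by exact: lt_nbhsr.
  by apply: filterS => s s0; rewrite E1 // ltW.
have zu : z + (1 : R) *: u = x by rewrite scale1r subrK.
rewrite -zu; have := @derive_val _ _ _ _ _ _ _ D3; have := @derive_val _ _ _ _ _ _ _ D1.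
by move=> -> ->.
Qed.

End SmoothCalculus.

(** * The fundamental theorem of calculus on the ordered simplex *)

Section StokesSimplex.
Variable R : realType.

(** Coordinate l of y, or 0 when l is out of range: with this value for y_m and
    with y_(-1) = 1, every barycentric coordinate is y_(l-1) - y_l ([baryE]). *)
Definition rnth m (y : 'rV[R]_m) (l : nat) : R :=
  if insub l is Some k then y 0 k else 0.

Lemma rnth_ord m (y : 'rV[R]_m) (k : 'I_m) : rnth y k = y 0 k.
Proof. by rewrite /rnth valK. Qed.

Lemma rnth_cons0 m b (y : 'rV[R]_m) : rnth (row_cons b y) 0 = b.
Proof. by rewrite -[0%N]/(val (@ord0 m)) rnth_ord row_cons0. Qed.

Lemma rnth_consS m b (y : 'rV[R]_m) l : rnth (row_cons b y) l.+1 = rnth y l.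
Proof.
rewrite [RHS]/rnth; case: insubP => [k lm <-|lm].
  by rewrite -[(val k).+1]/(val (fintype.lift ord0 k)) rnth_ord row_consS.
by rewrite /rnth insubF // ltnS; apply/negbTE.
Qed.

(** The i-th face of the ordered simplex of y_0 <= b: for 0 < i <= m the entry
    y_(i-1) is repeated, for i = 0 the bound b is put in front, for i = m + 1
    the value 0 is appended. *)
Definition row_ins m (b : R) (i : nat) (y : 'rV[R]_m) : 'rV[R]_m.+1 :=
  \row_l (if (l < i)%N then rnth y l else rnth (row_cons b y) l).

Lemma row_ins0 m b (y : 'rV[R]_m) : row_ins b 0 y = row_cons b y.
Proof. by apply/rowP => l; rewrite mxE /= rnth_ord. Qed.

Lemma row_insS m b i y (z : 'rV[R]_m) :
  row_ins b i.+1 (row_cons y z) = row_cons y (row_ins y i z).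
Proof.
apply/rowP => l; rewrite mxE; have [k ->|->] := unliftP ord0 l.
  by rewrite lift0 ltnS row_consS !rnth_consS mxE.
by rewrite /= rnth_cons0 row_cons0.
Qed.

Lemma row_ins1_nil b (y : 'rV[R]_0) : row_ins b 1 y = row_cons 0 y.
Proof. by apply/rowP => l; rewrite mxE !ord1 row_cons0 /= /rnth insubF. Qed.

Lemma smooth_rnth m l : smooth (fun y : 'rV[R]_m => rnth y l).
Proof.
rewrite /rnth; case: insubP => [k _ _|_]; [exact: smooth_coord|exact: smooth_cst].
Qed.

Lemma smooth_row_ins m b i : smooth_map (@row_ins m b i).
Proof.
move=> l; under eq_fun do rewrite mxE.
case: (l < i)%N; first exact: smooth_rnth.
case: (nat_of_ord l) => [|k].
  by under eq_fun do rewrite rnth_cons0; exact: smooth_cst.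
by under eq_fun do rewrite rnth_consS; exact: smooth_rnth.
Qed.

Lemma row_cons_lin m y (z : 'rV[R]_m) :
  row_cons y z = row_cons y 0 + z *m (row_mx 0 1%:M : 'M[R]_(m, 1 + m)).
Proof. by rewrite row_consE [in RHS]row_consE mul0mx addr0. Qed.

Lemma smooth_map_row_cons m y : smooth_map (@row_cons R m y).
Proof.
rewrite (_ : row_cons y = fun z => row_cons y 0 + z *m (row_mx 0 1%:M : 'M[R]_(m, 1 + m))).
  exact: smooth_map_affine.
by apply/funext => z; exact: row_cons_lin.
Qed.

Lemma derive_row_cons m (h : 'rV[R]_m.+1 -> R) y (z : 'rV[R]_m) v : smooth h ->
  'D_v (fun z => h (row_cons y z)) z = 'D_(row_cons 0 v) h (row_cons y z).
Proof.
move=> sh; rewrite derive_chain.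
- congr ('D_ _ _ _); rewrite /derive; apply: cvg_lim => //; apply: cvg_near_cst.
  have : \forall h \near (0 : R)^', h != 0 by exact: nbhs_dnbhs_neq.
  apply: filterS => t t0 /=.
  rewrite row_cons_lin [row_cons y z]row_cons_lin opprD addrACA subrr add0r.
  rewrite -mulmxBl addrK -scalemxAl scalerA mulVf // scale1r row_consE scale0r.
  by rewrite add0r.
- exact/smooth_map_differentiable/smooth_map_row_cons.
- exact: smooth_differentiable.
Qed.

Lemma delta_row_consS m (j : 'I_m) :
  delta_mx 0 (fintype.lift ord0 j) = row_cons 0 (delta_mx 0 j) :> 'rV[R]_m.+1.
Proof.
apply/rowP => l; rewrite mxE; have [k ->|->] := unliftP ord0 l.
  by rewrite row_consS mxE (inj_eq lift_inj).
by rewrite row_cons0.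
Qed.

Lemma delta_row_cons0 m : delta_mx 0 ord0 = row_cons 1 0 :> 'rV[R]_m.+1.
Proof.
apply/rowP => l; rewrite mxE; have [k ->|->] := unliftP ord0 l.
  by rewrite row_consS mxE.
by rewrite row_cons0 eqxx.
Qed.

Lemma is_derive_row_cons m (h : 'rV[R]_m.+1 -> R) (y : R) (z : 'rV[R]_m) : smooth h ->
  is_derive y (1 : R) (fun y => h (row_cons y z)) ('D_(delta_mx 0 ord0) h (row_cons y z)).
Proof.
move=> sh.
have E t : row_cons t z = row_cons 0 z + t *: delta_mx 0 ord0.
  rewrite delta_row_cons0 !row_consE scale0r add0r scale1r mul0mx addr0.
  by rewrite addrC.
rewrite [row_cons y z]E; under eq_fun do rewrite E.
exact: (is_derive_line (smooth_differentiable (row_cons 0 z + y *: delta_mx 0 ord0) sh)).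
Qed.

(** For the outermost variable both the integrand and the bound of the inner
    integral K (y) depend on y, so that the Leibniz rule expresses K' as the
    sum of the integral of the derivative and the integral over the face on
    which the first two variables coincide. *)
Lemma oint_derive0 m (h : 'rV[R]_m.+1 -> R) b : smooth h -> 0 <= b ->
  oint b (fun y => 'D_(delta_mx 0 ord0) h y) =
  oint b (fun y => h (row_ins b 0 y)) - oint b (fun y => h (row_ins b 1 y)).
Proof.
move=> sh b0; have ch := smooth_continuous sh.
have cD := smooth_continuous (smooth_derive (delta_mx 0 ord0) sh).
have -> : (fun y => h (row_ins b 0 y)) = (fun y => h (row_cons b y)).
  by apply/funext => y; rewrite row_ins0.
case: m h sh b0 ch cD => [|m] h sh b0 ch cD.
  rewrite /= row_ins1_nil; apply: (@int0_FTC2 R (fun y => h (row_cons y 0))) => //.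
  - by apply: (continuous_compose _ cD); apply: continuous_row_cons_comp; cts.
  - by apply: (continuous_compose _ ch); apply: continuous_row_cons_comp; cts.
  - by move=> x _; exact: (is_derive_row_cons x 0 sh).
pose f (p : R * R) := oint p.1 (fun w => h (row_cons p.2 (row_cons p.1 w))).
pose df (p : R * R) := oint p.1 (fun w : 'rV[R]_m =>
  'D_(delta_mx 0 ord0) h (row_cons p.2 (row_cons p.1 w))).
have cs (g : 'rV[R]_m.+2 -> R) : continuous g -> continuous
    (fun p : R * R => oint p.1 (fun w => g (row_cons p.2 (row_cons p.1 w)))).
  move=> cg; apply: continuous_oint; first by cts.
  apply: (continuous_compose _ cg); apply: continuous_row_cons_comp; first by cts.
  by apply: continuous_row_cons_comp; cts.
have cf : continuous f := cs _ ch.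
have cdf : continuous df := cs _ cD.
have dfE t y : is_derive y (1 : R) (fun y => f (t, y)) (df (t, y)).
  have cs2 (g : 'rV[R]_m.+2 -> R) : continuous g -> continuous
      (fun p : 'rV[R]_m * R => g (row_cons p.2 (row_cons t p.1))).
    move=> cg; apply: (continuous_compose _ cg); apply: continuous_row_cons_comp.
      by cts.
    by apply: continuous_row_cons_comp; cts.
  apply: (@oint_derive_param _ m (fun p => h (row_cons p.2 (row_cons t p.1)))
     (fun p => 'D_(delta_mx 0 ord0) h (row_cons p.2 (row_cons t p.1)))).
  - exact: cs2.
  - exact: cs2 cD.
  - by move=> w u; exact: (is_derive_row_cons u (row_cons t w) sh).
pose K y := oint y (fun z : 'rV[R]_m.+1 => h (row_cons y z)).
have cdiag : continuous (fun y => f (y, y)).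
  have cg : continuous (fun y : R => (y, y)) by cts.
  exact: (continuous_compose cg cf).
have cDs := oint_slice_continuous cD.
have : int0 b (fun y => f (y, y) + oint y (fun z : 'rV[R]_m.+1 =>
    'D_(delta_mx 0 ord0) h (row_cons y z))) = K b - K 0.
  apply: int0_FTC2 => //.
  - by move=> y; apply: cvgD; [exact: cdiag|exact: cDs].
  - exact: oint_slice_continuous.
  - by move=> x /andP[x0 _]; exact: (@int0_leibniz R f df x x0 cf cdf dfE).
rewrite int0D // {2}/K ointS (int0_le0 _ (lexx 0)) subr0 => EK; rewrite -[X in _ = X - _]/(K b) -EK.
rewrite [X in _ = _ - X]ointS.
have -> : int0 b (fun y => oint y (fun z : 'rV[R]_m => h (row_ins b 1 (row_cons y z)))) =
    int0 b (fun y => f (y, y)).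
  by apply: eq_int0 => y _; apply: oint_ext => w; rewrite row_insS row_ins0.
by rewrite addrAC subrr add0r.
Qed.

(** The variable y_j runs between y_(j-1) (or b) and y_(j+1) (or 0); the two
    faces of the ordered simplex on which it takes these values are numbered j
    and j + 1. *)
Lemma oint_derive m (h : 'rV[R]_m.+1 -> R) (j : 'I_m.+1) b : smooth h -> 0 <= b ->
  oint b (fun y => 'D_(delta_mx 0 j) h y) =
  oint b (fun y => h (row_ins b j y)) - oint b (fun y => h (row_ins b j.+1 y)).
Proof.
elim: m h j b => [|m IH] h j b sh b0.
  by rewrite ord1; exact: oint_derive0.
have [k ->|->] := unliftP ord0 j; last exact: oint_derive0.
rewrite ointS (ointS _ (fun y => h _)) (ointS _ (fun y => h (row_ins b _.+1 y))).
have ci i : continuous (fun y : 'rV[R]_m.+1 => h (row_ins b i y)).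
  exact/smooth_continuous/(smooth_comp (@smooth_row_ins _ b i) sh).
rewrite -(int0B _ (oint_slice_continuous (ci _)) (oint_slice_continuous (ci _))).
apply: eq_int0 => y /andP[y0 _].
have shy : smooth (fun z => h (row_cons y z)).
  exact: smooth_comp (@smooth_map_row_cons m.+1 y) sh.
transitivity (oint y (fun z => 'D_(delta_mx 0 k) (fun z => h (row_cons y z)) z)).
  by apply: oint_ext => z; rewrite derive_row_cons // delta_row_consS.
rewrite (IH _ k y shy y0); congr (_ - _); apply: oint_ext => z;
  by rewrite lift0 row_insS.
Qed.

End StokesSimplex.

(** * Products of iterated integrals *)

Section ShuffleProduct.
Variable R : realType.

(** The entries of y with indices in A, in increasing order. The size p is
    not tied to the cardinality of A, to avoid transporting along equations
    between dimensions. *)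
Definition select n p (A : {set 'I_n}) (y : 'rV[R]_n) : 'rV[R]_p :=
  \row_(b < p) nth 0 [seq y 0 i | i <- enum A] b.

(** Shifts A by one, to make room for an outermost variable. *)
Definition up_set n (A : {set 'I_n}) : {set 'I_n.+1} := [set fintype.lift ord0 i | i in A].

Lemma lift0_up n (A : {set 'I_n}) i : (fintype.lift ord0 i \in up_set A) = (i \in A).
Proof. by rewrite mem_imset //; exact: lift_inj. Qed.

Lemma ord0_up n (A : {set 'I_n}) : (ord0 \in up_set A) = false.
Proof. by apply/negP => /imsetP[i _ /eqP]; rewrite (negPf (neq_lift _ _)). Qed.

Lemma enum_filter (T : finType) (A : {set T}) : enum A = [seq x <- enum T | x \in A].
Proof. by rewrite {1}/enum_mem -enumT; apply: eq_filter. Qed.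

Lemma enum_up n (A : {set 'I_n}) : enum (up_set A) = map (fintype.lift ord0) (enum A).
Proof.
rewrite !enum_filter enum_ordSl /= ord0_up filter_map.
by congr map; apply: eq_filter => i /=; exact: lift0_up.
Qed.

Lemma enum_up0 n (A : {set 'I_n}) :
  enum (ord0 |: up_set A) = ord0 :: map (fintype.lift ord0) (enum A).
Proof.
rewrite !enum_filter enum_ordSl /= setU11 filter_map.
by congr (_ :: map _ _); apply: eq_filter => i /=; rewrite !inE lift0_up.
Qed.

Lemma setC_up n (A : {set 'I_n}) : finset.setC (up_set A) = ord0 |: up_set (finset.setC A).
Proof.
apply/setP => i; rewrite !inE; have [k ->|->] := unliftP ord0 i.
  by rewrite !lift0_up inE.
by rewrite ord0_up eqxx.
Qed.

Lemma setC_up0 n (A : {set 'I_n}) : finset.setC (ord0 |: up_set A) = up_set (finset.setC A).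
Proof. by rewrite -[in LHS](finset.setCK A) -setC_up finset.setCK. Qed.

Lemma select_up n p (A : {set 'I_n}) y (z : 'rV[R]_n) :
  select p (up_set A) (row_cons y z) = select p A z.
Proof.
apply/rowP => l; rewrite !mxE enum_up -map_comp; apply: (congr1 (fun s => s`_(val l))).
by apply: eq_map => i /=; rewrite row_consS.
Qed.

Lemma select_up0 n p (A : {set 'I_n}) y (z : 'rV[R]_n) :
  select p.+1 (ord0 |: up_set A) (row_cons y z) = row_cons y (select p A z).
Proof.
apply/rowP => l; rewrite mxE enum_up0 /=; have [k ->|->] := unliftP ord0 l.
  rewrite row_consS [RHS]mxE lift0 /= -map_comp (eq_map (g := fun i => z 0 i)) // => i /=.
  by rewrite row_consS.
by rewrite !row_cons0.
Qed.

Lemma smooth_select n p (A : {set 'I_n}) : smooth_map (select p A).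
Proof.
move=> l; under eq_fun do rewrite mxE.
have [lA|lA] := ltnP l (size (enum A)); last first.
  under eq_fun do rewrite nth_default ?size_map //; exact: smooth_cst.
case E: (enum A) lA => [//|i0 s]; rewrite -E => lA.
by under eq_fun do rewrite (nth_map i0) //; exact: smooth_coord.
Qed.

Lemma continuous_select n p (A : {set 'I_n}) : continuous (select p A).
Proof.
move=> y; apply: differentiable_continuous.
exact/smooth_map_differentiable/smooth_select.
Qed.

Lemma sum_sets_split n p (V : zmodType) (f : {set 'I_n.+1} -> V) :
  \sum_(A : {set 'I_n.+1} | #|A| == p.+1) f A =
  \sum_(A : {set 'I_n} | #|A| == p) f (ord0 |: up_set A) +
  \sum_(A : {set 'I_n} | #|A| == p.+1) f (up_set A).
Proof.
have upK (A : {set 'I_n}) : fintype.lift ord0 @^-1: up_set A = A.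
  by apply/setP => i; rewrite inE lift0_up.
have card_up (A : {set 'I_n}) : #|up_set A| = #|A| by rewrite card_imset //; exact: lift_inj.
rewrite (bigID (fun A : {set 'I_n.+1} => ord0 \in A)) /=; congr (_ + _).
  rewrite (reindex_onto (fun A => ord0 |: up_set A)
      (fun A => fintype.lift ord0 @^-1: A)) /=.
    apply: eq_bigl => A; rewrite setU11 andbT cardsU1 ord0_up card_up eqSS.
    rewrite (_ : _ @^-1: _ = A) ?eqxx ?andbT //.
    by apply/setP => i; rewrite !inE lift0_up.
  move=> A /andP[_ A0]; apply/setP => i; rewrite !inE.
  have [k ->|->] := unliftP ord0 i; first by rewrite lift0_up inE.
  by rewrite eqxx A0.
rewrite (reindex_onto (fun A => up_set A) (fun A => fintype.lift ord0 @^-1: A)) /=.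
  by apply: eq_bigl => A; rewrite ord0_up andbT card_up upK eqxx andbT.
move=> A /andP[_ A0]; apply/setP => i.
have [k ->|->] := unliftP ord0 i; first by rewrite lift0_up inE.
by rewrite ord0_up (negPf A0).
Qed.

Lemma select_setT n (y : 'rV[R]_n) : select n finset.setT y = y.
Proof.
apply/rowP => l; rewrite mxE enum_setT -enumT.
by rewrite (nth_map l) ?size_enum_ord // nth_ord_enum.
Qed.

Lemma continuous_mul (T : topologicalType) (f g : T -> R) :
  continuous f -> continuous g -> continuous (fun t => f t * g t).
Proof. by move=> cf cg t; apply: cvgM; [exact: cf|exact: cg]. Qed.

Lemma continuous_add (T : topologicalType) (f g : T -> R) :
  continuous f -> continuous g -> continuous (fun t => f t + g t).
Proof. by move=> cf cg t; apply: cvgD; [exact: cf|exact: cg]. Qed.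

(** Chen's shuffle formula. As functions of the bound b, both sides vanish at
    0, and the derivative of the right hand side is, by the product rule, the
    sum of two products with one variable less; on the left they correspond to
    the sets A that contain 0 and to those that do not. *)
Lemma shuffle_product n p q b (F : 'rV[R]_p -> R) (H : 'rV[R]_q -> R) :
  n = (p + q)%N -> continuous F -> continuous H -> 0 <= b ->
  \sum_(A : {set 'I_n} | #|A| == p)
     oint b (fun y => F (select p A y) * H (select q (finset.setC A) y)) =
  oint b F * oint b H.
Proof.
elim: n p q b F H => [|n IH] p q b F H.
  case: p F => // F; case: q H => // H _ cF cH b0.
  rewrite (big_pred1 finset.set0) => [|A]; last by rewrite cards_eq0.
  by rewrite /=; congr (F _ * H _); apply/rowP => -[].
case: p F => [|p] F.
  move=> nq cF cH b0; rewrite add0n in nq; subst q.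
  rewrite (big_pred1 finset.set0) => [|A]; last by rewrite cards_eq0.
  rewrite finset.setC0 [oint b F]/= -ointZ //; apply: oint_ext => y.
  by rewrite select_setT; congr (F _ * _); apply/rowP => -[].
case: q H => [|q] H.
  rewrite addn0 => -[np] cF cH b0; subst p.
  rewrite (big_pred1 finset.setT) => [|A]; last first.
    rewrite [RHS]/= eqEcard finset.subsetT cardsT card_ord eqn_leq.
    by rewrite -[X in (_ <= X)%N && _]card_ord max_card.
  rewrite [oint b H]/= mulrC -ointZ //; apply: oint_ext => y.
  by rewrite select_setT mulrC; congr (H _ * _); apply/rowP => -[].
move=> npq cF cH b0; rewrite sum_sets_split.
pose F1 y z := F (row_cons y z); pose H1 y z := H (row_cons y z).
have cF1 y : continuous (F1 y) := continuous_slice cF.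
have cH1 y : continuous (H1 y) := continuous_slice cH.
have cFH (A : {set 'I_n.+1}) : continuous
    (fun y => F (select p.+1 A y) * H (select q.+1 (finset.setC A) y)).
  have c1 := continuous_compose (@continuous_select _ p.+1 A) cF.
  have c2 := continuous_compose (@continuous_select _ q.+1 (finset.setC A)) cH.
  exact: continuous_mul c1 c2.
have cP := oint_slice_continuous cF; have cQ := oint_slice_continuous cH.
have cS (r : nat) (f : {set 'I_n} -> {set 'I_n.+1}) : continuous (fun y =>
    \sum_(A : {set 'I_n} | #|A| == r) F (select p.+1 (f A) y) *
      H (select q.+1 (finset.setC (f A)) y)).
  by apply: continuous_sumR => A _; exact: cFH.
rewrite -oint_sum => [|A _]; last exact: cFH.
rewrite -oint_sum => [|A _]; last exact: cFH.
rewrite -(ointD b (cS p (fun A => ord0 |: up_set A)) (cS p.+1 (@up_set n))).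
rewrite ointS (_ : oint b F * oint b H = oint b F * oint b H - oint 0 F * oint 0 H); last first.
  by rewrite [oint 0 F]int0_le0 // mul0r subr0.
apply: (@int0_FTC2 R (fun b => oint b F * oint b H)) => //.
- exact: (oint_slice_continuous (continuous_add (cS p (fun A => ord0 |: up_set A))
    (cS p.+1 (@up_set n)))).
- exact: continuous_mul (int0_continuous_bound cP) (int0_continuous_bound cQ).
move=> x /andP[/[dup] x0 /ltW x0' _].
rewrite (ointD x (continuous_slice (cS p (fun A => ord0 |: up_set A)))
  (continuous_slice (cS p.+1 (@up_set n)))).
rewrite oint_sum => [|A _]; last exact: continuous_slice (cFH _).
rewrite oint_sum => [|A _]; last exact: continuous_slice (cFH _).
have -> : \sum_(A : {set 'I_n} | #|A| == p) oint x (fun z =>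
    F (select p.+1 (ord0 |: up_set A) (row_cons x z)) *
    H (select q.+1 (finset.setC (ord0 |: up_set A)) (row_cons x z))) =
    oint x (F1 x) * oint x H.
  rewrite -(IH p q.+1 x (F1 x) H) //; last by move: npq; rewrite addSn => -[].
  apply: eq_bigr => A _; apply: oint_ext => z.
  by rewrite setC_up0 select_up select_up0.
have -> : \sum_(A : {set 'I_n} | #|A| == p.+1) oint x (fun z =>
    F (select p.+1 (up_set A) (row_cons x z)) *
    H (select q.+1 (finset.setC (up_set A)) (row_cons x z))) =
    oint x F * oint x (H1 x).
  rewrite -(IH p.+1 q x F (H1 x)) //; last by move: npq; rewrite addnS => -[].
  apply: eq_bigr => A _; apply: oint_ext => z.
  by rewrite setC_up select_up select_up0.
(* The derivatives of the two factors at x are the inner integrals. *)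
have dP := int0_FTC1 cP x0; have dQ := int0_FTC1 cQ x0.
have -> : oint x (F1 x) * oint x H + oint x F * oint x (H1 x) =
    oint x F *: oint x (H1 x) + oint x H *: oint x (F1 x).
  by rewrite addrC [_ * oint x H]mulrC.
exact: is_deriveM.
Qed.

End ShuffleProduct.

(** * Wedge products on block matrices *)

Section BlockPermutations.
Variables p q : nat.

Definition sum_perm_fun (t : 'S_p * 'S_q) (i : 'I_(p + q)) : 'I_(p + q) :=
  match fintype.split i with inl a => lshift q (t.1 a) | inr b => rshift p (t.2 b) end.

Lemma sum_perm_inj t : injective (sum_perm_fun t).
Proof.
move=> i j; rewrite /sum_perm_fun.
case: (split_ordP i) => a ->; case: (split_ordP j) => b ->.
- by move=> /lshift_inj /perm_inj ->.
- by move/eqP; rewrite eq_lrshift.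
- by move/eqP; rewrite eq_rlshift.
- by move=> /rshift_inj /perm_inj ->.
Qed.

Definition sum_perm t : 'S_(p + q) := perm (@sum_perm_inj t).

Lemma sum_perm_l t a : sum_perm t (lshift q a) = lshift q (t.1 a).
Proof. by rewrite permE /sum_perm_fun -[lshift q a]/(unsplit (inl a)) unsplitK. Qed.

Lemma sum_perm_r t b : sum_perm t (rshift p b) = rshift p (t.2 b).
Proof. by rewrite permE /sum_perm_fun -[rshift p b]/(unsplit (inr b)) unsplitK. Qed.

Lemma sum_perm_is_inj : injective sum_perm.
Proof.
move=> [t1 t2] [u1 u2] E; congr pair; apply/permP => a.
  by apply: (@lshift_inj p q); rewrite -(sum_perm_l (t1, t2)) E sum_perm_l.
by apply: (@rshift_inj p q); rewrite -(sum_perm_r (t1, t2)) E sum_perm_r.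
Qed.

Lemma row_perm_sum_perm (S : Type) d (t : 'S_p * 'S_q) (U : 'M[S]_(p, d)) (D : 'M[S]_(q, d)) :
  row_perm (sum_perm t) (col_mx U D) = col_mx (row_perm t.1 U) (row_perm t.2 D).
Proof.
apply/matrixP => i j; rewrite mxE; case: (split_ordP i) => a ->.
  by rewrite sum_perm_l !col_mxEu mxE.
by rewrite sum_perm_r !col_mxEd mxE.
Qed.

(** The permutation matrix is block diagonal. *)
Lemma sign_sum_perm (S : comRingType) t :
  (-1) ^+ sum_perm t = (-1) ^+ t.1 * (-1) ^+ t.2 :> S.
Proof.
rewrite -!det_perm.
have -> : perm_mx (sum_perm t) = block_mx (perm_mx t.1) 0 0 (perm_mx t.2) :> 'M[S]_(p + q).

  rewrite /perm_mx (scalar_mx_block p q 1) /block_mx row_perm_sum_perm.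
  by congr col_mx; apply/matrixP => i j; rewrite !mxE; case: fintype.split => k; rewrite !mxE.
by rewrite det_ublock.
Qed.

(** A permutation that maps the first p indices among themselves permutes the
    other q indices too. *)
Lemma sum_permP (s : 'S_(p + q)) :
  (forall a : 'I_p, (s (lshift q a) < p)%N) -> s \in [set sum_perm t | t in finset.setT]%SET.
Proof.
move=> sp.
pose f1 a : 'I_p := Ordinal (sp a).
have f1E a : lshift q (f1 a) = s (lshift q a) by exact: val_inj.
have f1_inj : injective f1.
  by move=> a b /(congr1 (lshift q)); rewrite !f1E => /perm_inj /lshift_inj.
have sq (b : 'I_q) : exists k, s (rshift p b) == rshift p k.
  case: (split_ordP (s (rshift p b))) => k E; last by exists k; rewrite E.
  have [a /esym ka] : exists a, f1 a = k.
    by have [g _ gK] := injF_bij f1_inj; exists (g k).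
  by move: E; rewrite ka f1E => /perm_inj /eqP; rewrite eq_rlshift.
pose f2 b := xchoose (sq b).
have f2E b : rshift p (f2 b) = s (rshift p b) by rewrite (eqP (xchooseP (sq b))).
have f2_inj : injective f2.
  by move=> a b /(congr1 (@rshift p q)); rewrite !f2E => /perm_inj /rshift_inj.
apply/imsetP; exists (perm f1_inj, perm f2_inj) => //; apply/permP => i.
case: (split_ordP i) => a ->; first by rewrite sum_perm_l permE f1E.
by rewrite sum_perm_r permE f2E.
Qed.

End BlockPermutations.

Section WedgeBlock.
Variable R : realType.

Lemma form_row0 (M : ftorus R) m (w : preform M m) x (A : 'M[R]_(m, tdim M)) i :
  is_form w -> row i A = 0 -> w x A = 0.
Proof.
move=> [lw _ _ _] A0; have := lw x A i 1 0 0; rewrite scale1r addr0 mul1r.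
have -> : set_row A i 0 = A.
  apply/matrixP => k l; rewrite !mxE; case: eqP => // ->.
  by have /rowP/(_ l) := A0; rewrite !mxE.
by move/eqP; rewrite -subr_eq0 opprD addNKr oppr_eq0 => /eqP.
Qed.

(** In the sum over all permutations that defines the wedge product, a
    permutation that moves one of the first p rows to one of the last q
    contributes 0, because this row has no component along M. The others
    permute the two blocks separately, and all p! q! of them contribute the
    same value. *)
Lemma fcross_block (M N : ftorus R) p q (w : dform M p) (v : dform N q)
    (x : 'rV[R]_(tdim M + tdim N)) (A : 'M[R]_(p, tdim M)) (B : 'M[R]_(q, tdim N)) :
  form_val (fcross w v) x (block_mx A 0 0 B) =
    form_val w (lsubmx x) A * form_val v (rsubmx x) B.
Proof.
have fw := formP w; have fv := formP v.
have [_ aw _ _] := fw; have [_ av _ _] := fv.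
rewrite /= /wedge_fun /pullback_fun.
set C := block_mx A 0 0 B.
have pr1E k (y : 'M[R]_(k, tdim M + tdim N)) : y *m tmap_lin (pr1T M N) = lsubmx y.
  by rewrite -{1}[y]hsubmxK /= mul_row_col mulmx1 mulmx0 addr0.
have pr2E k (y : 'M[R]_(k, tdim M + tdim N)) : y *m tmap_lin (pr2T M N) = rsubmx y.
  by rewrite -{1}[y]hsubmxK /= mul_row_col mulmx1 mulmx0 add0r.
rewrite (bigID (fun s => s \in [set @sum_perm p q t | t in finset.setT]%SET)) /=.
rewrite [X in _ * (_ + X)]big1 => [|s]; last first.
  move/negP => sP; have [a ap] : exists a : 'I_p, (p <= s (lshift q a))%N.
    apply/existsP; apply: contraT; rewrite negb_exists => /forallP sp.
    by case: sP; apply: sum_permP => a; rewrite ltnNge sp.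
  rewrite (@form_row0 _ _ w _ _ a fw) ?mulr0 ?mul0r // pr1E.
  apply/rowP => l; rewrite !mxE; case: (split_ordP (s (lshift q a))) ap => k ->.
    by rewrite /= leqNgt ltn_ord.
  by move=> _; rewrite row_mxEl mxE.
rewrite addr0 big_imset /=; last by move=> t u _ _; exact: sum_perm_is_inj.
rewrite (eq_bigr (fun=> form_val w (lsubmx x) A * form_val v (rsubmx x) B)); last first.
  move=> t _; rewrite sign_sum_perm !pr1E !pr2E /C /block_mx row_perm_sum_perm.
  rewrite col_mxKu col_mxKd.
  have -> : lsubmx (row_perm t.1 (row_mx A (0 : 'M[R]_(p, tdim N)))) = row_perm t.1 A.
    by rewrite !row_permE mul_mx_row row_mxKl.
  have -> : rsubmx (row_perm t.2 (row_mx (0 : 'M[R]_(q, tdim M)) B)) = row_perm t.2 B.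
    by rewrite !row_permE mul_mx_row row_mxKr.
  rewrite aw av; set a := (-1) ^+ t.1; set b := (-1) ^+ t.2.
  set u := form_val w _ _; set u' := form_val v _ _.
  have aa : a ^+ 2 = 1 by exact: sqrr_sign.
  have bb : b ^+ 2 = 1 by exact: sqrr_sign.
  by transitivity (a ^+ 2 * b ^+ 2 * (u * u')); [ring|rewrite aa bb !mul1r].
rewrite sumr_const cardsT card_prod !card_Sn -[X in _ * X]mulr_natl [LHS]mulrA mulVf ?mul1r //.
Qed.

End WedgeBlock.

(** * Derivatives of forms along smooth maps *)

Section SmoothDerivatives.
Variables (R : realType) (e : nat).
Implicit Types f g : 'rV[R]_e -> R.

Lemma smooth_derivable f x v : smooth f -> derivable f x v.
Proof. by move=> sf; exact/diff_derivable/smooth_differentiable. Qed.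

Lemma derive_mul f g x v : smooth f -> smooth g ->
  'D_v (fun y => f y * g y) x = f x * 'D_v g x + g x * 'D_v f x.
Proof. by move=> sf sg; apply: deriveM; exact: smooth_derivable. Qed.

Lemma derive_scale c f x v : smooth f -> 'D_v (fun y => c * f y) x = c * 'D_v f x.
Proof. by move=> sf; apply: deriveZ; exact: smooth_derivable. Qed.

Lemma derive_bigsum n (f : 'I_n -> 'rV[R]_e -> R) x v : (forall i, smooth (f i)) ->
  'D_v (fun y => \sum_(i < n) f i y) x = \sum_(i < n) 'D_v (f i) x.
Proof.
move=> sf; rewrite -derive_sum => [|i]; last exact: smooth_derivable.
by apply: (congr1 (fun f : 'rV[R]_e -> R => 'D_v f x)); apply/funext => y; rewrite fct_sumE.
Qed.

End SmoothDerivatives.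

Section MultilinearCalculus.
Variable R : realType.
Variables (M : ftorus R) (m : nat) (w : preform M m).
Hypothesis wP : is_form w.
Local Notation d := (tdim M).

Lemma set_row_id (A : 'M[R]_(m, d)) i : set_row A i (row i A) = A.
Proof. by apply/matrixP => k l; rewrite !mxE; case: eqP => // ->. Qed.

Lemma set_rowC (A : 'M[R]_(m, d)) i j u v : i != j ->
  set_row (set_row A i u) j v = set_row (set_row A j v) i u.
Proof.
move=> ij; apply/matrixP => k l; rewrite !mxE.
by case: (eqVneq k j) => // ->; rewrite eq_sym (negPf ij).
Qed.

Lemma row_set_row (A : 'M[R]_(m, d)) i j u :
  row j (set_row A i u) = if j == i then u else row j A.
Proof. by apply/rowP => l; rewrite !mxE; case: eqP; rewrite ?mxE. Qed.

Lemma form_set_row0 x (A : 'M[R]_(m, d)) i : w x (set_row A i 0) = 0.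
Proof. by apply: (@form_row0 _ _ _ w x _ i wP); rewrite row_set_row eqxx. Qed.

Lemma form_row_sum x (A : 'M[R]_(m, d)) i I (r : seq I) (c : I -> R) (u : I -> 'rV[R]_d) :
  w x (set_row A i (\sum_(k <- r) c k *: u k)) =
  \sum_(k <- r) c k * w x (set_row A i (u k)).
Proof.
elim: r => [|k r IH]; first by rewrite !big_nil form_set_row0.
by rewrite !big_cons (form_multilinear wP) IH.
Qed.

Lemma form_row_coords x (A : 'M[R]_(m, d)) i u :
  w x (set_row A i u) = \sum_j u 0 j * w x (set_row A i (delta_mx 0 j)).
Proof. by rewrite {1}[u]row_sum_delta form_row_sum. Qed.

Lemma form_coords x (A : 'M[R]_(m, d)) i :
  w x A = \sum_j A i j * w x (set_row A i (delta_mx 0 j)).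
Proof.
by rewrite -{1}(set_row_id A i) form_row_coords; apply: eq_bigr => j _; rewrite mxE.
Qed.

Section Composition.
Variables (e : nat) (G : 'rV[R]_e -> 'rV[R]_d).
Hypothesis sG : smooth_map G.

Definition smooth_rows (A : 'rV[R]_e -> 'M[R]_(m, d)) :=
  forall i, smooth_map (fun y => row i (A y)).

Lemma smooth_rows_entry A i j : smooth_rows A -> smooth (fun y => A y i j).
Proof. by move=> sA; have := sA i j; under eq_fun do rewrite mxE. Qed.

Lemma smooth_rows_set_row A i u :
  smooth_rows A -> smooth_rows (fun y => set_row (A y) i u).
Proof.
move=> sA k; under eq_fun do rewrite row_set_row.
by case: (k == i) => [l|]; [exact: (@smooth_cst R e (u 0 l))|exact: sA].
Qed.

(** An induction on k reduces statements on w (G y) (A y) to the case of a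
    constant matrix A: expanding the last row that is not constant along the
    standard basis by [form_coords] decreases k. *)
Definition const_rows_from k (A : 'rV[R]_e -> 'M[R]_(m, d)) :=
  forall (i : 'I_m) y z, (k <= i)%N -> row i (A y) = row i (A z).

Lemma const_rows_set_row (A : 'rV[R]_e -> 'M[R]_(m, d)) (k : 'I_m) u :
  const_rows_from k.+1 A -> const_rows_from k (fun y => set_row (A y) k u).
Proof.
move=> cA i y z ki; rewrite !row_set_row; case: (eqVneq i k) => // ik.
by apply: cA; rewrite ltn_neqAle eq_sym ki andbT.
Qed.

Lemma smooth_form_comp A : smooth_rows A -> smooth (fun y => w (G y) (A y)).
Proof.
move=> sA; have cA : const_rows_from m A by move=> i y z; rewrite leqNgt ltn_ord.
suff H k : (k <= m)%N -> forall A, smooth_rows A -> const_rows_from k A ->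
    smooth (fun y => w (G y) (A y)) by exact: H (leqnn m) A sA cA.
elim: k {A sA cA} => [|k IH] km A sA cA.
  have -> : (fun y => w (G y) (A y)) = (fun y => w (G y) (A 0)).
    apply/funext => y; congr (w _ _); apply/row_matrixP => i; exact: cA.
  exact: smooth_comp sG (form_smooth wP _).
pose i := Ordinal km.
have -> : (fun y => w (G y) (A y)) = (fun y => \sum_j A y i j *
    w (G y) (set_row (A y) i (delta_mx 0 j))).
  by apply/funext => y; rewrite -form_coords.
apply: smooth_sum => j; apply: smoothM; first exact: smooth_rows_entry.
apply: (IH (ltnW km) (fun y => set_row (A y) i (delta_mx 0 j))).
  exact: smooth_rows_set_row.
exact: (@const_rows_set_row A i).
Qed.

(** The product rule: the point G y and every row of A y contribute one term. *)
Lemma derive_form_comp A y v : smooth_rows A ->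
  'D_v (fun y => w (G y) (A y)) y =
  'D_('D_v G y) (fun x => w x (A y)) (G y) +
  \sum_i w (G y) (set_row (A y) i ('D_v (fun y => row i (A y)) y)).
Proof.
move=> sA; have cA : const_rows_from m A by move=> i z z'; rewrite leqNgt ltn_ord.
suff H k : (k <= m)%N -> forall A, smooth_rows A -> const_rows_from k A ->
    'D_v (fun y => w (G y) (A y)) y = 'D_('D_v G y) (fun x => w x (A y)) (G y) +
    \sum_i w (G y) (set_row (A y) i ('D_v (fun y => row i (A y)) y)).
  exact: H (leqnn m) A sA cA.
elim: k {A sA cA} => [|k IH] km A sA cA.
  rewrite [X in _ + X]big1 => [|i _]; last first.
    rewrite (_ : (fun y => row i (A y)) = cst (row i (A 0))).
      by rewrite derive_cst form_set_row0.
    by apply/funext => z; exact: cA.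
  rewrite addr0 -derive_chain; last 2 first.
  - exact: smooth_map_differentiable.
  - exact/smooth_differentiable/(form_smooth wP).
  apply: (congr1 (fun f : 'rV[R]_e -> R => 'D_v f y)); apply/funext => z; congr (w _ _).
  by apply/row_matrixP => i; exact: cA.
pose i := Ordinal km; pose B j z := set_row (A z) i (delta_mx 0 j).
have sB j : smooth_rows (B j) by exact: smooth_rows_set_row.
have sAj j := smooth_rows_entry i j sA.
have sBj j := smooth_form_comp (sB j).
have sBx j : smooth (fun x => w x (B j y)) := form_smooth wP (B j y).
have -> : (fun y => w (G y) (A y)) = (fun y => \sum_j A y i j * w (G y) (B j y)).
  by apply/funext => z; rewrite -form_coords.
rewrite derive_bigsum => [|j]; last exact: smoothM.
have IHB j := IH (ltnW km) (B j) (sB j) (const_rows_set_row (k := i) (delta_mx 0 j) cA).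
under eq_bigr => j _ do rewrite derive_mul // IHB mulrDr -addrA.
rewrite big_split /=; congr (_ + _).
  have -> : (fun x => w x (A y)) = (fun x => \sum_j A y i j * w x (B j y)).
    by apply/funext => z; rewrite -form_coords.
  rewrite derive_bigsum => [|j]; last by apply: smoothM => //; exact: smooth_cst.
  by apply: eq_bigr => j _; rewrite derive_scale.
rewrite big_split /= [RHS](bigD1 i) //= addrC; congr (_ + _).
  rewrite form_row_coords; apply: eq_bigr => j _; rewrite mulrC; congr (_ * _).
  rewrite derive_coord; last exact/smooth_map_differentiable/sA.
  by apply: (congr1 (fun f : 'rV[R]_e -> R => 'D_v f y)); apply/funext => z; rewrite mxE.
under eq_bigr do rewrite mulr_sumr.
rewrite exchange_big (bigD1 i) //= [X in X + _]big1 ?add0r => [|j _]; last first.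
  have -> : (fun z => row i (B j z)) = cst (delta_mx 0 j).
    by apply/funext => z; rewrite row_set_row eqxx.
  by rewrite derive_cst form_set_row0 mulr0.
apply: eq_bigr => l li; set u := 'D_v (fun y => row l (A y)) y.
rewrite [RHS](form_coords _ _ i); apply: eq_bigr => j _.
have -> : set_row (A y) l u i j = A y i j by rewrite mxE eq_sym (negPf li).
rewrite (set_rowC _ _ _ li).
have -> // : 'D_v (fun z => row l (B j z)) y = u.
apply: (congr1 (fun f : 'rV[R]_e -> 'rV[R]_d => 'D_v f y)); apply/funext => z.
by rewrite row_set_row (negPf li).
Qed.

End Composition.
End MultilinearCalculus.

(** * The exterior derivative commutes with charts *)

Section StokesChart.
Variable R : realType.

(** The transposition of j and k fixes A, and maps the rows other than k to the
    rows other than j; the permutation that it induces on the m remaining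
    positions has the sign - (-1)^(j + k). *)
Lemma form_row'_swap (M : ftorus R) m (w : preform M m) x
    (A : 'M[R]_(m.+1, tdim M)) (j k : 'I_m.+1) : is_form w -> j != k ->
  row j A = row k A ->
  (-1) ^+ j * w x (row' j A) + (-1) ^+ k * w x (row' k A) = 0.
Proof.
move=> wP jk Ajk; pose t := tperm j k.
have tk i : exists i', t (fintype.lift k i) == fintype.lift j i'.
  have [i' ->|E] := unliftP j (t (fintype.lift k i)); first by exists i'.
  have /eqP := congr1 t E; rewrite tpermK tpermL eq_sym.
  by rewrite (negPf (neq_lift _ _)).
pose s0 i := xchoose (tk i).
have s0E i : t (fintype.lift k i) = fintype.lift j (s0 i) by rewrite (eqP (xchooseP (tk i))).
have s0_inj : injective s0.
  by move=> a b /(congr1 (fintype.lift j)); rewrite -!s0E => /perm_inj/lift_inj.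
pose s := perm s0_inj.
have tE : t = lift_perm k j s.
  apply/permP => i; have [i' ->|->] := unliftP k i.
    by rewrite s0E lift_perm_lift [s _]permE.
  by rewrite lift_perm_id tpermR.
have At : row_perm t A = A.
  apply/row_matrixP => i; apply/rowP => l; rewrite !mxE /t.
  have /rowP/(_ l) := Ajk; rewrite !mxE => El.
  by case: tpermP => [->|->|].
have -> : row' k A = row_perm s (row' j A).
  apply/matrixP => i l; rewrite -{1}At !mxE tE lift_perm_lift.
  by [].
rewrite (form_alternating wP).
have := odd_lift_perm k j s; rewrite -tE odd_tperm jk => /esym so.
have -> : (-1) ^+ s = - (-1) ^+ k * (-1) ^+ j :> R.
  have -> : (s : bool) = true (+) odd k (+) odd j.
    by rewrite -so; case: (odd k); case: (odd j); case: (s : bool).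
  by rewrite !signr_addb expr1 !signr_odd mulN1r.
rewrite mulrA mulrA mulrN -expr2 -signr_odd sqrr_sign mulN1r mulNr addrC.
by rewrite addNr.
Qed.

Lemma row_jacobian d e (G : 'rV[R]_d -> 'rV[R]_e) y j : smooth_map G ->
  row j (jacobian G y) = 'D_(delta_mx 0 j) G y.
Proof.
by move=> sG; rewrite deriveEjacobian ?rowE //; exact: smooth_map_differentiable.
Qed.

Lemma smooth_rows_jacobian' (M : ftorus R) m (G : 'rV[R]_m.+1 -> 'rV[R]_(tdim M)) j :
  smooth_map G -> @smooth_rows R M m m.+1 (fun y => row' j (jacobian G y)).
Proof.
move=> sG i; have -> : (fun y => row i (row' j (jacobian G y))) =
    (fun y => 'D_(delta_mx 0 (fintype.lift j i)) G y).
  apply/funext => y; rewrite -row_jacobian //.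
  by apply/rowP => l; rewrite !mxE.
exact: smooth_map_derive.
Qed.

(** Pullback commutes with the exterior derivative. The derivatives of the
    Jacobian contribute a sum over j <> k of
    X_jk = (-1)^j w (rows of J other than j, with row k replaced by D_j D_k G).
    As second derivatives are symmetric, X_jk = - X_kj, and the sum vanishes. *)
Lemma extd_chart (M : ftorus R) m (w : preform M m)
    (G : 'rV[R]_m.+1 -> 'rV[R]_(tdim M)) y : is_form w -> smooth_map G ->
  \sum_(j < m.+1) (-1) ^+ j * 'D_(delta_mx 0 j) (fun y => w (G y) (row' j (jacobian G y))) y =
  extd w (G y) (jacobian G y).
Proof.
move=> wP sG; rewrite /extd.
pose J := jacobian G y.
pose H (j k : 'I_m.+1) := 'D_(delta_mx 0 j) (fun y => 'D_(delta_mx 0 k) G y) y.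
(* Both rows j and k are replaced, so that the rows other than j and those
   other than k are minors of the same matrix. *)
pose K j k := set_row (set_row J j (H j k)) k (H j k).
have HE j k l : H j k 0 l =
    'D_(delta_mx 0 j) (fun z => 'D_(delta_mx 0 k) (fun z => G z 0 l) z) y.
  have dH := smooth_map_differentiable y (smooth_map_derive (delta_mx 0 k) sG).
  apply: (etrans (derive_coord _ l dH)).
  apply: (congr1 (fun f : 'rV[R]_m.+1 -> R => 'D_(delta_mx 0 j) f y)).
  apply/funext => z; apply: derive_coord; exact: smooth_map_differentiable.
have HC j k : H j k = H k j.
  apply/rowP => l; apply: (etrans (HE j k l)); apply: (etrans _ (esym (HE k j l))).
  exact: derive_commute (sG l).
have KE j k : w (G y) (row' j (K j k)) = w (G y) (row' j (set_row J k (H j k))).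
  congr (w _ _); apply/row_matrixP => i; apply/rowP => l; rewrite !mxE.
  by rewrite [fintype.lift j i == j]eq_sym (negPf (neq_lift _ _)).
pose X (j k : 'I_m.+1) := if j == k then 0 else (-1) ^+ j * w (G y) (row' j (K j k)).
have XN j k : X j k = - X k j.
  rewrite /X eq_sym; case: eqP => [|/eqP kj]; first by rewrite oppr0.
  apply/eqP; rewrite -subr_eq0 opprK; apply/eqP.
  have -> : K k j = K j k.
    by rewrite /K (HC k j) set_rowC.
  apply: (form_row'_swap (G y) wP); first by rewrite eq_sym.
  by rewrite /K !row_set_row !eqxx; case: eqP.
have X0 : \sum_j \sum_k X j k = 0.
  have : \sum_j \sum_k X j k = - \sum_j \sum_k X j k.
    rewrite [LHS]exchange_big -sumrN; apply: eq_bigr => k _.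
    by rewrite -sumrN; apply: eq_bigr => j _; exact: XN.
  by move/eqP; rewrite -addr_eq0 -mulr2n mulrn_eq0 => /eqP.
rewrite -[RHS]addr0 -[X in _ = _ + X]X0 -big_split /=; apply: eq_bigr => j _.
have sA := smooth_rows_jacobian' (M := M) j sG.
rewrite (derive_form_comp wP sG) // mulrDr row_jacobian //; congr (_ + _).
rewrite mulr_sumr (bigD1_ord j) //= {1}/X eqxx add0r; apply: eq_bigr => i _.
rewrite /X (negPf (neq_lift _ _)) KE; congr (_ * w _ _).
have -> : 'D_(delta_mx 0 j) (fun z => row i (row' j (jacobian G z))) y =
    H j (fintype.lift j i).
  apply: (congr1 (fun f : 'rV[R]_m.+1 -> 'rV[R]_(tdim M) => 'D_(delta_mx 0 j) f y)).
  apply/funext => z; rewrite -row_jacobian //.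
  by apply/rowP => l; rewrite !mxE.
apply/row_matrixP => i'; apply/rowP => l; rewrite !mxE.
by rewrite (inj_eq lift_inj).
Qed.

End StokesChart.

(** * The theorem of Stokes for a smooth simplex *)

Section ChartIntegral.
Variable R : realType.

Definition chart_int (M : ftorus R) m (G : 'rV[R]_m -> 'rV[R]_(tdim M)) (w : preform M m) : R :=
  oint 1 (fun y => w (G y) (jacobian G y)).

Lemma smooth_rows_jacobian (M : ftorus R) m (G : 'rV[R]_m -> 'rV[R]_(tdim M)) :
  smooth_map G -> @smooth_rows R M m m (fun y => jacobian G y).
Proof.
move=> sG i; have -> : (fun y => row i (jacobian G y)) = (fun y => 'D_(delta_mx 0 i) G y).
  by apply/funext => y; rewrite -row_jacobian.
exact: smooth_map_derive.
Qed.

Lemma smooth_chart_integrand (M : ftorus R) m (G : 'rV[R]_m -> 'rV[R]_(tdim M))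
    (w : preform M m) : smooth_map G -> is_form w ->
  smooth (fun y => w (G y) (jacobian G y)).
Proof.
by move=> sG wP; apply: (smooth_form_comp wP sG); exact: smooth_rows_jacobian.
Qed.

Lemma jacobian_affine d e c (G : 'rV[R]_d -> 'rV[R]_e) (a : 'rV[R]_d) (L : 'M[R]_(c, d)) y :
  smooth_map G ->
  jacobian (fun y => G (a + y *m L)) y = L *m jacobian G (a + y *m L).
Proof.
move=> sG; apply/row_matrixP => i.
have sa := @smooth_map_affine R c d a L.
have da := smooth_map_differentiable y sa.
have dG := smooth_map_differentiable (a + y *m L) sG.
rewrite row_jacobian; last exact: smooth_map_comp sa sG.
apply: (etrans (derive_chain _ da dG)).
rewrite row_mul -(deriveEjacobian _ dG); congr ('D_ _ _ _).
have -> : (fun y => a + y *m L) = cst a + (fun y : 'rV[R]_c => y *m L) by [].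
rewrite deriveD; last 2 first.
- exact: derivable_cst.
- exact/diff_derivable/differentiable_mulmxr.
by rewrite derive_cst add0r derive_mulmxr -rowE.
Qed.

Lemma lift_int_chart (M : ftorus R) m (g : 'rV[R]_m.+1 -> 'rV[R]_(tdim M)) (w : preform M m) :
  smooth_map g -> lift_int g w = chart_int (fun y => g (bary y)) w.
Proof.
move=> sg; apply: oint_ext => y; congr (w _ _).
rewrite (jacobian_affine (delta_mx 0 0) (edge_mx R m) y sg).
apply/row_matrixP => i; rewrite rowK row_mul -deriveEjacobian //.
exact: smooth_map_differentiable.
Qed.

(** The linear part of the affine map [row_ins]. *)
Definition ins_mx m (i : nat) : 'M[R]_(m, m.+1) :=
  \matrix_(a, l) (if (l < i)%N then (l == a :> nat)%:R else (l == a.+1 :> nat)%:R).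

Lemma rnth_sum m (y : 'rV[R]_m) l : rnth y l = \sum_a y 0 a * (l == a :> nat)%:R.
Proof.
rewrite /rnth; case: insubP => [k _ <-|lm].
  rewrite (bigD1 k) //= eqxx mulr1 big1 ?addr0 // => a ak.
  by rewrite val_eqE eq_sym (negPf ak) mulr0.
rewrite big1 // => a _; case: eqP => [la|]; last by rewrite mulr0.
by rewrite la ltn_ord in lm.
Qed.

Lemma row_ins_affine m b i (y : 'rV[R]_m) :
  row_ins b i y = row_ins b i 0 + y *m ins_mx m i.
Proof.
have r0 l : rnth (0 : 'rV[R]_m) l = 0.
  by rewrite /rnth; case: insubP => [k _ _|//]; rewrite mxE.
apply/rowP => l; rewrite !mxE; case: (ltnP l i) => li.
  rewrite r0 add0r rnth_sum; apply: eq_bigr => a _.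
  by rewrite mxE li.
case El: (nat_of_ord l) => [|k].
  rewrite !rnth_cons0 big1 ?addr0 // => a _.
  by rewrite mxE ltnNge li /= El mulr0.
rewrite !rnth_consS r0 add0r rnth_sum; apply: eq_bigr => a _.
by rewrite mxE ltnNge li /= El eqSS.
Qed.

Lemma row_ins_mx m i d (A : 'M[R]_(m.+1, d)) (a : 'I_m) :
  row a (ins_mx m i *m A) =
  (if (a < i)%N then row (widen_ord (leqnSn m) a) A else 0) +
  (if (i <= a.+1)%N then row (fintype.lift ord0 a) A else 0).
Proof.
apply/rowP => c; rewrite !mxE.
rewrite (eq_bigr (fun l => (if (a < i)%N then (l == widen_ord (leqnSn m) a)%:R * A l c else 0)
   + (if (i <= a.+1)%N then (l == fintype.lift ord0 a)%:R * A l c else 0))); last first.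
  move=> l _; rewrite mxE -!val_eqE /= /bump leq0n add1n.
  case: (eqVneq (l : nat) a) => [la|la].
    rewrite la ltn_eqF // mul0r; case: (ltnP a i) => ai.
      by rewrite mul1r; case: ifP; rewrite addr0.
    by rewrite !mul0r; case: ifP; rewrite addr0.
  case: (eqVneq (l : nat) a.+1) => [->|la'].
    rewrite mul0r; case: (ltnP a.+1 i) => _; rewrite ?mul0r ?mul1r;
      by case: ifP => _; rewrite ?addr0 ?add0r.
  by case: ifP => _; case: ifP => _; case: ifP => _; rewrite ?mul0r ?addr0.
have pick (j : 'I_m.+1) : \sum_l (l == j)%:R * A l c = A j c.
  rewrite (bigD1 j) //= eqxx mul1r big1 ?addr0 // => l /negPf ->.
  by rewrite mul0r.
rewrite big_split /=; congr (_ + _).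
  by case: ifP => _; rewrite ?pick !mxE // big1.
by case: ifP => _; rewrite ?pick !mxE // big1.
Qed.

(** The convention that f (i) = 0 for i out of range makes the formula for the
    faces of the simplex the same at both ends. *)
Definition minor_val (V : zmodType) m (f : 'I_m.+1 -> V) (i : nat) : V :=
  if insub i is Some j then f j else 0.

Lemma minor_val_ord (V : zmodType) m (f : 'I_m.+1 -> V) (i : 'I_m.+1) :
  minor_val f i = f i.
Proof. by rewrite /minor_val valK. Qed.

Lemma row_row' m d (A : 'M[R]_(m.+1, d)) k a :
  row a (row' k A) = row (fintype.lift k a) A.
Proof. by apply/rowP => c; rewrite !mxE. Qed.

(** On the face i with 0 < i <= m the coordinate vector e_(i-1) of the
    face is mapped to e_(i-1) + e_i, and by linearity in this row the value is
    the sum of the two minors that omit the row i or the row i - 1. *)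
Lemma form_ins_mx (M : ftorus R) m (w : preform M m) x (A : 'M[R]_(m.+1, tdim M)) i :
  is_form w -> (i < m.+2)%N ->
  w x (ins_mx m i *m A) = minor_val (fun j => w x (row' j A)) i +
    (if i is i'.+1 then minor_val (fun j => w x (row' j A)) i' else 0).
Proof.
move=> wP; case: i => [|i] im.
  rewrite (minor_val_ord _ ord0) addr0; congr (w _ _); apply/row_matrixP => a.
  by rewrite row_ins_mx /= add0r; apply/rowP => c; rewrite !mxE.
have im' : (i < m.+1)%N by [].
pose k := Ordinal im'; have mk (f : 'I_m.+1 -> R) : minor_val f i = f k := minor_val_ord f k.
rewrite mk.
move: (im); rewrite ltnS leq_eqVlt => /predU1P[[Em]|lt_im].
  rewrite /minor_val insubF ?add0r; last by rewrite Em ltnn.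
  congr (w _ _); apply/row_matrixP => a; rewrite row_ins_mx Em.
  rewrite ltnS ltnW ?ltn_ord // ltnNge ltn_ord /= addr0.
  apply/rowP => c; rewrite !mxE; congr (A _ _); apply: val_inj => /=.
  by rewrite /bump leqNgt Em ltn_ord.
have i1m : (i.+1 < m.+1)%N by [].
pose k1 := Ordinal i1m; have mk1 (f : 'I_m.+1 -> R) : minor_val f i.+1 = f k1 := minor_val_ord f k1.
rewrite mk1.
pose a0 : 'I_m := Ordinal (lt_im : (i < m)%N).
have -> : ins_mx m i.+1 *m A =
    set_row (row' k1 A) a0 (row k A + row k1 A).
  apply/row_matrixP => a; rewrite row_ins_mx row_set_row.
  case: eqP => [->|/eqP aa0].
    rewrite /= ltnSn; congr (_ + _); congr row; exact: val_inj.
  move: aa0; rewrite -val_eqE /= => aa0; rewrite row_row'.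
  case: (ltnP a i) => ai.
    rewrite ltnS (ltnW ai) ltnS leqNgt ai addr0; congr row; apply: val_inj => /=.
    by rewrite /bump leqNgt (leq_trans ai).
  have {}ai : (i < a)%N by rewrite ltn_neqAle eq_sym aa0.
  rewrite ltnS leqNgt ai ltnS (ltnW ai) add0r; congr row; apply: val_inj => /=.
  by rewrite /bump ai.
rewrite -[row k A]scale1r (form_multilinear wP) mul1r; congr (w _ _ + w _ _).
  apply/row_matrixP => a; rewrite row_set_row; case: eqP => // ->.
  rewrite row_row'; congr row; apply: val_inj => /=.
  by rewrite /bump ltnn.
apply/row_matrixP => a; rewrite row_set_row; case: eqP => [->|/eqP aa0].
  rewrite row_row'; congr row; apply: val_inj => /=.
  by rewrite /bump leqnn.
rewrite !row_row'; congr row; apply: val_inj => /=.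
move: aa0; rewrite -val_eqE /= /bump => aa0.
by rewrite [(i <= a)%N]leq_eqVlt eq_sym (negPf aa0).
Qed.

Lemma alternating_minor_sum m (P : 'I_m.+1 -> R) (Q : 'I_m.+1 -> R) :
  \sum_(i < m.+2) (-1) ^+ i * (minor_val P i +
     (if (i : nat) is i'.+1 then minor_val Q i' else 0)) =
  \sum_(j < m.+1) (-1) ^+ j * (P j - Q j).
Proof.
under eq_bigr do rewrite mulrDr.
rewrite big_split /= big_ord_recr [X in _ + X]big_ord_recl /=.
rewrite mulr0 add0r {2}/minor_val insubF ?ltnn // mulr0 addr0 -big_split /=.
apply: eq_bigr => j _; rewrite minor_val_ord minor_val_ord.
by rewrite /bump add1n exprS mulN1r mulNr -mulrBr.
Qed.

(** Face i contributes the minors i and i - 1, with the sign (-1)^i. Hence the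
    minor j occurs on the faces j and j + 1 with opposite signs, and this
    difference is the integral of its j-th partial derivative by [oint_derive]. *)
Lemma chart_stokes (M : ftorus R) m (w : preform M m)
    (G : 'rV[R]_m.+1 -> 'rV[R]_(tdim M)) : is_form w -> smooth_map G ->
  \sum_(i < m.+2) (-1) ^+ i * chart_int (fun y => G (row_ins 1 i y)) w =
  chart_int G (extd w).
Proof.
move=> wP sG.
pose h j y := w (G y) (row' j (jacobian G y)).
have sh j : smooth (h j).
  by apply: (smooth_form_comp wP sG); exact: smooth_rows_jacobian'.
pose P (j : 'I_m.+1) := oint 1 (fun y => h j (row_ins 1 j y)).
pose Q (j : 'I_m.+1) := oint 1 (fun y => h j (row_ins 1 j.+1 y)).
have chi j i : continuous (fun y => h j (row_ins 1 i y)).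
  exact/smooth_continuous/(smooth_comp (@smooth_row_ins _ _ _ i) (sh j)).
transitivity (\sum_(i < m.+2) (-1) ^+ i * (minor_val P i +
     (if (i : nat) is i'.+1 then minor_val Q i' else 0))).
  apply: eq_bigr => i _; congr (_ * _).
  transitivity (oint 1 (fun y => minor_val (fun j => h j (row_ins 1 i y)) i +
     (if (i : nat) is i'.+1 then minor_val (fun j => h j (row_ins 1 i y)) i' else 0))).
    apply: oint_ext => y; rewrite -form_ins_mx //; congr (w _ _).
    have -> : (fun y => G (row_ins 1 i y)) =
        (fun y => G (row_ins 1 i 0 + y *m ins_mx m i)).
      by apply/funext => z; rewrite row_ins_affine.
    by rewrite (jacobian_affine (row_ins 1 i 0) (ins_mx m i) y sG) -(row_ins_affine 1 i y).
  have cm i' : continuous (fun y => minor_val (fun j => h j (row_ins 1 i y)) i').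
    by rewrite /minor_val; case: insub => [j|]; [exact: chi|exact: continuous_const].
  have cQ n : continuous (fun y =>
      if n is i'.+1 then minor_val (fun j => h j (row_ins 1 i y)) i' else 0).
    by case: n => [|i']; [exact: continuous_const|exact: cm].
  rewrite (ointD _ (cm i) (cQ i)); congr (_ + _).
    by rewrite /minor_val; case: insubP => [j _ <-|_]; [|exact: oint0].
  case: i {cm cQ} => -[|i'] im /=; first exact: oint0.
  rewrite /minor_val; case: insubP => [j _ ji|_]; last exact: oint0.
  by rewrite /Q; apply: oint_ext => y; rewrite -ji.
rewrite alternating_minor_sum /chart_int.
transitivity (\sum_(j < m.+1) (-1) ^+ j * oint 1 (fun y => 'D_(delta_mx 0 j) (h j) y)).
  by apply: eq_bigr => j _; rewrite oint_derive.
transitivity (\sum_(j < m.+1) oint 1 (fun y => (-1) ^+ j * 'D_(delta_mx 0 j) (h j) y)).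
  apply: eq_bigr => j _; rewrite ointZ //.
  exact/smooth_continuous/smooth_derive.
rewrite -oint_sum => [|j _]; last first.
  apply: smooth_continuous; apply: smoothM; first exact: smooth_cst.
  exact: smooth_derive.
by apply: oint_ext => y; exact: extd_chart.
Qed.

End ChartIntegral.

(** * Integrals do not depend on the lift *)

Section LiftIndependence.
Variable R : realType.

(** The fibres of the covering are contained in translates of a lattice, L
    mapping this lattice to the integer vectors. A product is of this form
    again, without being a quotient by a lattice by definition. *)
Definition lattice_cover (M : ftorus R) : Prop :=
  exists2 L : 'M[R]_(tdim M), L \in unitmx &
    forall x y, tcov (f := M) x = tcov y ->
    forall i, exists z : int, ((x - y) *m L) 0 i = z%:~R.

Lemma lattice_cover_quotT d (G : 'M[R]_d) : G \in unitmx -> lattice_cover (quotT G).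
Proof.
move=> uG; exists (invmx G); first by rewrite unitmx_inv.
move=> x y /quotT_covE /asboolP[z ->] i; exists (z 0 i).
by rewrite mulmxK // mxE.
Qed.

Lemma lattice_cover_prod (M N : ftorus R) :
  lattice_cover M -> lattice_cover N -> lattice_cover (prodT M N).
Proof.
move=> [L uL LP] [K uK KP]; exists (block_mx L 0 0 K).
  by move: uL uK; rewrite !unitmxE det_ublock unitrM => -> ->.
move=> x y /= [xyl xyr] i.
have E : (x - y) *m block_mx L 0 0 K =
    row_mx ((lsubmx x - lsubmx y) *m L) ((rsubmx x - rsubmx y) *m K).
  by rewrite -{1}[x]hsubmxK -{1}[y]hsubmxK opp_row_mx add_row_mx mul_row_block
    !mulmx0 addr0 add0r.
have -> : ((x - y) *m block_mx L 0 0 K) 0 i =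
    (row_mx ((lsubmx x - lsubmx y) *m L) ((rsubmx x - rsubmx y) *m K)) 0 i by rewrite -E.
case: (split_ordP i) => k ->.
  have [z zE] := LP _ _ xyl k; exists z; by rewrite row_mxEl.
have [z zE] := KP _ _ xyr k; exists z; by rewrite row_mxEr.
Qed.

Lemma baryE m (y : 'rV[R]_m) l : bary y 0 l = rnth (row_cons 1 y) l - rnth y l.
Proof.
rewrite !mxE eqxx /=.
rewrite (eq_bigr (fun a => y 0 a * (l == a.+1 :> nat)%:R - y 0 a * (l == a :> nat)%:R)); last first.
  by move=> a _; rewrite mxE mulrBr -!val_eqE.
rewrite sumrB addrA -rnth_sum; congr (_ - _).
case El: (nat_of_ord l) => [|k].
  rewrite rnth_cons0 -val_eqE /= El big1 ?addr0 // => a _.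
  by rewrite mulr0.
rewrite rnth_consS rnth_sum -val_eqE /= El add0r.
by apply: eq_bigr.
Qed.

Lemma rnth_row_cons_ordered m (y : 'rV[R]_m) l : ordered 1 y ->
  rnth y l <= rnth (row_cons 1 y) l.
Proof.
move=> [y01 ydec]; case: l => [|l].
  rewrite rnth_cons0 /rnth; case: insubP => [k _ _|_]; last exact: ler01.
  by have /andP[] := y01 k.
rewrite rnth_consS /rnth; case: insubP => [k km kE|_].
  have lm : (l < m)%N by rewrite (leq_trans _ km).
  by rewrite insubT; apply: ydec; rewrite /= kE.
by case: insubP => [k _ _|_]; [have /andP[] := y01 k|exact: lexx].
Qed.

Lemma sum_bary m (y : 'rV[R]_m) : \sum_l bary y 0 l = 1.
Proof.
have s1 (v : 'rV[R]_m.+1) : \sum_i v 0 i = (v *m const_mx 1 : 'M[R]_1) 0 0.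
  by rewrite mxE; apply: eq_bigr => i _; rewrite mxE mulr1.
rewrite s1 mulmxDl -mulmxA (_ : edge_mx R m *m const_mx 1 = 0 :> 'cV[R]_m).
  rewrite mulmx0 addr0 mxE (bigD1 ord0) //= big1 ?addr0 => [|i /negPf i0].
    by rewrite !mxE eqxx mulr1.
  by rewrite !mxE i0 andbF mul0r.
apply/colP => i; rewrite !mxE; under eq_bigr do rewrite !mxE mulr1.
rewrite sumrB; apply/eqP; rewrite subr_eq0; apply/eqP.
have pick (j : 'I_m.+1) : \sum_l (l == j)%:R = 1 :> R.
  by rewrite (bigD1 j) //= eqxx big1 ?addr0 // => l /negPf ->.
by rewrite !pick.
Qed.

Lemma in_splx_bary m (y : 'rV[R]_m) : ordered 1 y -> in_splx (bary y).
Proof.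
move=> oy; apply/andP; split; last by rewrite sum_bary.
by apply/forallP => l; rewrite baryE subr_ge0 rnth_row_cons_ordered.
Qed.

Lemma in_splx_delta m (k : 'I_m.+1) : in_splx (delta_mx 0 k : 'rV[R]_m.+1).
Proof.
apply/andP; split; first by apply/forallP => l; rewrite mxE ler0n.
rewrite (bigD1 k) //= big1 ?addr0 => [|l /negPf lk]; by rewrite mxE ?eqxx ?lk.
Qed.

Lemma in_splx_segment m (t u : 'rV[R]_m.+1) (s : R) : in_splx t -> in_splx u ->
  0 <= s <= 1 -> in_splx (t + s *: (u - t)).
Proof.
move=> /andP[/forallP t0 /eqP t1] /andP[/forallP u0 /eqP u1] /andP[s0 s1].
have E l : (t + s *: (u - t)) 0 l = (1 - s) * t 0 l + s * u 0 l.
  by rewrite !mxE; ring.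
apply/andP; split.
  by apply/forallP => l; rewrite E addr_ge0 // mulr_ge0 // subr_ge0.
under eq_bigr do rewrite E.
by rewrite big_split /= -!mulr_sumr t1 u1 !mulr1 subrK.
Qed.

Lemma intr_norm_lt1 (z : int) : `|z%:~R : R| < 1 -> z = 0.
Proof.
by rewrite -intr_norm -[1]/(1%:~R) ltr_int; case: z => [[|z]|z].
Qed.

(** On the segment from t to u, f is continuous with integer values, so that
    it is constant near t; hence the derivative from the right at t is 0.
    This also applies when t is on the boundary of the simplex. *)
Lemma derive_integer_valued m (f : 'rV[R]_m.+1 -> R) (t u : 'rV[R]_m.+1) :
  smooth f -> (forall x, in_splx x -> exists z : int, f x = z%:~R) ->
  in_splx t -> in_splx u -> 'D_(u - t) f t = 0.
Proof.
move=> sf fz tS uS; pose F (s : R) := f (t + s *: (u - t)).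
have F0 : F 0 = f t by rewrite /F scale0r addr0.
have dF : is_derive (0 : R) (1 : R) F ('D_(u - t) f t).
  have := is_derive_line (smooth_differentiable (t + 0 *: (u - t)) sf).
  by rewrite scale0r addr0.
have cF : continuous F := @continuous_line R m.+1 f t (u - t) (smooth_continuous sf).
have /is_derive_quotient dq := dF.
have dr := cvg_dnbhs_at_right dq.
have n1 : \forall h \near (0 : R)^'+, h < 1 by exact: nbhs_right_lt.
have n0 : \forall h \near (0 : R)^'+, 0 < h by exact: nbhs_right_gt.
have /cvgrPdist_lt/(_ _ ltr01) nF := cvg_at_right_filter (cF 0).
have [z0 z0E] := fz _ tS.
have d0 : (fun h => h^-1 * (F (h + 0) - F 0)) @ (0 : R)^'+ --> (0 : R).
  apply: cvg_near_cst; apply: filterS3 n1 n0 nF => h h1 h0 hF.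
  have [|z zE] := fz (t + h *: (u - t)).
    by apply: in_splx_segment; rewrite ?(ltW h0) ?(ltW h1).
  move: hF; rewrite addr0 F0 z0E /F zE -intrB => /intr_norm_lt1/eqP.
  by rewrite subr_eq0 => /eqP ->; rewrite subrr mulr0.
exact: cvg_unique dr d0.
Qed.

(** The directions u - t, with u a vertex of the simplex, span all directions
    tangent to the simplex. *)
Lemma lift_derive_eq (M : ftorus R) m (g g' : 'rV[R]_m.+1 -> 'rV[R]_(tdim M)) t k l :
  lattice_cover M -> smooth_map g -> smooth_map g' ->
  (forall x, in_splx x -> tcov (f := M) (g x) = tcov (g' x)) -> in_splx t ->
  'D_(delta_mx 0 k - delta_mx 0 l) g t = 'D_(delta_mx 0 k - delta_mx 0 l) g' t.
Proof.
move=> [L uL LP] sg sg' gg' tS; set v := _ - _.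
have dg := smooth_map_differentiable t sg.
have dg' := smooth_map_differentiable t sg'.
have v0 : ('D_v g t - 'D_v g' t) *m L = 0.
  apply/rowP => i; pose f x := ((g x - g' x) *m L) 0 i.
  have fE x : f x = (g x *m L) 0 i - (g' x *m L) 0 i by rewrite /f mulmxBl !mxE.
  have s1 : smooth (fun x => (g x *m L) 0 i) := smooth_map_comp_lin L sg i.
  have s2 : smooth (fun x => (g' x *m L) 0 i) := smooth_map_comp_lin L sg' i.
  have sf : smooth f.
    by rewrite (_ : f = fun x => (g x *m L) 0 i - (g' x *m L) 0 i);
      [exact: smoothD s1 (smoothN s2)|exact/funext].
  have fz x : in_splx x -> exists z : int, f x = z%:~R.
    by move=> xS; apply: LP; exact: gg'.
  have dfe k' : 'D_(delta_mx 0 k' - t) f t = 0.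
    by apply: derive_integer_valued => //; exact: in_splx_delta.
  have -> : (0 : 'rV[R]_(tdim M)) 0 i = 'D_v f t.
    have -> : v = (delta_mx 0 k - t) - (delta_mx 0 l - t).
      by rewrite opprB addrA subrK.
    have df := smooth_differentiable t sf.
    by rewrite deriveDv // deriveNv // !dfe subrr mxE.
  have DE (h : 'rV[R]_m.+1 -> 'rV[R]_(tdim M)) : smooth_map h ->
      'D_v (fun x => (h x *m L) 0 i) t = ('D_v h t *m L) 0 i.
    move=> sh; have dh := smooth_map_differentiable t sh.
    have dhL := smooth_map_differentiable t (smooth_map_comp_lin L sh).
    rewrite -(derive_coord v i dhL); apply: (congr1 (fun A : 'rV[R]_(tdim M) => A 0 i)).
    apply: (etrans (@derive_chain R _ _ _ h (fun z => z *m L) t v dh (differentiable_mulmxr L _))).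
    by rewrite derive_mulmxr.
  have -> : f = (fun x => (g x *m L) 0 i) - (fun x => (g' x *m L) 0 i).
    by apply/funext => x; rewrite fE.
  rewrite deriveB; [|exact: smooth_derivable..].
  by rewrite !DE // mulmxBl !mxE.
apply/eqP; rewrite -subr_eq0; apply/eqP.
by rewrite -[LHS](mulmxK uL) v0 mul0mx.
Qed.

Lemma row_edge_mx m (i : 'I_m) : row i (edge_mx R m) =
  delta_mx 0 (fintype.lift ord0 i) - delta_mx 0 (widen_ord (leqnSn m) i).
Proof. by apply/rowP => l; rewrite !mxE. Qed.

Lemma lift_int_eq (M : ftorus R) m (g g' : 'rV[R]_m.+1 -> 'rV[R]_(tdim M))
    (w : preform M m) : lattice_cover M -> is_form w ->
  smooth_map g -> smooth_map g' ->
  (forall x, in_splx x -> tcov (f := M) (g x) = tcov (g' x)) ->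
  lift_int g w = lift_int g' w.
Proof.
move=> MP wP sg sg' gg'; apply: eq_oint => [|y oy]; first exact: ler01.
have bS := in_splx_bary oy; rewrite (form_descends wP (gg' _ bS)); congr (w _ _).
apply/matrixP => i j; rewrite !mxE row_edge_mx.
apply: (congr1 (fun A : 'rV[R]_(tdim M) => A 0 j)).
exact: (lift_derive_eq _ _ MP sg sg' gg' bS).
Qed.

Lemma sintE (M : ftorus R) m (s : simplex M m) (w : dform M m)
    (g : 'rV[R]_m.+1 -> 'rV[R]_(tdim M)) : lattice_cover M -> smooth_map g ->
  (forall t, s t = tcov (g (val t))) ->
  sint s w = chart_int (fun y => g (bary y)) w.
Proof.
move=> MP sg gE; rewrite -(lift_int_chart w sg).
have slP : smooth_map (slift s) by rewrite /slift; case: cid2.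
have slE t : s t = tcov (slift s (val t)) by rewrite /slift; case: cid2.
apply: lift_int_eq => //; first exact: formP.
move=> x xS; have := slE (exist _ x xS); rewrite gE /= => ->.
by [].
Qed.

End LiftIndependence.

(** * Integrals over chains *)

Section ChainIntegral.
Variable R : realType.
Implicit Types M N : ftorus R.

Lemma additive_chlift (S : choiceType) (V : zmodType) (F : {freeg S} -> V) c :
  zmod_morphism F -> F c = chlift (fun s => F << s >>) c.
Proof.
move=> FB; pose F' : {additive {freeg S} -> V} :=
  HB.pack F (GRing.isZmodMorphism.Build _ _ _ FB).
rewrite -[F]/(F' : _ -> _) -{1}(freeg_sumE c) raddf_sum; apply: eq_bigr => s _.
rewrite -(raddfMz F'); congr (F' _).
by rewrite freeg_mulz mulrzz mul1r.
Qed.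

Lemma eq_chlift (S : choiceType) (V : zmodType) (f g : S -> V) c :
  f =1 g -> chlift f c = chlift g c.
Proof. by move=> /funext->. Qed.

Lemma chart_intB M m (G : 'rV[R]_m -> 'rV[R]_(tdim M)) (w v : preform M m) :
  smooth_map G -> is_form w -> is_form v ->
  chart_int G (w - v) = chart_int G w - chart_int G v.
Proof.
move=> sG wP vP; have cw := smooth_continuous (smooth_chart_integrand sG wP).
have cv := smooth_continuous (smooth_chart_integrand sG vP).
have cNv := smooth_continuous (smoothN (smooth_chart_integrand sG vP)).
rewrite /chart_int -(ointN _ cv) -(ointD _ cw cNv).
by apply: oint_ext.
Qed.

Lemma smooth_map_slift M m (s : simplex M m) : smooth_map (slift s).
Proof. by rewrite /slift; case: cid2. Qed.

Lemma slift_cov M m (s : simplex M m) t : s t = tcov (slift s (val t)).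
Proof. by rewrite /slift; case: cid2. Qed.

Lemma smooth_map_bary m : smooth_map (@bary R m).
Proof. exact: smooth_map_affine. Qed.

Lemma smooth_map_chart M m (g : 'rV[R]_m.+1 -> 'rV[R]_(tdim M)) : smooth_map g ->
  smooth_map (fun y => g (bary y)).
Proof. exact: smooth_map_comp (@smooth_map_bary m). Qed.

Lemma sint_is_additive M m (s : simplex M m) : zmod_morphism (sint s).
Proof.
move=> w v; have sg := smooth_map_slift s.
rewrite /sint !lift_int_chart //.
by apply: chart_intB; [exact: smooth_map_chart|exact: formP|exact: formP].
Qed.

HB.instance Definition _ M m (s : simplex M m) :=
  GRing.isZmodMorphism.Build _ _ (sint s) (sint_is_additive s).

Lemma chint_is_additiver M m (c : chain M m) : zmod_morphism (chint c).
Proof.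
move=> w v; rewrite /chint /chlift -sumrB; apply: eq_bigr => s _.
by rewrite raddfB mulrzBl.
Qed.

HB.instance Definition _ M m (c : chain M m) :=
  GRing.isZmodMorphism.Build _ _ (chint c) (chint_is_additiver c).

Lemma chintU M m (s : simplex M m) (w : dform M m) :
  chint (<< s >> : chain M m) w = sint s w.
Proof. exact: chliftU. Qed.

Lemma chint_scaleU M m (s : simplex M m) z (w : dform M m) :
  chint (<< z *g s >> : chain M m) w = z%:~R * sint s w.
Proof. by rewrite /chint chlift_scaleU mulrzl. Qed.

Lemma chint_suml M m I (r : seq I) (P : pred I) (c : I -> chain M m) (w : dform M m) :
  chint (\sum_(i <- r | P i) c i) w = \sum_(i <- r | P i) chint (c i) w.
Proof. exact: (raddf_sum (chlift (fun s : simplex M m => sint s w))). Qed.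

Lemma chint_mulzl M m (c : chain M m) z (w : dform M m) :
  chint (c *~ z) w = chint c w *~ z.
Proof. exact: (raddfMz (chlift (fun s : simplex M m => sint s w))). Qed.

Lemma chint_sumr M m I (r : seq I) (P : pred I) (c : chain M m) (w : I -> dform M m) :
  chint c (\sum_(i <- r | P i) w i) = \sum_(i <- r | P i) chint c (w i).
Proof. exact: raddf_sum. Qed.

Lemma chint_cpush M N (f : tmap M N) m (c : chain M m) (w : dform N m) :
  lattice_cover M -> lattice_cover N ->
  chint (cpush f c) w = chint c (pullback f w).
Proof.
move=> MP NP; rewrite (@additive_chlift _ _ (fun c => chint (cpush f c) w)); last first.
  move=> c1 c2; rewrite /cpush raddfB; exact: (raddfB (chlift (fun s : simplex N m => sint s w))).
apply: eq_chlift => s; rewrite /cpush chliftU chintU.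
have sg := smooth_map_slift s; have dg := smooth_map_differentiable _ (smooth_map_chart sg).
rewrite (sintE _ NP (smooth_map_comp_lin (tmap_lin f) sg)); last first.
  by move=> t; rewrite /= slift_cov tmap_cov.
rewrite /sint lift_int_chart //; apply: oint_ext => y; congr (form_val w _ _).
apply/row_matrixP => i; rewrite row_mul !row_jacobian.
- apply: (etrans (@derive_chain R _ _ _ (fun y => slift s (bary y))
    (fun z => z *m tmap_lin f) y _ (dg y) (differentiable_mulmxr _ _))).
  by rewrite derive_mulmxr.
- exact: smooth_map_chart.
- exact: smooth_map_comp_lin (smooth_map_chart sg).
Qed.

Lemma rnth_row_ins m b i (y : 'rV[R]_m) l : (i <= m.+1)%N ->
  rnth (row_ins b i y) l = if (l < i)%N then rnth y l else rnth (row_cons b y) l.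
Proof.
move=> im; rewrite {1}/rnth; case: insubP => [k _ <-|lm]; first by rewrite mxE.
have ml : (m.+1 <= l)%N by rewrite leqNgt.
by rewrite ltnNge (leq_trans im ml) /= /rnth insubF // ltnNge ml.
Qed.

Lemma vertex_mxE m p (f : 'I_m.+1 -> 'I_p.+1) j l : vertex_mx R f j l = (f j == l)%:R.
Proof. by rewrite mxE. Qed.

(** Setting the barycentric coordinate i to 0 means that y_(i-1) = y_i. *)
Lemma bary_face m (i : 'I_m.+2) (y : 'rV[R]_m) :
  bary y *m vertex_mx R (fintype.lift i) = bary (row_ins 1 i y).
Proof.
have im : (i <= m.+1)%N by rewrite -ltnS.
apply/rowP => l; rewrite baryE mxE.
have [k ->|->] := unliftP i l.
  rewrite (bigD1 k) //= vertex_mxE eqxx mulr1 big1 ?addr0 => [|k' kk']; last first.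
    by rewrite vertex_mxE (inj_eq lift_inj) (negPf kk') mulr0.
  rewrite baryE rnth_row_ins //= /bump; case: (leqP i k) => ik.
    rewrite add1n rnth_consS rnth_row_ins // !ltnNge ik (leqW ik) /=.
    by rewrite rnth_consS.
  rewrite add0n ik; case: (nat_of_ord k) ik => [|k'] ik; first by rewrite !rnth_cons0.
  by rewrite !rnth_consS rnth_row_ins // (ltnW ik).
rewrite big1 => [|k _]; last by rewrite vertex_mxE eq_sym (negPf (neq_lift _ _)) mulr0.
rewrite rnth_row_ins // ltnn; case: (nat_of_ord i) im => [|i'] im.
  by rewrite !rnth_cons0 subrr.
by rewrite !rnth_consS rnth_row_ins // ltnSn subrr.
Qed.

Lemma sint_face M m (s : simplex M m.+1) (w : dform M m) (i : 'I_m.+2) :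
  lattice_cover M ->
  sint (face i s) w = chart_int (fun y => slift s (bary (row_ins 1 i y))) w.
Proof.
move=> MP; have sg := smooth_map_slift s.
pose V := vertex_mx R (fintype.lift i).
have sgV : smooth_map (fun t => slift s (t *m V)).
  exact: smooth_map_comp (@smooth_map_lin R _ _ V) sg.
rewrite (sintE w MP sgV) => [|t]; last by rewrite /= slift_cov.
apply: (congr1 (fun g => chart_int g w)); apply/funext => y.
exact: (congr1 (slift s) (bary_face i y)).
Qed.

(** The theorem of Stokes. As the exterior derivative is only a field of
    multilinear forms here, its integral is taken with the chosen lifts. *)
Lemma chint_boundary M m (c : chain M m.+1) (w : dform M m) : lattice_cover M ->
  chint (boundary c) w = chlift (fun s => lift_int (slift s) (extd w)) c.
Proof.
move=> MP; rewrite (@additive_chlift _ _ (fun c => chint (boundary c) w)); last first.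
  move=> c1 c2; rewrite /boundary raddfB.
  exact: (raddfB (chlift (fun s : simplex M m => sint s w))).
apply: eq_chlift => s; rewrite /boundary chliftU chint_suml.
have sg := smooth_map_slift s.
rewrite lift_int_chart // -chart_stokes; [|exact: formP|exact: smooth_map_chart].
apply: eq_bigr => i _; rewrite chint_scaleU sint_face //.
by rewrite rmorphXn rmorphN1.
Qed.

Lemma chint_boundary_closed M m (c : chain M m.+1) (w : closed_form M m) :
  lattice_cover M -> chint (boundary c) w = 0.
Proof.
move=> MP; rewrite chint_boundary //; case: w => w /= /asboolP ->.
rewrite /chlift big1 // => s _; rewrite (_ : lift_int _ _ = 0) ?mul0rz //.
exact: oint0.
Qed.

Lemma chint_cycle_exact M m (z : Defs.cycle M m) (w : closed_form M m) :
  lattice_cover M -> w \in @exact_pred _ M m -> chint z w = 0.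
Proof.
move=> MP; case: m z w => [|m] z w /asboolP /=.
  move=> w0; rewrite (_ : closed_val w = 0) ?raddf0 //; exact: val_inj.
move=> [v vE].
have -> : chint z w = chint (boundary (cycle_chain z)) v.
  rewrite chint_boundary //; apply: eq_chlift => s.
  by rewrite /sint vE.
case: z => z /= /asboolP /= z0.
apply: (etrans (congr1 (fun c : chain M m => chint c v) z0)).
exact: (raddf0 (chlift (fun s : simplex M m => sint s v))).
Qed.

Lemma chint_hclass M m (z z' : Defs.cycle M m) (w : closed_form M m) :
  lattice_cover M -> hclass z = hclass z' -> chint z w = chint z' w.
Proof.
move=> MP /eqP; rewrite -Quotient.idealrBE => /asboolP[e eE].
apply/eqP; rewrite -subr_eq0; apply/eqP.
have zz' : cycle_chain z - cycle_chain z' = boundary e by rewrite -eE raddfB.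
apply: (etrans (esym (raddfB (chlift (fun s : simplex M m => sint s w)) _ _))).
by apply: (etrans (congr1 (fun c : chain M m => chint c w) zz')); exact: chint_boundary_closed.
Qed.

Lemma chint_dRclass M m (z : Defs.cycle M m) (w w' : closed_form M m) :
  lattice_cover M -> dRclass w = dRclass w' -> chint z w = chint z w'.
Proof.
move=> MP /eqP; rewrite -Quotient.idealrBE => ww'.
apply/eqP; rewrite -subr_eq0 -raddfB; apply/eqP.
have E : closed_val w - closed_val w' = closed_val (w - w').
  exact: (esym (raddfB val w w')).
exact: (etrans (congr1 (chint z) E) (chint_cycle_exact z MP ww')).
Qed.

End ChainIntegral.

(** * Staircases and shuffles *)

Section EilenbergZilber.
Variable R : realType.
Implicit Types M N : ftorus R.

(** The coordinates y of the point of the simplex with barycentric coordinates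
    x: the inverse of [bary]. *)
Definition tail_sum m (x : 'rV[R]_m.+1) (b : nat) : R := \sum_(l : 'I_m.+1 | (b < l)%N) x 0 l.

Lemma rnth_row m (f : nat -> R) l : rnth (\row_(b < m) f b) l = if (l < m)%N then f l else 0.
Proof.
by rewrite /rnth; case: insubP => [k _ <-|/negPf -> //]; rewrite ltn_ord mxE.
Qed.

Lemma bary_tail_sum m (x : 'rV[R]_m.+1) : \sum_l x 0 l = 1 ->
  x = bary (\row_b tail_sum x b).
Proof.
move=> x1; apply/rowP => l; rewrite baryE rnth_row.
have tS k : (k < m.+1)%N -> \sum_(i : 'I_m.+1 | (k <= i)%N) x 0 i = x 0 (inord k) + tail_sum x k.
  move=> km; rewrite (bigD1 (inord k)) /= ?inordK //; congr (_ + _); apply: eq_bigl => i.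
  by rewrite ltn_neqAle andbC -val_eqE /= inordK // eq_sym.
have -> : (if (l < m)%N then tail_sum x l else 0) = tail_sum x l.
  case: ifP => // lm; rewrite /tail_sum big1 // => i li.
  by have := ltn_ord i; rewrite ltnS leqNgt (leq_trans _ li) // ltnS leqNgt lm.
have -> : rnth (row_cons 1 (\row_(b < m) tail_sum x b)) l = \sum_(i : 'I_m.+1 | (l <= i)%N) x 0 i.
  move: (nat_of_ord l) (ltn_ord l) => [|k] kl; first by rewrite rnth_cons0 -x1.
  by rewrite rnth_consS rnth_row -ltnS kl.
by rewrite tS // addrK inord_val.
Qed.

Lemma tail_sum_bary m (y : 'rV[R]_m) (a : 'I_m) : tail_sum (bary y) a = y 0 a.
Proof.
pose c l := rnth (row_cons 1 y) l.
rewrite /tail_sum (eq_bigr (fun l : 'I_m.+1 => - (c l.+1 - c l))); last first.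
  by move=> l _; rewrite opprB baryE /c rnth_consS.
rewrite -(big_mkord (fun l => (a < l)%N) (fun l => - (c l.+1 - c l))).
rewrite (big_cat_nat (n := a.+1)) //=; last by rewrite ltnS ltnW.
rewrite big_nat_cond big1 ?add0r => [|l /andP[/andP[_ la] al]]; last first.
  by rewrite ltnS leqNgt al in la.
rewrite big_nat_cond (eq_bigl (fun l => (a.+1 <= l < m.+1)%N && true)); last first.
  by move=> l; case: (ltnP a l) => //=; rewrite ?andbT ?andbF.
rewrite -big_nat_cond sumrN telescope_sumr ?ltnS ?(ltnW (ltn_ord a)) // opprB /c !rnth_consS rnth_ord.
by rewrite /rnth insubF ?ltnn // subr0.
Qed.

Lemma tail_sum_vertex_mx m p (f : 'I_m.+1 -> 'I_p.+1) (t : 'rV[R]_m.+1) b :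
  tail_sum (t *m vertex_mx R f) b = \sum_(l | (b < f l)%N) t 0 l.
Proof.
rewrite /tail_sum; under eq_bigr do rewrite mxE.
rewrite exchange_big [RHS]big_mkcond; apply: eq_bigr => l _ /=.
case: ifP => bf.
  rewrite (bigD1 (f l)) //= vertex_mxE eqxx mulr1 big1 ?addr0 // => k /andP[_ kf].
  by rewrite vertex_mxE eq_sym (negPf kf) mulr0.
rewrite big1 // => k bk; rewrite vertex_mxE; case: eqP => [fk|]; last by rewrite mulr0.
by rewrite fk bk in bf.
Qed.

(** The entries below l form an initial segment of an increasing sequence. *)
Lemma count_lt_sorted (s : seq nat) b l : sorted ltn s -> (b < size s)%N ->
  (b < count (fun a => (a < l)%N) s)%N = (nth 0 s b < l)%N.
Proof.
elim: s b => [//|a s IH] b /= pa bs.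
case: (ltnP a l) => al.
  case: b bs => [//|b] bs /=; rewrite add1n ltnS; apply: IH => //.
  exact: path_sorted pa.
have ge c : c \in a :: s -> (l <= c)%N.
  rewrite inE => /orP[/eqP -> //|cs]; apply: leq_trans al (ltnW _).
  by have /allP := order_path_min ltn_trans pa; apply.
rewrite add0n (_ : count _ s = 0%N); last first.
  apply/eqP; rewrite -leqn0 leqNgt -has_count; apply/hasPn => c cs.
  by rewrite -leqNgt ge // inE cs orbT.
by rewrite ltn0; apply/esym/negbTE; rewrite -leqNgt ge // -[a :: s]/(a :: s) mem_nth.
Qed.

Lemma sorted_enum_set n (A : {set 'I_n}) : sorted ltn (map val (enum A)).
Proof.
rewrite enum_filter.
rewrite (eq_filter (a2 := preim val (mem (map val (enum A))))) => [|i]; last first.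
  by rewrite /= mem_map ?mem_enum //; exact: val_inj.
by rewrite -filter_map (sorted_filter ltn_trans) // val_enum_ord iota_ltn_sorted.
Qed.

Lemma staircase_lt n p (A : {set 'I_n}) (l : 'I_n.+1) (b : 'I_p) (i0 : 'I_n) : #|A| = p ->
  (b < staircase p A l)%N = (nth i0 (enum A) b < l)%N.
Proof.
move=> Ap; have cA : #|[set a in A | (a < l)%N]%SET| =
    count (fun a => (a < l)%N) (map val (enum A)).
  rewrite count_map -size_filter enum_filter -filter_predI.
  rewrite cardE enum_filter; congr size; apply: eq_filter => a /=.
  by rewrite inE andbC.
have sA : size (map val (enum A)) = p by rewrite size_map -cardE.
rewrite inordK; last by rewrite ltnS cA -[X in (_ <= X)%N]sA count_size.
rewrite cA count_lt_sorted ?sA //; last exact: sorted_enum_set.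
by rewrite (nth_map i0) // -cardE Ap.
Qed.

Lemma sum_vertex_mx m p (f : 'I_m.+1 -> 'I_p.+1) (t : 'rV[R]_m.+1) :
  \sum_l (t *m vertex_mx R f) 0 l = \sum_l t 0 l.
Proof.
under eq_bigr do rewrite mxE.
rewrite exchange_big; apply: eq_bigr => l _ /=.
rewrite (bigD1 (f l)) //= vertex_mxE eqxx mulr1 big1 ?addr0 // => k kf.
by rewrite vertex_mxE eq_sym (negPf kf) mulr0.
Qed.

(** The staircase of A exceeds b exactly after its step at the b-th element of
    A, so that the tail sums of the image are the tail sums of the source at
    the elements of A. *)
Lemma bary_staircase n p (A : {set 'I_n}) (y : 'rV[R]_n) : #|A| = p ->
  bary y *m vertex_mx R (staircase p A) = bary (select p A y).
Proof.
move=> Ap; rewrite [LHS]bary_tail_sum; last by rewrite sum_vertex_mx sum_bary.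
apply: (congr1 (@bary R p)); apply/rowP => b; rewrite !mxE tail_sum_vertex_mx.
have bA : (b < size (enum A))%N by rewrite -cardE Ap.
have i0 : 'I_n by case: (enum A) bA.
rewrite (nth_map i0) // -tail_sum_bary; apply: eq_bigl => l.
exact: staircase_lt.
Qed.

Definition select_mx n p (A : {set 'I_n}) : 'M[R]_(n, p) :=
  \matrix_(i, b) ((b < size (enum A))%N && (nth i (enum A) b == i))%:R.

Lemma select_mulmx n p (A : {set 'I_n}) (y : 'rV[R]_n) :
  select p A y = y *m select_mx p A.
Proof.
apply/rowP => b; rewrite !mxE; case: (ltnP b (size (enum A))) => bA.
  have i0 : 'I_n by case: (enum A) bA.
  rewrite (nth_map i0) // (bigD1 (nth i0 (enum A) b)) //= mxE bA.
  rewrite (set_nth_default i0) // eqxx mulr1 big1 ?addr0 // => i ib.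
  by rewrite mxE (set_nth_default i0) // eq_sym (negPf ib) andbF mulr0.
rewrite nth_default ?size_map // big1 // => i _.
by rewrite mxE ltnNge bA mulr0.
Qed.

(** The rows of [shuffle A] are first the elements of A, then the others. *)
Lemma row_perm_shuffle p q (A : {set 'I_(p + q)}) : #|A| = p ->
  row_perm (shuffle A) (select_mx p A) = col_mx 1%:M 0.
Proof.
move=> Ap; have sA : size (enum A) = p by rewrite -cardE.
apply/matrixP => i b; rewrite mxE.
have -> : shuffle A i = nth i (enum A ++ enum (finset.setC A)) i by rewrite permE.
case: (split_ordP i) => a ->.
  rewrite col_mxEu !mxE nth_cat sA /= !ltn_ord.
  rewrite (set_nth_default (lshift q a)) ?sA //.
  by rewrite nth_uniq ?enum_uniq ?sA // eq_sym.
rewrite col_mxEd !mxE nth_cat sA /= ![(p + a < p)%N]ltnNge leq_addr /= addKn.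
set c := nth _ (enum (finset.setC A)) _; have : c \in finset.setC A.
  have sC : size (enum (finset.setC A)) = q.
    by rewrite -cardE cardsCs finset.setCK card_ord Ap addKn.
  by rewrite -mem_enum mem_nth // sC.
rewrite !inE => /negP cA; case: eqP => [E|]; last by rewrite andbF.
by case: cA; rewrite -E -mem_enum mem_nth // sA.
Qed.

Lemma row_perm_shuffleC p q (A : {set 'I_(p + q)}) : #|A| = p ->
  row_perm (shuffle A) (select_mx q (finset.setC A)) = col_mx 0 1%:M.
Proof.
move=> Ap; have sA : size (enum A) = p by rewrite -cardE.
have sC : size (enum (finset.setC A)) = q.
  by rewrite -cardE cardsCs finset.setCK card_ord Ap addKn.
apply/matrixP => i b; rewrite mxE.
have -> : shuffle A i = nth i (enum A ++ enum (finset.setC A)) i by rewrite permE.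
case: (split_ordP i) => a ->; last first.
  rewrite col_mxEd !mxE nth_cat sA /= ![(p + a < p)%N]ltnNge leq_addr /= addKn sC !ltn_ord.
  rewrite (set_nth_default (rshift p a)) ?sC //.
  by rewrite nth_uniq ?enum_uniq ?sC // eq_sym.
rewrite col_mxEu !mxE nth_cat sA /= !ltn_ord.
set c := nth _ (enum A) _; have cA : c \in A by rewrite -mem_enum mem_nth // sA.
case: eqP => [E|]; last by rewrite andbF.
have : c \in finset.setC A by rewrite -E -mem_enum mem_nth // sC.
by rewrite inE cA.
Qed.

End EilenbergZilber.

(** * Integrals over cross products *)

Section CrossIntegral.
Variable R : realType.
Implicit Types M N : ftorus R.

Lemma jacobian_row_mx m (T1 T2 : nat) (f : 'rV[R]_m -> 'rV[R]_T1) (g : 'rV[R]_m -> 'rV[R]_T2) y :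
  smooth_map f -> smooth_map g ->
  jacobian (fun y => row_mx (f y) (g y)) y = row_mx (jacobian f y) (jacobian g y).
Proof.
move=> sf sg; have sfg := smooth_map_row_mx sf sg.
have dfg := smooth_map_differentiable y sfg.
have df := smooth_map_differentiable y sf; have dg := smooth_map_differentiable y sg.
apply/row_matrixP => i; rewrite row_jacobian //.
apply/rowP => l; rewrite derive_coord // [RHS]mxE.
case: (split_ordP l) => k ->.
  rewrite row_mxEl.
  have -> : (fun y => row_mx (f y) (g y) 0 (lshift T2 k)) = (fun y => f y 0 k).
    by apply/funext => z; rewrite row_mxEl.
  by rewrite -derive_coord // -row_jacobian // mxE.
rewrite row_mxEr.
have -> : (fun y => row_mx (f y) (g y) 0 (rshift T1 k)) = (fun y => g y 0 k).
  by apply/funext => z; rewrite row_mxEr.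
by rewrite -derive_coord // -row_jacobian // mxE.
Qed.

Lemma jacobian_select m n d (G : 'rV[R]_m -> 'rV[R]_d) (A : {set 'I_n}) y : smooth_map G ->
  jacobian (fun y => G (select m A y)) y =
  select_mx R m A *m jacobian G (select m A y).
Proof.
move=> sG; have := jacobian_affine 0 (select_mx R m A) y sG.
rewrite add0r -select_mulmx => <-.
by apply: (congr1 (fun f => jacobian f y)); apply/funext => z; rewrite add0r select_mulmx.
Qed.

(** In the coordinates y the simplex of the shuffle A is the product of the
    two simplices composed with the projections to the variables in A and in
    its complement. Its Jacobian is block diagonal after the shuffle of the
    rows, which accounts for the sign. *)
Lemma sint_shuffle M N p q (s : simplex M p) (u : simplex N q) (w : dform M p)
    (v : dform N q) (A : ksub (p + q) p) : lattice_cover M -> lattice_cover N ->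
  (-1) ^+ shuffle (val A) *
    sint (spair (reparam (staircase p (val A)) s)
                (reparam (staircase q (finset.setC (val A))) u)) (fcross w v) =
  oint 1 (fun y =>
    (fun y => form_val w (slift s (bary y)) (jacobian (fun y => slift s (bary y)) y))
      (select p (val A) y) *
    (fun y => form_val v (slift u (bary y)) (jacobian (fun y => slift u (bary y)) y))
      (select q (finset.setC (val A)) y)).
Proof.
move=> MP NP; case: A => A /= /eqP Ap.
have Aq : #|finset.setC A| = q by rewrite cardsCs finset.setCK card_ord Ap addKn.
have sg := smooth_map_slift s; have sh := smooth_map_slift u.
set V := vertex_mx R (staircase p A); set V' := vertex_mx R (staircase q (finset.setC A)).
have sgV : smooth_map (fun t => slift s (t *m V)).
  exact: smooth_map_comp (@smooth_map_lin R _ _ V) sg.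
have shV : smooth_map (fun t => slift u (t *m V')).
  exact: smooth_map_comp (@smooth_map_lin R _ _ V') sh.
rewrite (@sintE R (prodT M N) _ _ _ (fun t => row_mx (slift s (t *m V)) (slift u (t *m V')))).
- have sgb := smooth_map_chart sg; have shb := smooth_map_chart sh.
  set G := fun y => slift s (bary y); set H := fun y => slift u (bary y).
  have sGs : smooth_map (fun y : 'rV[R]_(p + q) => G (select p A y)).
    exact: smooth_map_comp (@smooth_select R _ p A) sgb.
  have sHs : smooth_map (fun y : 'rV[R]_(p + q) => H (select q (finset.setC A) y)).
    exact: smooth_map_comp (@smooth_select R _ q (finset.setC A)) shb.
  have -> : (fun y : 'rV[R]_(p + q) =>
      row_mx (slift s (bary y *m V)) (slift u (bary y *m V'))) =
      (fun y => row_mx (G (select p A y)) (H (select q (finset.setC A) y))).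
    by apply/funext => y; rewrite /V /V' !bary_staircase.
  rewrite /chart_int -ointZ; last first.
    exact: (smooth_continuous (smooth_chart_integrand (M := prodT M N)
      (smooth_map_row_mx sGs sHs) (formP (fcross w v)))).
  apply: oint_ext => y; rewrite -(form_alternating (formP (fcross w v))).
  have -> : row_perm (shuffle A)
      (jacobian (fun y => row_mx (G (select p A y)) (H (select q (finset.setC A) y))) y) =
      block_mx (jacobian G (select p A y)) 0 0 (jacobian H (select q (finset.setC A) y)).
    rewrite jacobian_row_mx // !jacobian_select //.
    rewrite row_permE mul_mx_row !mulmxA -!row_permE.
    rewrite row_perm_shuffle // row_perm_shuffleC // !mul_col_mx !mul1mx !mul0mx.
    by rewrite block_mxEh.
  by rewrite fcross_block row_mxKl row_mxKr.
- exact: lattice_cover_prod.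
- exact: smooth_map_row_mx.
- by move=> t; rewrite /= row_mxKl row_mxKr !slift_cov.
Qed.

Lemma chint_ez M N p q (s : simplex M p) (u : simplex N q) (w : dform M p)
    (v : dform N q) : lattice_cover M -> lattice_cover N ->
  chint (ez s u) (fcross w v) = sint s w * sint u v.
Proof.
move=> MP NP; rewrite /ez chint_suml.
have sG := smooth_map_chart (smooth_map_slift s).
have sH := smooth_map_chart (smooth_map_slift u).
pose F y := form_val w (slift s (bary y)) (jacobian (fun y => slift s (bary y)) y).
pose H y := form_val v (slift u (bary y)) (jacobian (fun y => slift u (bary y)) y).
have cF : continuous F := smooth_continuous (smooth_chart_integrand sG (formP w)).
have cH : continuous H := smooth_continuous (smooth_chart_integrand sH (formP v)).
transitivity (\sum_(A : ksub (p + q) p)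
    oint 1 (fun y => F (select p (val A) y) * H (select q (finset.setC (val A)) y))).
  apply: eq_bigr => A _; rewrite chint_scaleU -(sint_shuffle s u w v A MP NP).
  by rewrite rmorphXn rmorphN1.
rewrite /sint !lift_int_chart; try exact: smooth_map_slift.
rewrite -[RHS](shuffle_product (erefl (p + q)%N) cF cH ler01).
rewrite [RHS](reindex_omap (val : ksub (p + q) p -> _) insub) => [|A Ap]; last first.
  by rewrite insubT.
by apply: eq_bigl => A; rewrite valK eqxx andbT; case: A => A /= ->.
Qed.

(** Fubini's theorem for the Eilenberg-Zilber product. *)
Lemma chint_cross M N p q (c : chain M p) (e : chain N q) (w : dform M p)
    (v : dform N q) : lattice_cover M -> lattice_cover N ->
  chint (cross c e) (fcross w v) = chint c w * chint e v.
Proof.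
move=> MP NP.
rewrite (@additive_chlift _ _ (fun c => chint (cross c e) (fcross w v))); last first.
  move=> c1 c2; rewrite /cross raddfB.
  exact: (raddfB (chlift (fun s : simplex (prodT M N) (p + q) => sint s (fcross w v)))).
rewrite {2}/chint /chlift mulr_suml; apply: eq_bigr => s _.
rewrite mulrzAl; congr (_ *~ _).
rewrite /cross chliftU.
rewrite (@additive_chlift _ _ (fun e => chint (chlift (fun u => ez s u) e) (fcross w v))); last first.
  move=> c1 c2; rewrite raddfB.
  exact: (raddfB (chlift (fun s : simplex (prodT M N) (p + q) => sint s (fcross w v)))).
transitivity (chlift (fun u => sint s w * sint u v) e).
  by apply: eq_chlift => u; rewrite chliftU; exact: chint_ez.
by rewrite /chint /chlift mulr_sumr; apply: eq_bigr => u _; rewrite mulrzAr.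
Qed.

End CrossIntegral.

(** * Periods of the torus *)

Section TorusPairing.
Variable R : realType.

(** Multiplying the integrals of 1 over simplices of dimensions 1 and m, the
    shuffle formula has m + 1 equal terms. *)
Lemma oint1_cst m (c : R) : oint 1 (fun _ : 'rV[R]_m => c) = c / m`!%:R.
Proof.
suff o1 : oint 1 (fun _ : 'rV[R]_m => 1) = m`!%:R^-1.
  by rewrite -o1 -ointZ; [apply: oint_ext => y; rewrite mulr1|exact: continuous_const].
elim: m => [|m IH]; first by rewrite /= invr1.
have i1 : oint 1 (fun _ : 'rV[R]_1 => 1) = 1.
  rewrite ointS /=; apply: (etrans (@int0_FTC2 R id (fun=> 1) 1 _ _ _ _)) => //=.
  - exact: continuous_const.
  - exact: continuous_ident.
  - by rewrite subr0.
have c1 k : continuous (fun _ : 'rV[R]_k => (1 : R)) by exact: continuous_const.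
have := shuffle_product (esym (add1n m)) (c1 1%N) (c1 m) ler01.
rewrite i1 IH !mul1r.
rewrite sumr_const -[_ *+ _]mulr_natl.
have -> : #|[pred A : {set 'I_m.+1} | #|A| == 1%N]| = m.+1.
  by rewrite -[RHS](bin1 m.+1) -[X in 'C(X, _)]card_ord -card_draws cardsE.
move=> E; apply: (mulfI (x := m.+1%:R)); first by rewrite pnatr_eq0.
by rewrite E factS natrM invfM mulrA divff ?mul1r // pnatr_eq0.
Qed.

Variables (d : nat) (G : 'M[R]_d).
Hypothesis uG : G \in unitmx.

Lemma kelt_inj n m (J : ksub n m) : injective (kelt J).
Proof. by move=> a b /enum_val_inj /cast_ord_inj. Qed.

Lemma kelt_mem n m (J : ksub n m) a : kelt J a \in val J.
Proof. exact: enum_valP. Qed.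

(** If J and K differ, an element of J that is not in K gives a zero row. *)
Lemma det_kelt m (J K : ksub d m) :
  \det (\matrix_(a < m, b < m) (kelt J a == kelt K b)%:R : 'M[R]_m) = (J == K)%:R.
Proof.
case: (eqVneq J K) => [->|JK].
  rewrite (_ : \matrix_(_, _) _ = 1%:M) ?det1 //.
  by apply/matrixP => a b; rewrite !mxE (inj_eq (@kelt_inj _ _ K)).
have [a aK] : exists a, kelt J a \notin val K.
  apply/existsP; apply: contraT; rewrite negb_exists => /forallP JK'.
  case/eqP: JK; apply: val_inj; apply/eqP; rewrite eqEcard.
  rewrite (eqP (valP J)) (eqP (valP K)) leqnn andbT; apply/fintype.subsetP => i iJ.
  pose a := cast_ord (eqP (valP J)) (enum_rank_in iJ i).
  have -> : i = kelt J a.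
    by rewrite /kelt /a cast_ordK enum_rankK_in.
  by have := JK' a; rewrite negbK.
rewrite (expand_det_row _ a) big1 // => b _; rewrite mxE.
by case: eqP => [E|]; rewrite ?mul0r //; rewrite E kelt_mem in aK.
Qed.

Lemma edge_par_mx m (J : ksub d m) (s : 'S_m) a :
  row a (edge_mx R m *m par_mx G J s) = row (kelt J (s a)) G.
Proof.
rewrite row_mul row_edge_mx mulmxBl -!rowE; apply/rowP => l; rewrite !mxE !summxE.
rewrite (bigD1 a) /= ?lift0 //= mxE.
rewrite (eq_bigl (fun c : 'I_m => (c < a)%N)) ?addrK // => c.
by rewrite /bump leq0n add1n ltnS andbC ltn_neqAle.
Qed.

(** The simplex of s is affine, with edges the rows of G in J in the order s;
    the integrand is constant and the simplex has the volume 1 / m!. *)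
Lemma sint_par m (J K : ksub d m) (s : 'S_m) :
  sint (linear_simplex (M := quotT G) (par_mx G J s)) (dp G K) =
  (-1) ^+ s * (J == K)%:R / m`!%:R.
Proof.
set W := par_mx G J s.
have sW : smooth_map (fun t : 'rV[R]_m.+1 => t *m W) := smooth_map_lin W.
rewrite (@sintE R (quotT G) m _ (dp G K) (fun t => t *m W) (lattice_cover_quotT uG) sW) //.
rewrite -oint1_cst; apply: oint_ext => y.
have JE : jacobian (fun y => bary y *m W) y = edge_mx R m *m W.
  rewrite (jacobian_affine (delta_mx 0 0) (edge_mx R m) y sW); congr (_ *m _).
  apply/row_matrixP => i; rewrite row_jacobian //; apply: (etrans (derive_mulmxr _ _ _)).
  by rewrite -rowE.
rewrite JE /= /dp_fun -det_kelt -det_perm -det_mulmx -row_permE; congr (\det _).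
apply/matrixP => a b; rewrite [LHS]mxE [RHS]mxE [RHS]mxE.
have -> : (edge_mx R m *m W *m invmx G) a (kelt K b) =
    (row (kelt J (s a)) G *m invmx G) 0 (kelt K b).
  by rewrite -edge_par_mx -row_mul [RHS]mxE.
by rewrite -row_mul mulmxV // !mxE.
Qed.

Lemma chint_par m (J K : ksub d m) : chint (par_chain G J) (dp G K) = (J == K)%:R.
Proof.
rewrite /par_chain chint_suml.
rewrite (eq_bigr (fun=> (J == K)%:R / m`!%:R)); last first.
  move=> s _; rewrite chint_scaleU sint_par rmorphXn rmorphN1 !mulrA.
  by rewrite -expr2 sqrr_sign mul1r.
rewrite sumr_const card_Sn -[_ *+ _]mulr_natr divfK //.
Qed.

(** By the theorem of Stokes the period only depends on the classes, so it may
    be computed on the coordinate subtori with the forms dp_J. *)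
Lemma chint_splittings m (a b : ext d m) (z : Defs.cycle (quotT G) m)
    (w : closed_form (quotT G) m) :
  hclass z = ext_homology G a -> dRclass w = ext_deRham G b ->
  chint z w = (\sum_J a J * b J)%:~R.
Proof.
move=> za wb.
(* The representatives of the two classes for which the periods are known. *)
pose z0 : Defs.cycle (quotT G) m := \sum_J par_cycle G J *~ a J.
pose w0 : closed_form (quotT G) m := \sum_J dp_closed_form G J *~ b J.
have GP := lattice_cover_quotT uG.
rewrite (@chint_hclass _ _ _ z z0 w GP); last first.
  rewrite za /hclass raddf_sum; apply: eq_bigr => J _.
  by rewrite raddfMz.
rewrite (@chint_dRclass _ _ _ z0 w w0 GP); last first.
  rewrite wb /dRclass raddf_sum; apply: eq_bigr => J _.
  by rewrite raddfMz.
have -> : cycle_chain z0 = \sum_J par_chain G J *~ a J.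
  by rewrite -[LHS]/(val z0) raddf_sum; apply: eq_bigr => J _; rewrite raddfMz.
have -> : closed_val w0 = \sum_J dp G J *~ b J.
  by rewrite -[LHS]/(val w0) raddf_sum; apply: eq_bigr => J _; rewrite raddfMz.
rewrite chint_suml rmorph_sum; apply: eq_bigr => J _.
rewrite chint_sumr (bigD1 J) //= big1 ?addr0 => [|K KJ].
  by rewrite raddfMz /= chint_mulzl chint_par eqxx -mulrzA mulrC.
by rewrite raddfMz /= chint_mulzl chint_par eq_sym (negPf KJ) !mul0rz.
Qed.

End TorusPairing.

Section Assembly.
Variable R : realType.

Lemma kcompl_inj n k : injective (@kcompl n k).
Proof. by move=> A B /(congr1 val) /= /finset.setC_inj /val_inj. Qed.

Lemma ext_compl_kcompl n k (alpha : ext n k) I :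
  ext_compl alpha (kcompl I) = alpha I * (-1) ^+ shuffle (val I).
Proof.
rewrite /ext_compl sum_ffunE (bigD1 I) //= big1 => [|J JI].
  by rewrite addr0 ffunMzE ffunE eqxx mulrzz mul1r.
by rewrite ffunMzE ffunE (inj_eq (@kcompl_inj _ _)) eq_sym (negPf JI) mul0rz.
Qed.

Lemma ext_compl_basisE n k (I : ksub n k) :
  ext_compl (ext_basis I) = ext_basis (kcompl I) *~ (-1) ^+ shuffle (val I).
Proof.
rewrite /ext_compl (bigD1 I) //= big1 => [|J JI]; first by rewrite addr0 ffunE eqxx mul1r.
by rewrite ffunE (negPf JI) mul0r mulr0z.
Qed.

(** The signs of mu in the two identifications of coefficients cancel. *)
Lemma ext_compl_pairing n k (I : ksub n k) (alpha : ext n k) :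
  \sum_J ext_compl (ext_basis I) J * ext_compl alpha J = alpha I.
Proof.
rewrite ext_compl_basisE (bigD1 (kcompl I)) //= big1 => [|J JI].
  rewrite addr0 ffunMzE ffunE eqxx ext_compl_kcompl mulrzz mul1r mulrCA.
  by rewrite -expr2 sqrr_sign mulr1.
by rewrite ffunMzE ffunE (negPf JI) mul0rz mul0r.
Qed.

Variables (n : nat) (G1 V : 'M[R]_n).
Hypotheses (uG1 : G1 \in unitmx) (uV : V \in unitmx).

Lemma dual_basis_unit : dual_basis V \in unitmx.
Proof. by rewrite /dual_basis unitmx_tr unitmx_inv. Qed.

Lemma lattice_cover_tropX : lattice_cover (tropX G1 V).
Proof.
apply: lattice_cover_quotT; rewrite unitmxE det_ublock unitrM -!unitmxE uG1.
exact: dual_basis_unit.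
Qed.

Lemma pullback_triv_inv m (w : dform (prodT (tropB G1) (tropF V)) m) :
  pullback (triv_inv G1 V) (pullback (triv G1 V) w) = w.
Proof.
apply: val_inj; apply/funext => x; apply/funext => A.
by rewrite /= /pullback_fun /= !mulmx1.
Qed.

End Assembly.

Theorem proposition5p3 (R : realType) (n : nat) (G1 V : 'M[R]_n)
    (hG1 : G1 \in unitmx) (hV : V \in unitmx) (j k : nat)
    (c : trop_chain G1 j k) (delta : trop_cochain G1 j k)
    (kappa : forall m : nat, {additive homology (tropF V) m -> chain (tropF V) m})
    (kappa' : forall m : nat,
      {additive int_cohomology (dual_basis V) m -> dform (tropF V) m}) :
  is_cycle_splitting kappa ->
  is_form_splitting kappa' ->
  trop_int c delta = chint (phihat kappa c) (psihat kappa' delta).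
Proof.
move=> kP k'P.
have BP : lattice_cover (tropB G1) := lattice_cover_quotT hG1.
have FP : lattice_cover (tropF V) := lattice_cover_quotT (dual_basis_unit hV).
have BFP := lattice_cover_prod BP FP; have XP := lattice_cover_tropX hG1 hV.
rewrite /psihat chint_sumr; apply: eq_bigr => -[alpha eta] _ /=.
rewrite /phihat chint_suml; apply: eq_bigr => I _.
rewrite chint_cpush // pullback_triv_inv chint_cross // mulrC; congr (_ * _).
(* It remains to see that the period of the two splittings is alpha (v_I). *)
have [z [-> zE]] := kP _ (ext_homology (dual_basis V) (ext_compl (ext_basis I))).
have [w [-> wE]] := k'P _ (ext_cohomology (dual_basis V) (ext_compl alpha)).
by rewrite (chint_splittings (dual_basis_unit hV) zE wE) ext_compl_pairing.
Qed.
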